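(* Let $\mathcal{H}$ be a separable infinite-dimensional Hilbert space and let $T$ and $T_0$ be two contractions on $\mathcal{H}$ such that $T_0$ is a strict contraction (that is, $\|T_0\|<1$) and $T-T_0\in\mathcal{B}_1(\mathcal{H})$. Let $\xi\in L^1([0,2\pi])$ be a real-valued spectral shift function for the pair $(T,T_0)$, and let $\widetilde{\xi}(z,\bar z)=(P\xi)(z)$, $z\in\mathbb{D}$, be its Poisson integral. Then for every $\psi\in\widetilde{\mathcal{G}}$ the operator $\widetilde{\psi}(T,T^* )-\widetilde{\psi}(T_0,T_0^* )$ is trace class and $$\mathrm{Tr}_{\mathcal{H}}\Big\{\widetilde{\psi}(T,T^* )-\widetilde{\psi}(T_0,T_0^* )\Big\}=\int_{\mathbb{D}}J\big(\widetilde{\xi},\widetilde{\psi}\big)(z,\bar z)\,dz\wedge d\bar z,$$ where $$J\big(\widetilde{\xi},\widetilde{\psi}\big)=\frac{\partial\widetilde{\xi}}{\partial z}\frac{\partial\widetilde{\psi}}{\partial\bar z}-\frac{\partial\widetilde{\psi}}{\partial z}\frac{\partial\widetilde{\xi}}{\partial\bar z}$$ is the Jacobian of $\widetilde{\xi}$ and $\widetilde{\psi}$ on $\mathbb{D}$, $dz\wedge d\bar z=-2i\,dx\,dy$ with $dx\,dy$ the planar Lebesgue measure, and the integral on the right-hand side is to be interpreted as the improper integral $$\lim_{R\uparrow1}\int_{\{z:\,|z|\le R\}}J\big(\widetilde{\xi},\widetilde{\psi}\big)(z,\bar z)\,dz\wedge d\bar z\qquad (R<1).$$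
   Context: $\mathcal{H}$ is a complex Hilbert space, $\mathcal{B}(\mathcal{H})$ is the algebra of bounded linear operators on $\mathcal{H}$, $\mathcal{B}_1(\mathcal{H})$ is the space of trace-class operators, and $\mathrm{Tr}_{\mathcal{H}}$ is the trace. A contraction is an operator $T\in\mathcal{B}(\mathcal{H})$ with $\|T\|\le1$; it is strict if $\|T\|<1$. $\mathbb{D}$ is the open unit disc, $\mathbb{T}$ the unit circle. For an integrable $f$ on $\mathbb{T}$ (functions on $\mathbb{T}$ are identified with functions of $t\in[0,2\pi]$ via $t\mapsto e^{it}$), $\hat f(n)=\frac1{2\pi}\int_0^{2\pi}f(e^{it})e^{-int}\,dt$, $n\in\mathbb{Z}$. Spectral shift function. Let $\mathcal{G}$ be the class of functions $\phi(z)=\sum_{k=0}^\infty a_kz^k$ with $a_k\in\mathbb{C}$ and $\sum_{k=0}^\infty|ka_k|<\infty$, and for a contraction $T$ put $\phi(T)=\sum_{k\ge0}a_kT^k$. For $T,T_0$ as in the theorem, a spectral shift function for $(T,T_0)$ is a real-valued $\xi\in L^1([0,2\pi])$ such that $$\mathrm{Tr}_{\mathcal{H}}\{\phi(T)-\phi(T_0)\}=\int_0^{2\pi}\frac{d}{dt}\{\phi(e^{it})\}\,\xi(t)\,dt\quad\text{for all }\phi\in\mathcal{G};$$ such a $\xi$ exists and is unique up to an additive constant. Poisson integral. For $f\in L^1(\mathbb{T})$ and $z\in\mathbb{D}$, $$(Pf)(z)=\frac1{2\pi}\int_0^{2\pi}\frac{1-|z|^2}{|e^{it}-z|^2}f(e^{it})\,dt=\hat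 f(0)+\sum_{n\ge1}\hat f(-n)\bar z^n+\sum_{n\ge1}\hat f(n)z^n.$$ The class $\widetilde{\mathcal{G}}$ consists of all (integrable) functions $\psi:\mathbb{T}\to\mathbb{C}$ with $\sum_{n=-\infty}^\infty|n\hat\psi(n)|<\infty$. For $\psi\in\widetilde{\mathcal{G}}$ and $|z|\le1$, $$\widetilde\psi(z,\bar z)=\hat\psi(0)+\sum_{n=1}^\infty\hat\psi(-n)\bar z^n+\sum_{n=1}^\infty\hat\psi(n)z^n,$$ and for a contraction $T$ on $\mathcal{H}$, $$\widetilde\psi(T,T^* )=\hat\psi(0)I+\sum_{n=1}^\infty\hat\psi(-n)(T^* )^n+\sum_{n=1}^\infty\hat\psi(n)T^n$$ (convergent in operator norm). $\partial/\partial z$ and $\partial/\partial\bar z$ are the Wirtinger derivatives $\frac12(\partial_x-i\partial_y)$ and $\frac12(\partial_x+i\partial_y)$, where $z=x+iy$. *)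

(* Defs.v *)
From HB Require Import structures.
From mathcomp Require Import all_boot all_order all_algebra.
From mathcomp Require Import all_classical all_reals all_analysis.
From mathcomp Require Import complex.

Set Implicit Arguments.
Unset Strict Implicit.
Unset Printing Implicit Defensive.

Import Order.TTheory GRing.Theory Num.Theory.
Import numFieldNormedType.Exports.

Local Open Scope classical_set_scope.
Local Open Scope ring_scope.
Local Open Scope complex_scope.

(* The R-valued real and imaginary parts, not the R[i]-valued ones of Num. *)
Local Notation Re := complex.Re.
Local Notation Im := complex.Im.

(* The usual topology of the complex plane: the one carried by R[i]^o. *)
HB.instance Definition _ (R : realType) := NormedModule.copy R[i] R[i]^o.

(* In MathComp the norm of a complex normed module is R[i]-valued (with zero
   imaginary part); rnorm is the corresponding real number. *)
Definition rnorm (R : realType) (V : normedModType R[i]) (x : V) : R :=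
  Re `|x|.

(* Complex Hilbert spaces; the inner product is linear on the left. *)
HB.mixin Record NormedModule_isHilbert (R : realType) H
    & CompleteNormedModule R[i] H := {
  inner : H -> H -> R[i];
  inner_linearl : forall z : H, linear_for *%R (inner ^~ z);
  innerC : forall x y : H, inner y x = (inner x y)^*;
  innerxx : forall x : H, inner x x = `|x| ^+ 2
}.

#[short(type="hilbertType")]
HB.structure Definition Hilbert (R : realType) :=
  {H of CompleteNormedModule R[i] H & NormedModule_isHilbert R H}.

Definition separable (T : topologicalType) : Prop :=
  exists S : set T, countable S /\ dense S.

Definition infinite_dimensional (K : nzRingType) (V : lmodType K) : Prop :=
  forall (n : nat) (v : 'I_n -> V),
    exists x : V, ~ exists c : 'I_n -> K, x = \sum_i c i *: v i.

Section BoundedOperators.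
Variables (R : realType) (H : hilbertType R).

Definition bounded_linear : {pred H -> H} :=
  mem [set f : H -> H | linear f /\
    exists M : R[i], forall x, `|f x| <= M * `|x|].

Lemma bounded_linearP (f : H -> H) : reflect
  (linear f /\ exists M : R[i], forall x, `|f x| <= M * `|x|)
  (f \in bounded_linear).
Proof. by apply: (iffP idP); rewrite inE. Qed.

Lemma bounded_linear_ge0 (f : H -> H) : f \in bounded_linear ->
  exists2 M : R[i], 0 <= M & forall x, `|f x| <= M * `|x|.
Proof.
move=> /bounded_linearP[lf [M fM]]; case: (pselect (exists x : H, x != 0)).
  move=> [x x0]; exists M => //.
  rewrite -(pmulr_lge0 _ (_ : 0 < `|x|)) ?normr_gt0//.
  exact: le_trans (fM x).
move=> nx; exists 0 => // x; rewrite mul0r.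
have -> : x = 0 by apply/eqP/negPn/negP => x0; apply: nx; exists x.
by apply: le_trans (fM 0) _; rewrite normr0 mulr0.
Qed.

Lemma bounded_linear_submod_closed : submod_closed bounded_linear.
Proof.
split=> [|a f g bf bg].
  apply/bounded_linearP; split; first by move=> b x y; rewrite /= scaler0 addr0.
  by exists 0 => x; rewrite normr0 mul0r.
have [M M0 fM] := bounded_linear_ge0 bf.
have [N N0 gN] := bounded_linear_ge0 bg.
have [lf _] := bounded_linearP _ bf; have [lg _] := bounded_linearP _ bg.
apply/bounded_linearP; split.
  move=> b x y; rewrite !fctE /= lf lg !scalerDr !scalerA (mulrC a b).
  by rewrite addrACA.
exists (`|a| * M + N) => x; rewrite !fctE /=; apply: le_trans (ler_normD _ _) _.
by rewrite mulrDl normrZ lerD// -mulrA ler_wpM2l.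
Qed.

HB.instance Definition _ :=
  GRing.isSubmodClosed.Build R[i] (H -> H) bounded_linear
    bounded_linear_submod_closed.

Record bop := Bop {
  bop_fun :> H -> H;
  bop_subproof : bop_fun \in bounded_linear
}.

HB.instance Definition _ := [isSub for bop_fun].
HB.instance Definition _ := [Choice of bop by <:].
HB.instance Definition _ := [SubChoice_isSubLmodule of bop by <:].

Lemma bop_linear (T : bop) : linear T.
Proof. by have /bounded_linearP[] := bop_subproof T. Qed.

HB.instance Definition _ (T : bop) :=
  GRing.isLinear.Build R[i] H H *:%R T (@bop_linear T).

Lemma bop_ext (S T : bop) : S =1 T -> S = T.
Proof. by move=> ST; apply/val_inj/funext. Qed.

Lemma bop_bounded (T : bop) :
  exists2 M : R[i], 0 <= M & forall x, `|T x| <= M * `|x|.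
Proof. exact: bounded_linear_ge0 (bop_subproof T). Qed.

Lemma bop_id_subproof : (fun x : H => x) \in bounded_linear.
Proof.
by apply/bounded_linearP; split=> //; exists 1 => x; rewrite mul1r.
Qed.

Lemma bop_comp_subproof (S T : bop) : (S \o T) \in bounded_linear.
Proof.
apply/bounded_linearP; split=> [a x y|] /=; first by rewrite !linearP.
have [M M0 SM] := bop_bounded S; have [N N0 TN] := bop_bounded T.
exists (M * N) => x; apply: le_trans (SM _) _.
by rewrite -mulrA ler_wpM2l.
Qed.

Definition bop_id := Bop bop_id_subproof.
Definition bop_comp (S T : bop) := Bop (bop_comp_subproof S T).

Lemma bop_compA : associative bop_comp.
Proof. by move=> S T U; apply: bop_ext. Qed.
Lemma bop_comp1o : left_id bop_id bop_comp.
Proof. by move=> S; apply: bop_ext. Qed.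
Lemma bop_compo1 : right_id bop_id bop_comp.
Proof. by move=> S; apply: bop_ext. Qed.
Lemma bop_compDl : left_distributive bop_comp +%R.
Proof. by move=> S T U; apply: bop_ext. Qed.
Lemma bop_compDr : right_distributive bop_comp +%R.
Proof. by move=> S T U; apply: bop_ext => x /=; rewrite linearD. Qed.

HB.instance Definition _ := GRing.Zmodule_isPzRing.Build bop
  bop_compA bop_comp1o bop_compo1 bop_compDl bop_compDr.

Definition opnorm (T : bop) : R[i] :=
  (sup [set rnorm (T x) | x in [set x : H | `|x| <= 1]])%:C.

Lemma normE (V : normedModType R[i]) (x : V) : `|x| = (rnorm x)%:C.
Proof. by rewrite /rnorm RRe_real// normr_real. Qed.

Lemma opnorm_has_sup (T : bop) :
  has_sup [set rnorm (T x) | x in [set x : H | `|x| <= 1]].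
Proof.
split; first by exists (rnorm (T 0)); exists 0 => //=; rewrite normr0.
have [M M0 TM] := bop_bounded T; exists (Re M) => _ [x /= x1 <-].
have : `|T x| <= M by apply: le_trans (TM x) _; rewrite ler_piMr.
by rewrite lecE => /andP[].
Qed.

Lemma opnorm_ub (T : bop) (x : H) : `|x| <= 1 -> `|T x| <= opnorm T.
Proof.
move=> x1; rewrite normE lecR; apply: sup_upper_bound.
  exact: opnorm_has_sup.
by exists x.
Qed.

Lemma opnorm_lub (T : bop) (M : R[i]) :
  (forall x, `|x| <= 1 -> `|T x| <= M) -> opnorm T <= M.
Proof.
move=> TM; have M0 : 0 <= M by apply: le_trans (TM 0 _); rewrite ?normr0.
have MR : M \is Num.real by exact: ger0_real.
rewrite -(RRe_real MR) lecR; apply: ge_sup.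
  by have [] := opnorm_has_sup T.
move=> _ [x /= x1 <-]; have := TM x x1.
by rewrite lecE => /andP[].
Qed.

Lemma opnormP (T : bop) (x : H) : `|T x| <= opnorm T * `|x|.
Proof.
have [->|x0] := eqVneq x 0; first by rewrite linear0 !normr0 mulr0.
have nx : 0 < `|x| by rewrite normr_gt0.
rewrite -ler_pdivrMr// mulrC -[`|x|^-1]ger0_norm ?invr_ge0 ?normr_ge0// -normrZ.
rewrite -linearZ; apply: opnorm_ub.
by rewrite normrZ ger0_norm ?invr_ge0 ?normr_ge0// mulVf// normr_eq0.
Qed.

Lemma opnorm_ge0 (T : bop) : 0 <= opnorm T.
Proof. by apply: le_trans (opnorm_ub T (_ : `|0| <= 1)); rewrite ?normr0. Qed.

Lemma opnormD (S T : bop) : opnorm (S + T) <= opnorm S + opnorm T.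
Proof.
apply: opnorm_lub => x x1; apply: le_trans (ler_normD _ _) _.
by rewrite lerD// opnorm_ub.
Qed.

Lemma opnormZ_le (a : R[i]) (T : bop) : opnorm (a *: T) <= `|a| * opnorm T.
Proof.
by apply: opnorm_lub => x x1; rewrite normrZ ler_wpM2l// opnorm_ub.
Qed.

Lemma opnormZ (a : R[i]) (T : bop) : opnorm (a *: T) = `|a| * opnorm T.
Proof.
apply/le_anti; rewrite opnormZ_le/=.
have [->|a0] := eqVneq a 0; first by rewrite normr0 mul0r opnorm_ge0.
rewrite -ler_pdivlMl ?normr_gt0// -normfV.
by have := opnormZ_le a^-1 (a *: T); rewrite scalerA mulVf// scale1r.
Qed.

Lemma opnorm_eq0 (T : bop) : opnorm T = 0 -> T = 0.
Proof.
move=> T0; apply: bop_ext => x; apply/eqP; rewrite -normr_le0.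
by have := opnormP T x; rewrite T0 mul0r.
Qed.

HB.instance Definition _ := Lmodule_isNormed.Build R[i] bop
  opnormD opnormZ opnorm_eq0.

(* The unique S with <T x, y> = <x, S y>; it exists by the Riesz theorem. *)
Definition adj (T : bop) : bop :=
  xget 0 [set S : bop | forall x y, inner (T x) y = inner x (S y)].

(* As R[i] is ordered by 0 <= z <-> (Im z = 0 and 0 <= Re z), this is the usual
   notion, and it entails self-adjointness. *)
Definition positive_op (A : bop) : Prop := forall x, 0 <= inner (A x) x.

(* |T|: the unique positive square root of T^* T. *)
Definition absop (T : bop) : bop :=
  xget 0 [set A : bop | positive_op A /\ A * A = adj T * T].

Definition orthonormal_basis (e : nat -> H) : Prop :=
  (forall m n, inner (e m) (e n) = (m == n)%:R) /\
  (forall x, series (fun n => inner x (e n) *: e n) @ \oo --> x).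

(* Such a basis exists when H is separable and infinite-dimensional, and
   neither trace_class nor trace (on trace-class operators) depends on which
   one is chosen. *)
Definition onb : nat -> H := xget (fun=> 0) orthonormal_basis.

Definition trace_class (T : bop) : Prop :=
  (\sum_(0 <= n <oo) (Re (inner (absop T (onb n)) (onb n)))%:E < +oo)%E.

Definition trace (T : bop) : R[i] :=
  limn (series (fun n => inner (T (onb n)) (onb n))).

End BoundedOperators.

Arguments adj {R H}.
Arguments absop {R H}.
Arguments trace_class {R H}.
Arguments trace {R H}.

Section ComplexAnalysis.
Variable R : realType.
Implicit Types (t : R) (z : R[i]).

Definition expi t : R[i] := cos t +i* sin t.

Definition Cintegrable (d : measure_display) (X : measurableType d)
    (mu : {measure set X -> \bar R}) (D : set X) (f : X -> R[i]) : Prop :=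
  mu.-integrable D (fun x => (Re (f x))%:E) /\
  mu.-integrable D (fun x => (Im (f x))%:E).

Definition Cintegral (d : measure_display) (X : measurableType d)
    (mu : {measure set X -> \bar R}) (D : set X) (f : X -> R[i]) : R[i] :=
  (\int[mu]_(x in D) Re (f x)) +i* (\int[mu]_(x in D) Im (f x)).

Definition Cderive1 (f : R -> R[i]) t : R[i] :=
  derive1 (fun s => Re (f s)) t +i* derive1 (fun s => Im (f s)) t.

Definition sum_ge1 (V : normedModType R[i]) (u : nat -> V) : V :=
  limn (fun N => \sum_(1 <= n < N) u n).

(* Functions on the unit circle are given as functions of t in [0, 2 pi]. *)
Definition circle_int (f : R -> R[i]) : R[i] :=
  Cintegral lebesgue_measure `[0, 2 * pi] f.

Definition fourier (f : R -> R[i]) (n : int) : R[i] :=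
  ((2 * pi)^-1)%:C * circle_int (fun t => f t * expi (- (n%:~R * t))).

Definition poisson (f : R -> R[i]) z : R[i] :=
  ((2 * pi)^-1)%:C * circle_int (fun t =>
    ((1 - rnorm z ^+ 2) / rnorm (expi t - z) ^+ 2)%:C * f t).

(* The class G, in terms of the coefficients of the power series. *)
Definition class_G (a : nat -> R[i]) : Prop :=
  (\sum_(0 <= k <oo) (rnorm (k%:R * a k))%:E < +oo)%E.

Definition power_series (a : nat -> R[i]) z : R[i] :=
  limn (series (fun k => a k * z ^+ k)).

Definition class_Gtilde (psi : R -> R[i]) : Prop :=
  Cintegrable lebesgue_measure `[0, 2 * pi] psi /\
  (\esum_(n in [set: int]) (rnorm (n%:~R * fourier psi n))%:E < +oo)%E.

Definition tilde (psi : R -> R[i]) z : R[i] :=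
  fourier psi 0 + sum_ge1 (fun n => fourier psi (- n%:Z) * z^* ^+ n)
                + sum_ge1 (fun n => fourier psi n%:Z * z ^+ n).

Definition partial_x (F : R[i] -> R[i]) z : R[i] :=
  Cderive1 (fun x => F (x +i* Im z)) (Re z).
Definition partial_y (F : R[i] -> R[i]) z : R[i] :=
  Cderive1 (fun y => F (Re z +i* y)) (Im z).
Definition partial_z (F : R[i] -> R[i]) z : R[i] :=
  2^-1 * (partial_x F z - 'i * partial_y F z).
Definition partial_zbar (F : R[i] -> R[i]) z : R[i] :=
  2^-1 * (partial_x F z + 'i * partial_y F z).

Definition wirtinger_jacobian (F G : R[i] -> R[i]) z : R[i] :=
  partial_z F z * partial_zbar G z - partial_z G z * partial_zbar F z.

(* The integral of F against dz /\ dzbar = - 2 i dx dy over |z| <= r. *)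
Definition disc_integral (F : R[i] -> R[i]) (r : R) : R[i] :=
  - 2 * 'i * Cintegral (lebesgue_measure \x lebesgue_measure)%E
    [set p : R * R | rnorm (p.1 +i* p.2) <= r] (fun p => F (p.1 +i* p.2)).

End ComplexAnalysis.

Section FunctionalCalculus.
Variables (R : realType) (H : hilbertType R).

Definition op_power_series (a : nat -> R[i]) (T : bop H) : bop H :=
  limn (series (fun k => a k *: T ^+ k)).

Definition op_tilde (psi : R -> R[i]) (T : bop H) : bop H :=
  fourier psi 0 *: (1 : bop H) + sum_ge1 (fun n => fourier psi (- n%:Z) *: adj T ^+ n)
                     + sum_ge1 (fun n => fourier psi n%:Z *: T ^+ n).

Definition spectral_shift (T T0 : bop H) (xi : R -> R) : Prop :=
  lebesgue_measure.-integrable `[0, 2 * pi] (EFin \o xi) /\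
  forall a : nat -> R[i], class_G a ->
    trace (op_power_series a T - op_power_series a T0) =
    circle_int (fun t =>
      Cderive1 (fun s => power_series a (expi s)) t * (xi t)%:C).

End FunctionalCalculus.

(* Main.v *)
(**
Both sides equal
  2 pi i \sum_(n >= 1) n (psi^(n) xi^(-n) - psi^(-n) xi^(n)).

Trace side. T^n - T0^n telescopes into n terms T^j (T - T0) T0^(n-1-j), so its
trace norm is at most n |T - T0|_1. As \sum |n psi^(n)| is finite, the series
of psi~(T) - psi~(T0) converges in trace norm and the trace may be
taken termwise. The spectral shift property for phi(z) = z^n evaluates
Tr (T^n - T0^n) = 2 pi i n xi^(-n), and adjoints give the conjugates.

Area side. P xi and psi~ are sums of a power series in z and one in the
conjugate of z, so on the disc of radius r the Jacobian is a uniformly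
convergent double series of monomials z^a conj(z)^b. Only those with a = b have a
nonzero integral, by Green's formula, and the integral becomes the above series
with an additional factor r^(2n). It remains to let r tend to 1, which is
Abel's theorem for an absolutely convergent series.

The trace norm is handled through the sums \sum_k |<X U e_k, V e_k>| over
contractions U and V, which are visibly stable under the operations needed.
*)
Require Import Defs.
From HB Require Import structures.
From mathcomp Require Import all_boot all_order all_algebra.
From mathcomp Require Import all_classical all_reals all_analysis.
From mathcomp Require Import complex measurable_realfun.
From mathcomp Require Import ring lra.
Import Order.TTheory GRing.Theory Num.Theory.
Import numFieldNormedType.Exports.
Local Open Scope classical_set_scope.
Local Open Scope ring_scope.
Local Open Scope complex_scope.
Set Implicit Arguments.
Unset Strict Implicit.
Unset Printing Implicit Defensive.
Local Notation Re := complex.Re.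
Local Notation Im := complex.Im.

(** * Real-valued norms *)

(** [adj] and [absop] are choices with a default value, so adjoints and positive square roots must
    be shown to exist before either can be used. Both are built by hand: the adjoint by its
    expansion in the basis, the square root by a monotone iteration. The main obstacle is that
    [trace_class] speaks of |X| along a single basis, where stability under sums, products, adjoints
    and norm limits is invisible. Passing from there to [trace_bound] and back is usually done by
    the polar decomposition X = W |X|. Here W is replaced by X p, where p is a polynomial in |X|
    that nearly inverts it. Since |X| p = 1 - B^n with B a contraction, X p has norm at most 2, and
    this is where the factors 2 in the trace estimates come from. The error is made small on
    finitely many vectors at a time, which suffices because every estimate concerns finite sums. On
    the area side polar coordinates are avoided. Green's formula, in x and in y, is applied to z^a
    conj(z)^(b+1), and the two results are combined into the derivative in conj(z), which is (b+1)
    z^a conj(z)^b. *)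

Section RealValuedNorm.
Variable R : realType.

Section Module.
Variable V : normedModType R[i].
Implicit Types (x y : V) (a : R[i]).

Lemma rnorm_ge0 x : 0 <= rnorm x.
Proof. by have := normr_ge0 x; rewrite normE ler0c. Qed.

Lemma rnorm0 : rnorm (0 : V) = 0.
Proof. by rewrite /rnorm normr0. Qed.

Lemma rnormN x : rnorm (- x) = rnorm x.
Proof. by rewrite /rnorm normrN. Qed.

Lemma rnormBC x y : rnorm (x - y) = rnorm (y - x).
Proof. by rewrite /rnorm distrC. Qed.

Lemma rnormD x y : rnorm (x + y) <= rnorm x + rnorm y.
Proof. by rewrite -lecR rmorphD/= -!normE ler_normD. Qed.

Lemma rnormB x y : rnorm (x - y) <= rnorm x + rnorm y.
Proof. by rewrite -(rnormN y) rnormD. Qed.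

Lemma rnorm_dist x y : `|rnorm x - rnorm y| <= rnorm (x - y).
Proof.
have h (u v : V) : rnorm u - rnorm v <= rnorm (u - v).
  by rewrite lerBlDr; apply: le_trans (rnormD _ _); rewrite subrK.
by rewrite ler_norml h lerNl opprB rnormBC h.
Qed.

Lemma rnormZ a x : rnorm (a *: x) = rnorm a * rnorm x.
Proof. by apply: complexI; rewrite rmorphM/= -!normE normrZ. Qed.

Lemma rnorm_eq0 x : rnorm x = 0 -> x = 0.
Proof. by move=> x0; apply/eqP; rewrite -normr_eq0 normE x0. Qed.

Lemma rnorm_sum (I : Type) (s : seq I) (P : pred I) (F : I -> V) :
  rnorm (\sum_(i <- s | P i) F i) <= \sum_(i <- s | P i) rnorm (F i).
Proof.
elim/big_rec2: _ => [|i y z _ h]; first by rewrite rnorm0.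
by apply: le_trans (rnormD _ _) _; rewrite lerD2l.
Qed.

(** A positive element of [R[i]] is real, so the complex radii that define the topology of [V] are
    exactly the real ones. Limits in [V] thereby become limits in [R], where squeezing is
    available. *)
Lemma cvg_rnormP {T : Type} (F : set_system T) {FF : Filter F} (u : T -> V) l :
  u @ F --> l <-> (fun t => rnorm (u t - l)) @ F --> (0 : R).
Proof.
split=> [/cvgrPdist_le h|/cvgrPdist_le h]; apply/cvgrPdist_le => e e0.
  have := h e%:C; rewrite ltcR => /(_ e0); apply: filterS => t.
  by rewrite normE lecR sub0r normrN ger0_norm ?rnorm_ge0// rnormBC.
have eE : e = (Re e)%:C by rewrite RRe_real// gtr0_real.
have := h (Re e); rewrite -ltcR -eE => /(_ e0); apply: filterS => t.
by rewrite normE eE lecR sub0r normrN ger0_norm ?rnorm_ge0// rnormBC.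
Qed.

Lemma cvg_rnorm {T : Type} (F : set_system T) {FF : Filter F} (u : T -> V) l :
  u @ F --> l -> (fun t => rnorm (u t)) @ F --> rnorm l.
Proof.
move=> /cvg_rnormP/cvgrPdist_le h; apply/cvgrPdist_le => e e0.
apply: filterS (h e e0) => t; rewrite sub0r normrN ger0_norm ?rnorm_ge0//.
by move=> h1; apply: le_trans h1; rewrite distrC rnorm_dist.
Qed.

Lemma rcvg_unique {T : Type} (F : set_system T) {FF : ProperFilter F}
    (u : T -> V) (a b : V) :
  u @ F --> a -> u @ F --> b -> a = b.
Proof. by apply: cvg_unique; exact: norm_hausdorff. Qed.

Lemma rcvg_lim {T : Type} (F : set_system T) {FF : ProperFilter F}
    (u : T -> V) (a : V) : u @ F --> a -> lim (u @ F) = a.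
Proof. by apply: cvg_lim; exact: norm_hausdorff. Qed.

End Module.

Lemma rcauchy_cvg (V : completeNormedModType R[i]) (u : nat -> V) :
  (forall e : R, 0 < e -> exists N, forall m n, (N <= m)%N -> (N <= n)%N ->
     rnorm (u m - u n) <= e) -> cvgn u.
Proof.
move=> h; apply/cauchy_cvgP/cauchy_exP => e e0.
have eE : e = (Re e)%:C by rewrite RRe_real// gtr0_real.
have [|N hN] := h (Re e / 2); first by rewrite divr_gt0// -ltcR -eE.
exists (u N), N => // n /= Nn; rewrite -ball_normE /ball_/= normE eE ltcR.
apply: le_lt_trans (hN _ _ (leqnn _) Nn) _.
by rewrite ltr_pdivrMr// ltr_pMr ?ltr1n// -ltcR -eE.
Qed.

Section Scalars.
Implicit Types (a b : R[i]) (x : R).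

Lemma rnormM a b : rnorm (a * b) = rnorm a * rnorm b.
Proof. exact: rnormZ. Qed.

Lemma rnormR x : rnorm x%:C = `|x|.
Proof. by rewrite /rnorm normc_def /= expr0n addr0 sqrtr_sqr. Qed.

Lemma rnorm_sqr a : rnorm a ^+ 2 = Re a ^+ 2 + Im a ^+ 2.
Proof. by rewrite /rnorm normc_def /= sqr_sqrtr// addr_ge0// sqr_ge0. Qed.

Lemma conjcB a b : conjc (a - b) = conjc a - conjc b. Proof. exact: rmorphB. Qed.
Lemma conjcM a b : conjc (a * b) = conjc a * conjc b. Proof. exact: rmorphM. Qed.
Lemma conjcX a n : conjc (a ^+ n) = conjc a ^+ n. Proof. exact: rmorphXn. Qed.

Lemma rnormJ a : rnorm (conjc a) = rnorm a.
Proof. by rewrite /rnorm normcJ. Qed.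

Lemma mulcJ a : a * conjc a = (rnorm a ^+ 2)%:C.
Proof. by rewrite rmorphXn/= -normE sqr_normc. Qed.

Lemma Re_le_rnorm a : `|Re a| <= rnorm a.
Proof. by have := normc_ge_Re a; rewrite normE lecR. Qed.

Lemma Im_le_rnorm a : `|Im a| <= rnorm a.
Proof.
rewrite -(@ler_pXn2r _ 2)// ?nnegrE ?normr_ge0 ?rnorm_ge0// rnorm_sqr.
by rewrite real_normK ?num_real// lerDr sqr_ge0.
Qed.

Lemma rnorm_le_ReIm a : rnorm a <= `|Re a| + `|Im a|.
Proof.
rewrite -(@ler_pXn2r _ 2)// ?nnegrE ?rnorm_ge0 ?addr_ge0// rnorm_sqr.
rewrite sqrrD !real_normK ?num_real//.
by rewrite addrAC lerDl mulrn_wge0// mulr_ge0.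
Qed.

Lemma rnorm1 : rnorm (1 : R[i]) = 1.
Proof. by rewrite (rnormR 1) normr1. Qed.

Lemma rnormX a n : rnorm (a ^+ n) = rnorm a ^+ n.
Proof. by elim: n => [|n ih]; rewrite ?expr0 ?rnorm1// !exprS rnormM ih. Qed.

Lemma rnorm_nat n : rnorm (n%:R : R[i]) = n%:R.
Proof. by rewrite -(rmorph_nat (real_complex R)) rnormR ger0_norm. Qed.

Lemma rnormi : rnorm ('i : R[i]) = 1.
Proof. by rewrite /rnorm normc_def /= expr0n add0r expr1n sqrtr1. Qed.

Lemma rnormV a : rnorm a^-1 = (rnorm a)^-1.
Proof.
have [->|a0] := eqVneq a 0; first by rewrite invr0 rnorm0 invr0.
have r0 : rnorm a != 0 by apply: contra_neq a0 => /rnorm_eq0.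
by apply: (mulIf r0); rewrite -rnormM mulVf// mulVf// rnorm1.
Qed.

Lemma ReD a b : Re (a + b) = Re a + Re b.
Proof. by case: a b => [? ?] [? ?]. Qed.
Lemma ImD a b : Im (a + b) = Im a + Im b.
Proof. by case: a b => [? ?] [? ?]. Qed.
Lemma ReN a : Re (- a) = - Re a.
Proof. by case: a. Qed.
Lemma ImN a : Im (- a) = - Im a.
Proof. by case: a. Qed.
Lemma ReB a b : Re (a - b) = Re a - Re b.
Proof. by rewrite ReD ReN. Qed.
Lemma ImB a b : Im (a - b) = Im a - Im b.
Proof. by rewrite ImD ImN. Qed.
Lemma ReM a b : Re (a * b) = Re a * Re b - Im a * Im b.
Proof. by case: a b => [? ?] [? ?]. Qed.
Lemma ImM a b : Im (a * b) = Re a * Im b + Im a * Re b.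
Proof. by case: a b => [? ?] [? ?]. Qed.
Lemma ReZ x a : Re (x%:C * a) = x * Re a.
Proof. by rewrite ReM/= mul0r subr0. Qed.
Lemma ImZ x a : Im (x%:C * a) = x * Im a.
Proof. by rewrite ImM/= mul0r addr0. Qed.
Lemma ReJ a : Re (conjc a) = Re a.
Proof. by case: a. Qed.
Lemma ImJ a : Im (conjc a) = - Im a.
Proof. by case: a. Qed.
Lemma complex_ext a b : Re a = Re b -> Im a = Im b -> a = b.
Proof. by case: a b => [? ?] [? ?] /= -> ->. Qed.

Lemma cvg_ReIm {T : Type} (F : set_system T) {FF : Filter F} (u : T -> R[i]) l :
  (fun t => Re (u t)) @ F --> Re l -> (fun t => Im (u t)) @ F --> Im l ->
  u @ F --> l.
Proof.
move=> /cvgrPdist_le hR /cvgrPdist_le hI; apply/cvg_rnormP/cvgrPdist_le => e e0.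
have e20 : 0 < e / 2 by rewrite divr_gt0.
move: (hR _ e20) (hI _ e20); apply: filterS2 => t h1 h2.
rewrite sub0r normrN ger0_norm ?rnorm_ge0// rnormBC.
apply: le_trans (rnorm_le_ReIm _) _.
by rewrite ReB ImB [leRHS]splitr lerD.
Qed.

Lemma cvg_Re {T : Type} (F : set_system T) {FF : Filter F} (u : T -> R[i]) l :
  u @ F --> l -> (fun t => Re (u t)) @ F --> Re l.
Proof.
move=> /cvg_rnormP/cvgrPdist_le h; apply/cvgrPdist_le => e e0.
apply: filterS (h e e0) => t; rewrite sub0r normrN ger0_norm ?rnorm_ge0//.
by move=> h1; apply: le_trans h1; rewrite -ReB -rnormN opprB; exact: Re_le_rnorm.
Qed.

Lemma cvg_Im {T : Type} (F : set_system T) {FF : Filter F} (u : T -> R[i]) l :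
  u @ F --> l -> (fun t => Im (u t)) @ F --> Im l.
Proof.
move=> /cvg_rnormP/cvgrPdist_le h; apply/cvgrPdist_le => e e0.
apply: filterS (h e e0) => t; rewrite sub0r normrN ger0_norm ?rnorm_ge0//.
by move=> h1; apply: le_trans h1; rewrite -ImB -rnormN opprB; exact: Im_le_rnorm.
Qed.

End Scalars.

Lemma ccauchy_cvg (u : nat -> R[i]) :
  (forall e : R, 0 < e -> exists N, forall m n, (N <= m)%N -> (N <= n)%N ->
     rnorm (u m - u n) <= e) -> cvgn u.
Proof.
move=> h.
have aux (f : R[i] -> R) : (forall a b, `|f a - f b| <= rnorm (a - b)) ->
    cvgn (f \o u).
  move=> hf; apply/cauchy_cvgP/cauchy_exP => e e0.
  have [|N hN] := h (e / 2); first by rewrite divr_gt0.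
  exists (f (u N)), N => // n /= Nn; rewrite -ball_normE /ball_/=.
  apply: le_lt_trans (hf _ _) _; apply: le_lt_trans (hN _ _ (leqnn _) Nn) _.
  by rewrite ltr_pdivrMr// ltr_pMr ?ltr1n.
have cR : cvgn (@Re R \o u) by apply: aux => a b; rewrite -ReB Re_le_rnorm.
have cI : cvgn (@Im R \o u) by apply: aux => a b; rewrite -ImB Im_le_rnorm.
apply/cvg_ex; exists (limn (@Re R \o u) +i* limn (@Im R \o u)).
exact: cvg_ReIm.
Qed.

End RealValuedNorm.

(** * Positive operators and square roots *)

Section InnerProduct.
Variables (R : realType) (H : hilbertType R).
Implicit Types (x y z : H) (a : R[i]).

Lemma innerDl x y z : inner (x + y) z = inner x z + inner y z.
Proof. by have := inner_linearl z 1 x y; rewrite scale1r mul1r. Qed.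

Lemma inner0l z : inner 0 z = 0.
Proof. by apply: (addrI (inner 0 z)); rewrite -innerDl !addr0. Qed.

Lemma innerZl a x z : inner (a *: x) z = a * inner x z.
Proof. by have := inner_linearl z a x 0; rewrite !addr0 inner0l addr0. Qed.

Lemma innerNl x z : inner (- x) z = - inner x z.
Proof. by rewrite -scaleN1r innerZl mulN1r. Qed.

Lemma innerBl x y z : inner (x - y) z = inner x z - inner y z.
Proof. by rewrite innerDl innerNl. Qed.

Lemma innerDr x y z : inner z (x + y) = inner z x + inner z y.
Proof. by rewrite innerC innerDl rmorphD/= -!innerC. Qed.

Lemma inner0r z : inner z 0 = 0.
Proof. by rewrite innerC inner0l conjc0. Qed.

Lemma innerZr a x z : inner z (a *: x) = conjc a * inner z x.
Proof. by rewrite innerC innerZl rmorphM/= -innerC. Qed.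

Lemma innerNr x z : inner z (- x) = - inner z x.
Proof. by rewrite innerC innerNl rmorphN/= -innerC. Qed.

Lemma innerBr x y z : inner z (x - y) = inner z x - inner z y.
Proof. by rewrite innerDr innerNr. Qed.

Lemma inner_suml (I : Type) (s : seq I) (P : pred I) (F : I -> H) z :
  inner (\sum_(i <- s | P i) F i) z = \sum_(i <- s | P i) inner (F i) z.
Proof. by elim/big_rec2: _ => [|i y w _ <-]; rewrite ?inner0l// innerDl. Qed.

Lemma inner_sumr (I : Type) (s : seq I) (P : pred I) (F : I -> H) z :
  inner z (\sum_(i <- s | P i) F i) = \sum_(i <- s | P i) inner z (F i).
Proof. by elim/big_rec2: _ => [|i y w _ <-]; rewrite ?inner0r// innerDr. Qed.

Lemma inner_rnorm x : inner x x = (rnorm x ^+ 2)%:C.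
Proof. by rewrite innerxx normE rmorphXn. Qed.

Lemma rnorm_innerC x y : rnorm (inner x y) = rnorm (inner y x).
Proof. by rewrite innerC rnormJ. Qed.

End InnerProduct.

Section PositiveOperators.
Variables (R : realType) (H : hilbertType R).
Implicit Types (x y z : H) (a : R[i]) (A S T : bop H).

Lemma bop1E x : (1 : bop H) x = x. Proof. by []. Qed.
Lemma bopDE S T x : (S + T) x = S x + T x. Proof. by []. Qed.
Lemma bopBE S T x : (S - T) x = S x - T x. Proof. by []. Qed.
Lemma bopME S T x : (S * T) x = S (T x). Proof. by []. Qed.
Lemma bopZE a S x : (a *: S) x = a *: S x. Proof. by []. Qed.
Lemma rnorm_bop T x : rnorm (T x) <= rnorm T * rnorm x.
Proof. by rewrite -lecR rmorphM/= -!normE; exact: opnormP. Qed.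

Lemma rnorm_bop_le T (M : R) : 0 <= M ->
  (forall x, rnorm (T x) <= M * rnorm x) -> rnorm T <= M.
Proof.
move=> M0 h; rewrite -lecR -normE; apply: opnorm_lub => x x1.
rewrite normE lecR; apply: le_trans (h x) _.
by rewrite ler_piMr// -lecR -normE.
Qed.

Lemma rnorm_bopM S T : rnorm (S * T) <= rnorm S * rnorm T.
Proof.
apply: rnorm_bop_le => [|x]; first by rewrite mulr_ge0 ?rnorm_ge0.
rewrite bopME; apply: le_trans (rnorm_bop _ _) _.
by rewrite -mulrA ler_wpM2l ?rnorm_ge0// rnorm_bop.
Qed.

Lemma rnorm_bop1 : rnorm (1 : bop H) <= 1.
Proof. by apply: rnorm_bop_le => // x; rewrite mul1r. Qed.

Lemma rnorm_bopX T n : rnorm T <= 1 -> rnorm (T ^+ n) <= 1.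
Proof.
move=> T1; elim: n => [|n ih]; first exact: rnorm_bop1.
rewrite exprS; apply: le_trans (rnorm_bopM _ _) _.
by rewrite -[leRHS]mulr1 ler_pM ?rnorm_ge0.
Qed.

(** Polarization: the quadratic form is real, and its values at [x + y] and [x + 'i *: y] give the
    imaginary and the real part of the identity. *)
Lemma positive_op_sym A x y : positive_op A -> inner (A x) y = inner x (A y).
Proof.
move=> A0; have h z : Im (inner (A z) z) = 0 by apply: ger0_Im; exact: A0.
have h1 := h (x + y); have h2 := h (x + 'i *: y).
rewrite (innerC (A y) x).
move: h1 h2; rewrite !linearD !linearZ/= !innerDl !innerDr !innerZl !innerZr !ImD.
rewrite !h; case: (inner (A x) y) => p q; case: (inner (A y) x) => p' q' /=.
rewrite !(mul0r, mulr0, mulrN, mulNr, mul1r, oppr0, addr0, add0r, opprK, subr0, sub0r, mulr1).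
rewrite mulrA mulcJ rnormi expr1n mul1r h addr0 => /eqP.
rewrite addr_eq0 => /eqP -> /eqP; rewrite addrC subr_eq0 => /eqP ->.
by [].
Qed.

Lemma positive_op_real A x : positive_op A ->
  inner (A x) x = (Re (inner (A x) x))%:C.
Proof. by move=> A0; rewrite RRe_real// ger0_real. Qed.

Lemma positive_op_ge0 A x : positive_op A -> 0 <= Re (inner (A x) x).
Proof. by move=> A0; rewrite -ler0c -positive_op_real. Qed.

Lemma positive_op_CS A x y : positive_op A ->
  rnorm (inner (A x) y) ^+ 2 <= Re (inner (A x) x) * Re (inner (A y) y).
Proof.
move=> A0; set c := inner (A x) y; set p := Re _; set q := Re _.
have p0 : 0 <= p by exact: positive_op_ge0.
have q0 : 0 <= q by exact: positive_op_ge0.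
(* Positivity of the form at [x - t c y]. The factor [c] makes the cross terms real, so real values
   of [t] are enough. *)
have h (t : R) : 0 <= p - 2 * t * rnorm c ^+ 2 + t ^+ 2 * rnorm c ^+ 2 * q.
  have := positive_op_ge0 (x - (t%:C * c) *: y) A0.
  rewrite linearB linearZ/= !innerBl !innerBr !innerZl !innerZr.
  rewrite (positive_op_sym y x A0) (innerC (A x) y) -/c conjcM conjc_real.
  rewrite (positive_op_real x A0) (positive_op_real y A0) -/p -/q.
  have -> : p%:C - t%:C * conjc c * c -
      (t%:C * c * conjc c - t%:C * c * (t%:C * conjc c * q%:C)) =
    p%:C - 2 * t%:C * (c * conjc c) + t%:C ^+ 2 * (c * conjc c) * q%:C by ring.
  by rewrite mulcJ ReD ReB -rmorphXn !ReM/= !(mulr0, mul0r, addr0, subr0).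
(* For [q = 0] the expression is affine in [t], and the chosen [t] would give it the value -1 unless
   [c = 0]. Otherwise its minimum, at [t = 1 / q], is the claim. *)
have [q1|q1] := eqVneq q 0.
  rewrite q1 mulr0; have [->//|c0] := eqVneq (rnorm c ^+ 2) 0.
  have := h ((p + 1) / rnorm c ^+ 2 / 2); rewrite q1 mulr0 addr0.
  have -> : 2 * ((p + 1) / rnorm c ^+ 2 / 2) * rnorm c ^+ 2 = p + 1.
    by move: (rnorm c ^+ 2) c0 => r r0; field.
  lra.
have := h q^-1.
have -> : p - 2 * q^-1 * rnorm c ^+ 2 + q^-1 ^+ 2 * rnorm c ^+ 2 * q =
  p - rnorm c ^+ 2 / q by field.
by rewrite subr_ge0 ler_pdivrMr// lt_neqAle eq_sym q1.
Qed.

Lemma positive_op1 : positive_op (1 : bop H).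
Proof. by move=> x; rewrite bop1E inner_rnorm ler0c sqr_ge0. Qed.

Lemma cauchy_schwarz x y : rnorm (inner x y) <= rnorm x * rnorm y.
Proof.
rewrite -(@ler_pXn2r _ 2)// ?nnegrE ?mulr_ge0 ?rnorm_ge0// exprMn.
by have := positive_op_CS x y positive_op1; rewrite !bop1E !inner_rnorm.
Qed.

Lemma cvg_innerl {T : Type} (F : set_system T) {FF : Filter F} (u : T -> H) l y :
  u @ F --> l -> (fun t => inner (u t) y) @ F --> inner l y.
Proof.
move=> /cvg_rnormP ul; apply/cvg_rnormP.
apply: (@squeeze_cvgr _ _ _ _ (cst 0) (fun t => rnorm (u t - l) * rnorm y)).
- by apply: nearW => t; rewrite rnorm_ge0 -innerBl cauchy_schwarz.
- exact: cvg_cst.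
- by rewrite -[X in _ --> X](mul0r (rnorm y)); apply: cvgMl.
Qed.

Lemma cvg_innerr {T : Type} (F : set_system T) {FF : Filter F} (u : T -> H) l y :
  u @ F --> l -> (fun t => inner y (u t)) @ F --> inner y l.
Proof.
move=> /cvg_rnormP ul; apply/cvg_rnormP.
apply: (@squeeze_cvgr _ _ _ _ (cst 0) (fun t => rnorm y * rnorm (u t - l))).
- by apply: nearW => t; rewrite rnorm_ge0 -innerBr cauchy_schwarz.
- exact: cvg_cst.
- by rewrite -[X in _ --> X](mulr0 (rnorm y)); apply: cvgMr.
Qed.

(** Cauchy-Schwarz for the form of [A] at [x] and [A x]. This is the operator inequality A^2 <= M A,
    obtained without a functional calculus. *)
Lemma positive_op_norm A (M : R) x : positive_op A -> rnorm A <= M ->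
  rnorm (A x) ^+ 2 <= M * Re (inner (A x) x).
Proof.
move=> A0 AM; have := positive_op_CS x (A x) A0.
rewrite inner_rnorm rnormR ger0_norm ?sqr_ge0//.
have [->|n0] := eqVneq (rnorm (A x)) 0.
  rewrite expr0n => _; rewrite mulr_ge0 ?positive_op_ge0//.
  by rewrite (le_trans _ AM) ?rnorm_ge0.
have n1 : 0 < rnorm (A x) ^+ 2 by rewrite exprn_gt0// lt_neqAle eq_sym n0 rnorm_ge0.
move=> h; rewrite -(ler_pM2r n1) -expr2; apply: le_trans h _.
rewrite [leRHS]mulrAC mulrC ler_wpM2r ?positive_op_ge0//.
apply: le_trans (ler_norm _) _; apply: le_trans (Re_le_rnorm _) _.
apply: le_trans (cauchy_schwarz _ _) _.
rewrite expr2 mulrA ler_wpM2r ?rnorm_ge0//.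
by apply: le_trans (rnorm_bop _ _) _; rewrite ler_wpM2r ?rnorm_ge0.
Qed.

(** In the expanded square the cross term is -2c <Ax, x>, and c^2 |Ax|^2 uses up only one of the two
    copies. The copy that remains is what [power_telescope] sums. *)
Lemma positive_op_sub_norm A (c : R) x : positive_op A -> 0 <= c ->
  c * rnorm A <= 1 ->
  rnorm (x - c%:C *: A x) ^+ 2 + c * Re (inner (A x) x) <= rnorm x ^+ 2.
Proof.
move=> A0 c0 cA.
have E : rnorm (x - c%:C *: A x) ^+ 2 =
    rnorm x ^+ 2 - 2 * c * Re (inner (A x) x) + c ^+ 2 * rnorm (A x) ^+ 2.
  apply: complexI; rewrite -inner_rnorm !innerBl !innerBr !innerZl !innerZr.
  rewrite conjc_real -(positive_op_sym _ _ A0) (positive_op_real x A0) !inner_rnorm.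
  rewrite -!rmorphM -!rmorphB/=; congr (_%:C); ring.
have h := positive_op_norm x A0 (lexx (rnorm A)).
have h2 : c ^+ 2 * rnorm (A x) ^+ 2 <= c * Re (inner (A x) x).
  apply: le_trans (ler_wpM2l (sqr_ge0 c) h) _.
  rewrite expr2 -mulrA mulrA -mulrA ler_wpM2l// mulrA ler_piMl//.
  exact: positive_op_ge0.
rewrite E; lra.
Qed.

Lemma rnorm_positive_op_sub A (c : R) : positive_op A -> 0 <= c ->
  c * rnorm A <= 1 -> rnorm (1 - c%:C *: A) <= 1.
Proof.
move=> A0 c0 cA; apply: rnorm_bop_le => // x; rewrite mul1r bopBE bop1E bopZE.
rewrite -(@ler_pXn2r _ 2)// ?nnegrE ?rnorm_ge0//.
apply: le_trans (positive_op_sub_norm x A0 c0 cA).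
by rewrite lerDl mulr_ge0// positive_op_ge0.
Qed.

End PositiveOperators.

(** * Completeness of the space of bounded operators *)

Section OperatorLimits.
Variables (R : realType) (H : hilbertType R).
Implicit Types (x y z : H) (a : R[i]) (A S T : bop H).

Lemma cvg_bop_apply {T : Type} (F : set_system T) {FF : Filter F}
    (u : T -> bop H) (l : bop H) x :
  u @ F --> l -> (fun t => u t x) @ F --> l x.
Proof.
move=> /cvg_rnormP ul; apply/cvg_rnormP.
apply: (@squeeze_cvgr _ _ _ _ (cst 0) (fun t => rnorm (u t - l) * rnorm x)).
- by apply: nearW => t; rewrite rnorm_ge0 -bopBE rnorm_bop.
- exact: cvg_cst.
- by rewrite -[X in _ --> X](mul0r (rnorm x)); apply: cvgMl.
Qed.

(** The limit is formed pointwise in [H]. Letting one index of the Cauchy estimate tend to infinity,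
    in [close], yields both the boundedness of the limit and the convergence in norm. *)
Lemma bop_cauchy_cvg (u : nat -> bop H) :
  (forall e : R, 0 < e -> exists N, forall m n, (N <= m)%N -> (N <= n)%N ->
     rnorm (u m - u n) <= e) -> cvgn u.
Proof.
move=> h.
have cx x : cvgn (fun n => u n x).
  apply: rcauchy_cvg => e e0.
  have [|N hN] := h (e / (rnorm x + 1)).
    by rewrite divr_gt0// ltr_wpDl ?rnorm_ge0.
  exists N => m n Nm Nn; rewrite -bopBE; apply: le_trans (rnorm_bop _ _) _.
  apply: le_trans (ler_wpM2r (rnorm_ge0 x) (hN m n Nm Nn)) _.
  rewrite mulrAC ler_pdivrMr ?ltr_wpDl ?rnorm_ge0//.
  by rewrite ler_wpM2l ?(ltW e0)// lerDl.
pose f x := limn (fun n => u n x).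
have flin : linear f.
  move=> a x y; apply/cvg_lim => //.
  have -> : (fun n => u n (a *: x + y)) = (fun n => a *: u n x + u n y).
    by apply/funext => n; rewrite linearP.
  by apply: cvgD; [apply: cvgZr; exact: cx|exact: cx].
have close e N : (forall m n, (N <= m)%N -> (N <= n)%N -> rnorm (u m - u n) <= e) ->
    forall n x, (N <= n)%N -> rnorm (u n x - f x) <= e * rnorm x.
  move=> hN n x Nn.
  have : (fun m => rnorm (u n x - u m x)) @ \oo --> rnorm (u n x - f x).
    by apply: cvg_rnorm; apply: cvgB; [exact: cvg_cst|exact: cx].
  move=> /cvgr_to_le; apply; exists N => // m /= Nm.
  by rewrite -bopBE; apply: le_trans (rnorm_bop _ _) _; rewrite ler_wpM2r ?rnorm_ge0 ?hN.
have [N hN] := h 1 ltr01.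
have fb : f \in @bounded_linear _ H.
  apply/bounded_linearP; split=> //; exists (1 + rnorm (u N))%:C => x.
  rewrite !normE -rmorphM/= lecR.
  have -> : f x = u N x - (u N x - f x) by rewrite opprB addrC subrK.
  apply: le_trans (rnormB _ _) _; rewrite addrC mulrDl lerD ?rnorm_bop//.
  exact: (close _ _ hN _ _ (leqnn N)).
apply/cvg_ex; exists (Bop fb); apply/cvg_rnormP/cvgrPdist_le => e e0.
have [N' hN'] := h _ e0; exists N' => // n /= Nn.
rewrite sub0r normrN ger0_norm ?rnorm_ge0//; apply: rnorm_bop_le; first exact: ltW.
by move=> x; exact: (close _ _ hN').
Qed.

End OperatorLimits.

(** * Square roots of positive operators *)

Section SquareRoot.
Variables (R : realType) (H : hilbertType R).
Implicit Types (x y z : H) (A B S T : bop H).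

Lemma rnorm_bopZ (a : R[i]) T : rnorm (a *: T) = rnorm a * rnorm T.
Proof. exact: rnormZ. Qed.

Lemma bop_mulZl (a : R[i]) S T : (a *: S) * T = a *: (S * T).
Proof. by apply: bop_ext. Qed.

Lemma bop_mulZr (a : R[i]) S T : S * (a *: T) = a *: (S * T).
Proof. by apply: bop_ext => x; rewrite bopME !bopZE linearZ. Qed.

(** A fixed point Y = (B + Y^2) / 2 satisfies (1 - Y)^2 = 1 - B, so the iteration converges to 1
    minus a square root of [1 - B]. *)
Fixpoint sqrt_iter B n : bop H :=
  if n is m.+1 then 2^-1 *: (B + sqrt_iter B m * sqrt_iter B m) else 0.

(** The same iteration for the number 1 in place of [B]. It majorizes both the norms and the
    increments of [sqrt_iter] when [B] is a contraction, which reduces convergence to that of a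
    bounded monotone real sequence. *)
Fixpoint sqrt_bound n : R :=
  if n is m.+1 then 2^-1 * (1 + sqrt_bound m * sqrt_bound m) else 0.

Lemma sqrt_bound_ge0 n : 0 <= sqrt_bound n.
Proof.
by elim: n => //= n ih; rewrite mulr_ge0 ?invr_ge0// addr_ge0// mulr_ge0.
Qed.

Lemma sqrt_bound_le1 n : sqrt_bound n <= 1.
Proof.
elim: n => [|n ih]/=; first exact: ler01.
have h : sqrt_bound n * sqrt_bound n <= 1 by rewrite mulr_ile1 ?sqrt_bound_ge0.
lra.
Qed.

Lemma sqrt_bound_nd n : sqrt_bound n <= sqrt_bound n.+1.
Proof.
have h : 0 <= (1 - sqrt_bound n) * (1 - sqrt_bound n) by rewrite -expr2 sqr_ge0.
rewrite /=; lra.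
Qed.

Lemma sqrt_iter_le B n : rnorm B <= 1 -> rnorm (sqrt_iter B n) <= sqrt_bound n.
Proof.
move=> B1; elim: n => [|n ih]/=; first by rewrite rnorm0.
rewrite rnorm_bopZ rnormV rnorm_nat ler_wpM2l ?invr_ge0//.
apply: le_trans (rnormD _ _) _; rewrite lerD//.
by apply: le_trans (rnorm_bopM _ _) _; rewrite ler_pM ?rnorm_ge0.
Qed.

(* [Y^2 - Z^2 = ((Y - Z)(Y + Z) + (Y + Z)(Y - Z)) / 2] needs no commutation. *)
Lemma sqrt_iter_dist1 B n : rnorm B <= 1 ->
  rnorm (sqrt_iter B n.+1 - sqrt_iter B n) <= sqrt_bound n.+1 - sqrt_bound n.
Proof.
move=> B1; elim: n => [|n ih].
  rewrite /= !subr0 mulr0 mulr0 !addr0 mulr1 rnorm_bopZ rnormV rnorm_nat.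
  by rewrite ler_piMr// invr_ge0.
set Y := sqrt_iter B n.+1 in ih *; set Z := sqrt_iter B n in ih *.
have -> : sqrt_iter B n.+2 - Y = 2^-1 *: (Y * Y - Z * Z).
  by rewrite {2}/Y /= -scalerBr -/Y -/Z opprD addrACA subrr add0r.
set y := sqrt_bound n.+1 in ih *; set z := sqrt_bound n in ih *.
have -> : sqrt_bound n.+2 - y = 2^-1 * (y * y - z * z).
  by rewrite {2}/y /= -mulrBr -/y -/z opprD addrACA subrr add0r.
rewrite rnorm_bopZ rnormV rnorm_nat ler_wpM2l ?invr_ge0//.
have -> : Y * Y - Z * Z = 2^-1 *: ((Y - Z) * (Y + Z) + (Y + Z) * (Y - Z)).
  rewrite !mulrDl !mulrDr !mulrN !mulNr.
  have -> : Y * Y + Y * Z + (- (Z * Y) - Z * Z) + (Y * Y - Y * Z + (Z * Y - Z * Z)) =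
      (Y * Y - Z * Z) + (Y * Y - Z * Z).
    rewrite [LHS](AC ((2*2)*(2*2)) ((1*4)*(5*8)*((2*7)*(6*3))))/=.
    by rewrite -opprD subrr addr0.
  by rewrite -mulr2n -(scaler_nat 2 (Y * Y - Z * Z)) scalerA mulVf ?scale1r// pnatr_eq0.
have Yy : rnorm Y <= y by exact: sqrt_iter_le.
have Zz : rnorm Z <= z by exact: sqrt_iter_le.
have YZ : rnorm (Y + Z) <= y + z by apply: le_trans (rnormD _ _) _; rewrite lerD.
have h1 : rnorm ((Y - Z) * (Y + Z)) <= (y - z) * (y + z).
  by apply: le_trans (rnorm_bopM _ _) _; rewrite ler_pM ?rnorm_ge0.
have h2 : rnorm ((Y + Z) * (Y - Z)) <= (y + z) * (y - z).
  by apply: le_trans (rnorm_bopM _ _) _; rewrite ler_pM ?rnorm_ge0.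
rewrite rnorm_bopZ rnormV rnorm_nat.
have h3 := rnormD ((Y - Z) * (Y + Z)) ((Y + Z) * (Y - Z)).
set r := rnorm (_ + _) in h3 *; lra.
Qed.

Lemma sqrt_iter_dist B m n : rnorm B <= 1 -> (m <= n)%N ->
  rnorm (sqrt_iter B n - sqrt_iter B m) <= sqrt_bound n - sqrt_bound m.
Proof.
move=> B1 /subnK <-; elim: (n - m)%N => [|k ih]; first by rewrite !subrr rnorm0.
rewrite addSn -(subrK (sqrt_iter B (k + m)) (sqrt_iter B _.+1)) -addrA.
apply: le_trans (rnormD _ _) _.
have := sqrt_iter_dist1 (k + m) B1; lra.
Qed.

Lemma sqrt_bound_cvg : cvgn sqrt_bound.
Proof.
apply: nondecreasing_is_cvgn; first by apply/nondecreasing_seqP; exact: sqrt_bound_nd.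
by exists 1 => _ [n _ <-]; exact: sqrt_bound_le1.
Qed.

Lemma sqrt_iter_cvg B : rnorm B <= 1 -> cvgn (sqrt_iter B).
Proof.
move=> B1; apply: bop_cauchy_cvg => e e0.
have e20 : 0 < e / 2 by rewrite divr_gt0.
have /cvgrPdist_le/(_ _ e20)[N _ hN] := sqrt_bound_cvg.
exists N => m n Nm Nn.
wlog mn : m n Nm Nn / (m <= n)%N.
  by move=> h; have [/h|/ltnW/h] := leqP m n; [exact|rewrite rnormBC; exact].
rewrite rnormBC; apply: le_trans (sqrt_iter_dist B1 mn) _.
have := hN _ Nm; have := hN _ Nn; rewrite /= !ler_norml; lra.
Qed.

Lemma cvg_bopM {T : Type} (F : set_system T) {FF : ProperFilter F}
    (u v : T -> bop H) (l m : bop H) :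
  u @ F --> l -> v @ F --> m -> (fun t => u t * v t) @ F --> l * m.
Proof.
move=> ul vm; have ru := cvg_rnorm ul.
move: ul vm => /cvg_rnormP ul /cvg_rnormP vm; apply/cvg_rnormP.
apply: (@squeeze_cvgr _ _ _ _ (cst 0)
  (fun t => rnorm (u t) * rnorm (v t - m) + rnorm (u t - l) * rnorm m)).
- apply: nearW => t; rewrite rnorm_ge0/=.
  have -> : u t * v t - l * m = u t * (v t - m) + (u t - l) * m.
    by rewrite mulrBr mulrBl addrA subrK.
  by apply: le_trans (rnormD _ _) _; rewrite lerD ?rnorm_bopM.
- exact: cvg_cst.
- rewrite [X in _ --> X](_ : _ = rnorm l * 0 + 0 * rnorm m); last by rewrite mulr0 mul0r addr0.
  by apply: cvgD; apply: cvgM; [exact: ru|exact: vm|exact: ul|exact: cvg_cst].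
Qed.

Lemma sqrt_iter_sym B n x y : (forall x y, inner (B x) y = inner x (B y)) ->
  inner (sqrt_iter B n x) y = inner x (sqrt_iter B n y).
Proof.
move=> Bs; elim: n x y => [|n ih] x y; first by rewrite inner0l inner0r.
rewrite -[sqrt_iter B n.+1]/(2^-1 *: (B + sqrt_iter B n * sqrt_iter B n)).
rewrite !(bopZE _ (B + sqrt_iter B n * sqrt_iter B n)) !bopDE !bopME.
rewrite innerZl innerZr !innerDl !innerDr Bs !ih.
by congr (_ * _); rewrite conjc_inv conjc_nat.
Qed.

(** Scaling by c = 1 / (|A| + 1) makes B = 1 - c A a contraction; the 1 added in the denominator
    covers [A = 0]. The limit Y of the iteration satisfies (1 - Y)^2 = c A, and 1 - Y is positive
    because Y is a symmetric contraction. The root of [A] is therefore (1 - Y) / sqrt c. *)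
Theorem positive_sqrt A : positive_op A -> exists2 S, positive_op S & S * S = A.
Proof.
move=> A0; pose c := (rnorm A + 1)^-1; pose B := 1 - c%:C *: A.
have c0 : 0 < c by rewrite invr_gt0 ltr_wpDl ?rnorm_ge0.
have cA : c * rnorm A <= 1.
  by rewrite mulrC ler_pdivrMr ?ltr_wpDl ?rnorm_ge0// mul1r lerDl.
have B1 : rnorm B <= 1 by apply: rnorm_positive_op_sub => //; exact: ltW.
have Bs x y : inner (B x) y = inner x (B y).
  rewrite !bopBE !bop1E !bopZE innerBl innerBr innerZl innerZr conjc_real.
  by rewrite (positive_op_sym _ _ A0).
set Y := limn (sqrt_iter B).
have cY : sqrt_iter B @ \oo --> Y by exact: sqrt_iter_cvg.
have YE : Y = 2^-1 *: (B + Y * Y).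
  have : (fun n => sqrt_iter B n.+1) @ \oo --> 2^-1 *: (B + Y * Y).
    by apply: cvgZr; apply: cvgD; [exact: cvg_cst|exact: cvg_bopM].
  have h2 : [sequence sqrt_iter B n.+1]_n @ \oo --> Y by rewrite cvg_shiftS.
  by move=> h; exact: cvg_unique h2 h.
have Y1 : rnorm Y <= 1.
  apply: (cvgr_to_le (cvg_rnorm cY)); apply: nearW => n.
  exact: le_trans (sqrt_iter_le n B1) (sqrt_bound_le1 n).
have Ys x y : inner (Y x) y = inner x (Y y).
  have h1 : (fun n => inner (sqrt_iter B n x) y) @ \oo --> inner (Y x) y.
    by apply: cvg_innerl; exact: cvg_bop_apply.
  apply: rcvg_unique h1 _.
  have -> : (fun n => inner (sqrt_iter B n x) y) = (fun n => inner x (sqrt_iter B n y)).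
    by apply/funext => n; exact: sqrt_iter_sym.
  by apply: cvg_innerr; exact: cvg_bop_apply.
have Yp x : 0 <= inner ((1 - Y) x) x.
  rewrite bopBE innerBl bop1E inner_rnorm.
  have YR : inner (Y x) x = (Re (inner (Y x) x))%:C.
    apply: complex_ext => //=; have := innerC x (Y x); rewrite -Ys.
    by move=> /(congr1 (@Im R)); rewrite ImJ; lra.
  rewrite YR -rmorphB/= ler0c subr_ge0.
  apply: le_trans (ler_norm _) _; apply: le_trans (Re_le_rnorm _) _.
  apply: le_trans (cauchy_schwarz _ _) _; rewrite expr2 ler_wpM2r ?rnorm_ge0//.
  by apply: le_trans (rnorm_bop _ _) _; rewrite ler_piMl ?rnorm_ge0.
pose s := Num.sqrt c^-1.
have s0 : 0 <= s by exact: sqrtr_ge0.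
exists (s%:C *: (1 - Y)) => [x|].
  by rewrite bopZE innerZl mulr_ge0// ler0c.
rewrite bop_mulZl bop_mulZr scalerA -rmorphM/= -expr2 sqr_sqrtr ?invr_ge0 ?ltW//.
have -> : (1 - Y) * (1 - Y) = 1 - B.
  rewrite mulrBl mul1r mulrBr mulr1.
  have E : Y * Y = Y + Y - B.
    by rewrite {3 4}YE -mulr2n -scaler_nat scalerA divff ?pnatr_eq0// scale1r addrC addKr.
  rewrite E.
  have -> : Y - (Y + Y - B) = B - Y by rewrite -addrA opprD addrA subrr add0r opprB.
  by rewrite opprB addrA subrK.
rewrite /B opprB addrC subrK scalerA -rmorphM/= mulVf ?scale1r//.
  by rewrite gt_eqF.
by rewrite ltr_wpDl ?rnorm_ge0.
Qed.

End SquareRoot.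

(** * Orthonormal bases and the trace *)

Section Adjoints.
Variables (R : realType) (H : hilbertType R).
Implicit Types (x y z : H) (S T U V X : bop H).

(** A relation instead of a statement about [adj]: it makes sense before adjoints are known to
    exist, and it passes to powers and differences without the uniqueness of the adjoint. *)
Definition adjoint_pair T S := forall x y, inner (T x) y = inner x (S y).

Lemma adjoint_pair_norm T S : adjoint_pair T S -> rnorm S <= rnorm T.
Proof.
move=> TS; apply: rnorm_bop_le => [|x]; first exact: rnorm_ge0.
have [->|n0] := eqVneq (rnorm (S x)) 0; first by rewrite mulr_ge0 ?rnorm_ge0.
have n1 : 0 < rnorm (S x) by rewrite lt_neqAle eq_sym n0 rnorm_ge0.
rewrite -(ler_pM2r n1) -expr2.
have -> : rnorm (S x) ^+ 2 = rnorm (inner (T (S x)) x).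
  by rewrite TS inner_rnorm rnormR ger0_norm ?sqr_ge0.
apply: le_trans (cauchy_schwarz _ _) _; rewrite mulrAC ler_wpM2r ?rnorm_ge0//.
exact: rnorm_bop.
Qed.

Lemma adjoint_pairC T S : adjoint_pair T S -> adjoint_pair S T.
Proof. by move=> TS x y; rewrite innerC -TS -innerC. Qed.

Lemma adjoint_pairM T S T' S' : adjoint_pair T S -> adjoint_pair T' S' ->
  adjoint_pair (T * T') (S' * S).
Proof. by move=> h h' x y; rewrite !bopME h h'. Qed.

Lemma adjoint_pairX T S n : adjoint_pair T S -> adjoint_pair (T ^+ n) (S ^+ n).
Proof.
move=> h; elim: n => [x y|n ih]//; rewrite exprS exprSr.
exact: adjoint_pairM.
Qed.

Lemma adjoint_pairB T S T' S' : adjoint_pair T S -> adjoint_pair T' S' ->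
  adjoint_pair (T - T') (S - S').
Proof. by move=> h h' x y; rewrite !bopBE innerBl innerBr h h'. Qed.

End Adjoints.

Section OrthonormalBasis.
Variables (R : realType) (H : hilbertType R) (e : nat -> H).
Hypothesis e_onb : orthonormal_basis e.
Implicit Types (x y z : H) (S T U V X : bop H).

Lemma onb_inner m n : inner (e m) (e n) = (m == n)%:R.
Proof. exact: e_onb.1. Qed.

Lemma onb_rnorm n : rnorm (e n) = 1.
Proof.
have := onb_inner n n; rewrite inner_rnorm eqxx => /complexI h.
by apply/eqP; rewrite -(@eqrXn2 _ 2) ?rnorm_ge0// expr1n h.
Qed.

Lemma onb_sum_rnorm (c : nat -> R[i]) m n :
  rnorm (\sum_(m <= j < n) c j *: e j) ^+ 2 = \sum_(m <= j < n) rnorm (c j) ^+ 2.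
Proof.
apply: complexI; rewrite -inner_rnorm inner_sumr rmorph_sum/=.
apply: eq_big_nat => k /andP[mk kn].
rewrite innerZr inner_suml; under eq_bigr do rewrite innerZl onb_inner.
rewrite (bigD1_seq k) ?iota_uniq ?mem_index_iota ?mk//= eqxx mulr1 big1 ?addr0.
  by rewrite mulrC mulcJ.
by move=> j /negPf ->; rewrite mulr0.
Qed.

Lemma onb_parseval x :
  (fun n => \sum_(0 <= k < n) rnorm (inner x (e k)) ^+ 2) @ \oo --> rnorm x ^+ 2.
Proof.
under eq_fun do rewrite -onb_sum_rnorm.
have h : series (fun n => inner x (e n) *: e n) @ \oo --> x by exact: e_onb.2.
by apply: cvgM; exact: cvg_rnorm h.
Qed.

Lemma onb_bessel x n : \sum_(0 <= k < n) rnorm (inner x (e k)) ^+ 2 <= rnorm x ^+ 2.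
Proof.
have nd : {homo (fun n => \sum_(0 <= k < n) rnorm (inner x (e k)) ^+ 2) :
    n m / (n <= m)%N >-> n <= m}.
  apply/nondecreasing_seqP => k; rewrite big_nat_recr//= lerDl sqr_ge0//.
have h := @onb_parseval x.
rewrite -(cvg_lim _ h)//; apply: nondecreasing_cvgn_le => //.
by apply/cvg_ex; eexists; exact: h.
Qed.

(** Riesz-Fischer: by orthonormality the squared norm of a block of the series is the corresponding
    block of a convergent real series. *)
Lemma onb_sum_cvg (c : nat -> R[i]) (M : R) :
  (forall n, \sum_(0 <= k < n) rnorm (c k) ^+ 2 <= M) ->
  cvgn (series (fun n => c n *: e n)).
Proof.
move=> cM; apply: rcauchy_cvg => r r0.
have cc : cvgn (fun n => \sum_(0 <= k < n) rnorm (c k) ^+ 2).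
  apply: nondecreasing_is_cvgn; last by exists M => _ [n _ <-].
  by apply/nondecreasing_seqP => k; rewrite big_nat_recr//= lerDl sqr_ge0.
have r20 : 0 < r ^+ 2 / 2 by rewrite divr_gt0// exprn_gt0.
have /cvgrPdist_le/(_ _ r20)[N _ hN] := cc.
exists N => m n Nm Nn.
wlog mn : m n Nm Nn / (m <= n)%N.
  by move=> h; have [/h|/ltnW/h] := leqP m n; [exact|rewrite rnormBC; exact].
rewrite rnormBC -(@ler_pXn2r _ 2)// ?nnegrE ?rnorm_ge0 ?(ltW r0)//.
rewrite sub_series_geq// onb_sum_rnorm.
have := hN _ Nm; have := hN _ Nn; rewrite /= !ler_norml.
rewrite -(sub_series_geq (fun k => rnorm (c k) ^+ 2) mn) /series /=; lra.
Qed.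

(** The adjoint at y is the sum of <y, T e_n> e_n. Its partial sums satisfy |s_n|^2 = <y, T s_n> <=
    |T| |y| |s_n|, which gives convergence and the operator bound together. *)
Lemma onb_adjoint T : exists S, adjoint_pair T S.
Proof.
pose c y n := inner y (T (e n)).
pose s y n := series (fun n => c y n *: e n) n.
have cE y n : rnorm (s y n) ^+ 2 = \sum_(0 <= k < n) rnorm (c y k) ^+ 2.
  by rewrite /s /series /= onb_sum_rnorm.
have sle y n : rnorm (s y n) <= rnorm T * rnorm y.
  have [->|n0] := eqVneq (rnorm (s y n)) 0; first by rewrite mulr_ge0 ?rnorm_ge0.
  have n1 : 0 < rnorm (s y n) by rewrite lt_neqAle eq_sym n0 rnorm_ge0.
  rewrite -(ler_pM2r n1) -expr2.
  have -> : rnorm (s y n) ^+ 2 = rnorm (inner y (T (s y n))).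
    rewrite /s /series /= linear_sum inner_sumr.
    under [in RHS]eq_bigr do rewrite linearZ/= innerZr mulrC -/(c y _) mulcJ.
    rewrite -rmorph_sum/= rnormR ger0_norm; last by apply: sumr_ge0 => *; exact: sqr_ge0.
    by rewrite onb_sum_rnorm.
  apply: le_trans (cauchy_schwarz _ _) _.
  rewrite [leRHS]mulrC [rnorm T * _]mulrC [leRHS]mulrCA ler_wpM2l ?rnorm_ge0//.
  by rewrite mulrC rnorm_bop.
have sc y : cvgn (s y).
  apply: (@onb_sum_cvg _ ((rnorm T * rnorm y) ^+ 2)) => n.
  by rewrite -cE ler_pXn2r// ?nnegrE ?mulr_ge0 ?rnorm_ge0.
pose f y := limn (s y).
have flin : linear f.
  move=> a x y; apply: rcvg_lim.
  have -> : s (a *: x + y) = (fun n => a *: s x n + s y n).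
    apply/funext => n; rewrite /s /series /= scaler_sumr -big_split/=.
    by apply: eq_bigr => k _; rewrite /c innerDl innerZl scalerDl scalerA.
  by apply: cvgD; [apply: cvgZr; exact: sc|exact: sc].
have fb : f \in @bounded_linear _ H.
  apply/bounded_linearP; split=> //; exists (rnorm T)%:C => x.
  rewrite !normE -rmorphM/= lecR.
  apply: (cvgr_to_le (cvg_rnorm (sc x))); exact: nearW.
exists (Bop fb) => x y /=.
have h1 : (fun n => inner (T (series (fun n => inner x (e n) *: e n) n)) y) @ \oo
    --> inner (T x) y.
  have h : series (fun n => inner x (e n) *: e n) @ \oo --> x by exact: e_onb.2.
  apply: cvg_innerl; apply/cvg_rnormP.
  apply: (@squeeze_cvgr _ _ _ _ (cst 0) (fun n => rnorm T *
    rnorm (series (fun n => inner x (e n) *: e n) n - x))).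
  - by apply: nearW => t; rewrite rnorm_ge0 -linearB rnorm_bop.
  - exact: cvg_cst.
  - rewrite -[X in _ --> X](mulr0 (rnorm T)); apply: cvgMr.
    by move/cvg_rnormP : h.
have h2 : (fun n => inner x (s y n)) @ \oo --> inner x (f y).
  by apply: cvg_innerr; exact: sc.
apply: rcvg_unique h1 _; rewrite (_ : (fun n => _) = (fun n => inner x (s y n)))//.
apply/funext => n; rewrite /s /series /= linear_sum inner_suml inner_sumr.
apply: eq_bigr => k _; rewrite linearZ/= innerZl innerZr mulrC; congr (_ * _).
by rewrite /c -innerC.
Qed.

Lemma adjP T : adjoint_pair T (adj T).
Proof. exact: (xgetPex 0 (onb_adjoint T)). Qed.

Lemma rnorm_adj T : rnorm (adj T) <= rnorm T.
Proof. exact: adjoint_pair_norm (adjP T). Qed.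

Lemma absopP T : positive_op (absop T) /\ absop T * absop T = adj T * T.
Proof.
apply: (xgetPex 0 (P := [set A : bop H | positive_op A /\ A * A = adj T * T])).
have [|S S0 SE] := @positive_sqrt _ _ (adj T * T); last by exists S.
by move=> x; rewrite bopME (adjoint_pairC (adjP T)) inner_rnorm ler0c sqr_ge0.
Qed.

(** Both squared norms equal <[adj T] T x, x>. This is the isometry behind the polar decomposition,
    and it is how norms of X p are read off from |X| p. *)
Lemma rnorm_absop T x : rnorm (absop T x) = rnorm (T x).
Proof.
apply/eqP; rewrite -(@eqrXn2 _ 2) ?rnorm_ge0//; apply/eqP/complexI.
rewrite -!inner_rnorm -(positive_op_sym _ _ (absopP T).1) -bopME (absopP T).2.
by rewrite bopME (adjoint_pairC (adjP T)).
Qed.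

Lemma cvg_sum_nat {I : Type} (G : set_system I) {FG : Filter G}
    (F : nat -> I -> R) (l : nat -> R) m :
  (forall k, (fun n => F k n) @ G --> l k) ->
  (fun n => \sum_(0 <= k < m) F k n) @ G --> \sum_(0 <= k < m) l k.
Proof.
move=> h; elim: m => [|m ih].
  by rewrite big_geq//; under eq_fun do rewrite big_geq//; exact: cvg_cst.
rewrite big_nat_recr//=; under eq_fun do rewrite big_nat_recr//=.
by apply: cvgD.
Qed.

(** Parseval in e_j for each vector S W e_k, an exchange of finite sums, and Bessel in e_k for W' S
    e_j. The truncation [N] of the Parseval sums is then removed by a limit. In other words, the
    Hilbert-Schmidt norm of S W is at most |W'| times that of S. *)
Lemma hilbert_schmidt_comp S W W' (w t : R) m : positive_op S ->
  (forall n, \sum_(0 <= k < n) rnorm (S (e k)) ^+ 2 <= t) ->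
  adjoint_pair W W' -> rnorm W' <= w ->
  \sum_(0 <= k < m) rnorm (S (W (e k))) ^+ 2 <= w ^+ 2 * t.
Proof.
move=> S0 St WW' W'w.
have lim := @cvg_sum_nat _ \oo _ (fun k n => \sum_(0 <= j < n) rnorm (inner (S (W (e k))) (e j)) ^+ 2)
  (fun k => rnorm (S (W (e k))) ^+ 2) m (fun k => @onb_parseval (S (W (e k)))).
apply: (cvgr_to_le (lim _)).
apply: nearW => N; rewrite exchange_big/=.
have w0 : 0 <= w by apply: le_trans W'w; exact: rnorm_ge0.
apply: le_trans (ler_wpM2l (sqr_ge0 w) (St N)); rewrite mulr_sumr.
apply: ler_sum => j _.
apply: (@le_trans _ _ (rnorm (W' (S (e j))) ^+ 2)).
  apply: le_trans (onb_bessel (W' (S (e j))) m).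
  by apply: ler_sum => k _; rewrite (positive_op_sym _ _ S0) WW' rnorm_innerC.
rewrite -exprMn ler_pXn2r ?nnegrE ?mulr_ge0 ?rnorm_ge0//.
by apply: le_trans (rnorm_bop _ _) _; rewrite ler_wpM2r ?rnorm_ge0.
Qed.

End OrthonormalBasis.

(** * Approximate inverses of a positive operator *)

Section PowersOfContraction.
Variables (R : realType) (H : hilbertType R) (A : bop H) (c : R).
Hypotheses (A0 : positive_op A) (c0 : 0 < c) (cA : c * rnorm A <= 1).
(* [c \sum_(i < n) B ^+ i] is an approximate inverse of [A]. For [A = |X|] its
   product with [X] replaces the partial isometry of the polar decomposition. *)
Let B : bop H := 1 - c%:C *: A.
Let g n x := Re (inner (A ((B ^+ n) x)) ((B ^+ n) x)).

Lemma power_telescope x N :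
  rnorm ((B ^+ N) x) ^+ 2 + c * \sum_(0 <= n < N) g n x <= rnorm x ^+ 2.
Proof.
elim: N => [|N ih]; first by rewrite big_geq// mulr0 addr0.
apply: le_trans ih; rewrite big_nat_recr//= mulrDr addrA addrAC lerD2r.
have -> : (B ^+ N.+1) x = (B ^+ N) x - c%:C *: A ((B ^+ N) x) by rewrite exprS.
exact: positive_op_sub_norm (ltW c0) cA.
Qed.

(** Pigeonhole: by [power_telescope] the sums for n = 0, ..., N - 1 add up to at most (sum of
    |x_k|^2) / c, uniformly in N, so they cannot all exceed [r]. A single [n] serves all [m]
    vectors. *)
Lemma power_small m (x : nat -> H) (r : R) : 0 < r ->
  exists n, \sum_(0 <= k < m) g n (x k) <= r.
Proof.
move=> r0; apply: contrapT => /forallNP h.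
pose Q := (\sum_(0 <= k < m) rnorm (x k) ^+ 2) / c / r.
have Q0 : 0 <= Q.
  by rewrite !divr_ge0 ?(ltW r0) ?(ltW c0)// sumr_ge0// => k _; exact: sqr_ge0.
have := archi_boundP Q0; set N := Num.bound Q; apply/negP; rewrite -leNgt.
rewrite ler_pdivlMr// ler_pdivlMr//.
apply: (@le_trans _ _ (\sum_(0 <= k < m) c * \sum_(0 <= n < N) g n (x k))).
  rewrite -mulr_sumr mulrC ler_wpM2l ?(ltW c0)// exchange_big/=.
  apply: (@le_trans _ _ (\sum_(0 <= n < N) r)).
    by rewrite big_const_nat subn0 iter_addr_0 mulr_natl.
  by apply: ler_sum => n _; apply/ltW; rewrite ltNge; apply/negP/h.
apply: ler_sum => k _; apply: le_trans (power_telescope (x k) N).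
by rewrite lerDr sqr_ge0.
Qed.

Lemma power_comm n : A * B ^+ n = B ^+ n * A.
Proof.
apply: commrX; rewrite /GRing.comm /B mulrBr mulrBl mulr1 mul1r.
by rewrite bop_mulZl bop_mulZr.
Qed.

Lemma power_sym n x y : inner ((B ^+ n) x) y = inner x ((B ^+ n) y).
Proof.
have Bs : adjoint_pair B B.
  move=> u v; rewrite /B !bopBE !bop1E !bopZE innerBl innerBr innerZl innerZr.
  by rewrite conjc_real (positive_op_sym _ _ A0).
exact: adjoint_pairX.
Qed.

Lemma power_quotient n : A * (c%:C *: \sum_(i < n) B ^+ i) = 1 - B ^+ n.
Proof.
rewrite bop_mulZr -bop_mulZl.
have -> : c%:C *: A = 1 - B by rewrite /B opprB addrC subrK.
by apply: oppr_inj; rewrite -mulNr !opprB -subrX1.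
Qed.

Lemma power_quotientC n : (c%:C *: \sum_(i < n) B ^+ i) * A = 1 - B ^+ n.
Proof.
rewrite -power_quotient bop_mulZl bop_mulZr; congr (_ *: _).
by rewrite mulr_suml mulr_sumr; apply: eq_bigr => i _; rewrite power_comm.
Qed.

Lemma power_norm n : rnorm (B ^+ n) <= 1.
Proof. by apply: rnorm_bopX; apply: rnorm_positive_op_sub => //; exact: ltW. Qed.

End PowersOfContraction.

(** * The trace class through matrix coefficients *)

Section TraceBound.
Variables (R : realType) (H : hilbertType R).
Local Notation e := (@onb R H).
Hypothesis e_onb : orthonormal_basis e.
Implicit Types (x y z : H) (A B S T U V X : bop H).

(* The trace norm of [X] is the supremum of these sums, up to a factor [2]
   that plays no role. *)
Definition trace_bound X (K : R) := forall U V, rnorm U <= 1 -> rnorm V <= 1 ->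
  forall m, \sum_(0 <= k < m) rnorm (inner (X (U (e k))) (V (e k))) <= K.

Let small_scalar A : exists2 c : R, 0 < c & c * rnorm A <= 1.
Proof.
exists (rnorm A + 1)^-1; first by rewrite invr_gt0 ltr_wpDl ?rnorm_ge0.
by rewrite mulrC ler_pdivrMr ?ltr_wpDl ?rnorm_ge0// mul1r lerDl.
Qed.

(** The bound is tested on U = 1 and V = X p / 2. With A = |X|, the coefficient <X e_k, X p e_k>
    equals <A e_k, A p e_k>, that is <A e_k, e_k> up to an error of arbitrarily small sum. Halving
    makes V a contraction, whence [2 * K]. *)
Lemma trace_bound_class X K : trace_bound X K -> trace_class X.
Proof.
move=> XK; have [A0 AE] := absopP e_onb X; rewrite /trace_class.
set A := absop X in A0 AE *.
have [c c0 cA] := small_scalar A.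
have ge0 k : (0 <= (Re (inner (A (e k)) (e k)))%:E)%E.
  by rewrite lee_fin positive_op_ge0.
suff h m : \sum_(0 <= k < m) Re (inner (A (e k)) (e k)) <= 2 * K.
  apply: (@le_lt_trans _ _ (2 * K)%:E); last exact: ltry.
  apply: lime_le; first by apply: is_cvg_nneseries => n _ _; exact: ge0.
  by apply: nearW => m; rewrite sumEFin lee_fin.
apply/ler_addgt0Pr => r r0.
pose B : bop H := 1 - c%:C *: A.
have [n hn] := power_small A0 c0 cA m e r0.
(* Twice the length [n], so that the error <A e_k, B^(2n) e_k> is the form value <A B^n e_k, B^n
   e_k>, which is what [power_small] controls. *)
pose p : bop H := c%:C *: \sum_(i < (n + n)%N) B ^+ i.
have Ap : A * p = 1 - B ^+ (n + n) by exact: power_quotient.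
pose V : bop H := 2^-1 *: (X * p).
have V1 : rnorm V <= 1.
  apply: rnorm_bop_le => // x; rewrite mul1r bopZE rnormZ rnormV rnorm_nat.
  rewrite bopME -(rnorm_absop e_onb) -/A -bopME Ap.
  rewrite ler_pdivrMl// bopBE bop1E; apply: le_trans (rnormB _ _) _.
  rewrite mulr2n mulrDl mul1r lerD2l; apply: le_trans (rnorm_bop _ _) _.
  by rewrite ler_piMl ?rnorm_ge0//; exact: power_norm.
have := XK 1 V (rnorm_bop1 H) V1 m => hK.
apply: (@le_trans _ _ (2 * \sum_(0 <= k < m) rnorm (inner (X (e k)) (V (e k))) +
    \sum_(0 <= k < m) Re (inner (A ((B ^+ n) (e k))) ((B ^+ n) (e k))))); last first.
  by rewrite lerD// ler_wpM2l.
rewrite mulr_sumr -big_split/=; apply: ler_sum => k _.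
have E : inner (X (e k)) (V (e k)) = 2^-1 * (inner (A (e k)) (e k) -
    inner (A ((B ^+ n) (e k))) ((B ^+ n) (e k))).
  rewrite /V bopZE innerZr conjc_inv conjc_nat; congr (_ * _).
  rewrite bopME -(adjoint_pairC (adjP e_onb X)) -bopME -AE bopME.
  rewrite (positive_op_sym _ _ A0) -bopME Ap bopBE bop1E innerBr; congr (_ - _).
  rewrite exprD bopME -(power_sym c A0) -bopME -(power_comm A c) bopME//.
rewrite E rnormM rnormV rnorm_nat mulrA divff ?pnatr_eq0// mul1r.
rewrite -lerBlDr -ReB; apply: le_trans (ler_norm _) _; exact: Re_le_rnorm.
Qed.

(** Let A = |X| = S^2, so that S is Hilbert-Schmidt with the squares |S e_k|^2 summing to at most
    [t]. Writing X = W A + X B^n with W = X p turns <X U e_k, V e_k> into <S U e_k, S [adj W] V e_k>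
    plus a small term. Cauchy-Schwarz and [hilbert_schmidt_comp] bound the main sum by [2 * t]. *)
Lemma trace_class_bound X : trace_class X -> exists K, trace_bound X K.
Proof.
have [A0 AE] := absopP e_onb X; rewrite /trace_class.
set A := absop X in A0 AE *; move=> Atr.
have [S S0 SE] := positive_sqrt A0.
have ge0 k : (0 <= (Re (inner (A (e k)) (e k)))%:E)%E.
  by rewrite lee_fin positive_op_ge0.
pose t := fine (\sum_(0 <= n <oo) (Re (inner (A (e n)) (e n)))%:E)%E.
have tE : (t%:E = \sum_(0 <= n <oo) (Re (inner (A (e n)) (e n)))%:E)%E.
  by rewrite fineK// ge0_fin_numE//; apply: nneseries_ge0 => *; exact: ge0.
have St n : \sum_(0 <= k < n) rnorm (S (e k)) ^+ 2 <= t.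
  rewrite -lee_fin tE -sumEFin.
  apply: le_trans (nneseries_lim_ge n _); last by move=> *; exact: ge0.
  rewrite lee_sum// => k _; rewrite lee_fin -SE bopME (positive_op_sym _ _ S0).
  by rewrite inner_rnorm.
have t0 : 0 <= t by apply: le_trans (St 0%N); rewrite big_geq.
exists (2 * t) => U V U1 V1 m.
have [c c0 cA] := small_scalar A.
pose B : bop H := 1 - c%:C *: A.
apply/ler_addgt0Pr => r r0.
(* Chosen so that |X B^n U e_k|^2 <= (|A| + 1) d = (r / (m + 1))^2 for each k < m; the [m] error
   terms then add up to at most [r]. *)
pose d := (r / (m%:R + 1)) ^+ 2 / (rnorm A + 1).
have A10 : 0 < rnorm A + 1 by rewrite ltr_wpDl ?rnorm_ge0.
have m10 : 0 < m%:R + 1 :> R by rewrite ltr_wpDl.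
have d0 : 0 < d by rewrite divr_gt0// exprn_gt0// divr_gt0.
have [n hn] := power_small A0 c0 cA m (fun k => U (e k)) d0.
pose p : bop H := c%:C *: \sum_(i < n) B ^+ i.
have pA : p * A = 1 - B ^+ n by exact: power_quotientC.
have Ap : A * p = 1 - B ^+ n by exact: power_quotient.
pose W := X * p.
have W2 : rnorm W <= 2.
  apply: rnorm_bop_le => // x.
  rewrite bopME -(rnorm_absop e_onb) -/A -bopME Ap.
  rewrite bopBE bop1E; apply: le_trans (rnormB _ _) _.
  rewrite mulr2n mulrDl mul1r lerD2l; apply: le_trans (rnorm_bop _ _) _.
  by rewrite ler_piMl ?rnorm_ge0//; exact: power_norm.
have XE x : X x = W (A x) + X ((B ^+ n) x).
  have -> : W (A x) = X ((1 - B ^+ n) x) by rewrite -pA.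
  have -> : X x = X ((1 - B ^+ n) x + (B ^+ n) x) by rewrite bopBE subrK.
  exact: linearD.
have main k : rnorm (inner (X (U (e k))) (V (e k))) <=
    rnorm (S (U (e k))) ^+ 2 + 4^-1 * rnorm (S ((adj W * V) (e k))) ^+ 2 +
    rnorm (X ((B ^+ n) (U (e k)))).
  rewrite XE innerDl; apply: le_trans (rnormD _ _) _; apply: lerD; last first.
    apply: le_trans (cauchy_schwarz _ _) _; rewrite ler_piMr ?rnorm_ge0//.
    by apply: le_trans (rnorm_bop _ _) _; rewrite (onb_rnorm e_onb) mulr1.
  rewrite (adjP e_onb W) -SE bopME (positive_op_sym _ _ S0) -bopME.
  apply: le_trans (cauchy_schwarz _ _) _.
  rewrite -[S _]/(S ((adj W * V) (e k))).
  set a := rnorm _; set b := rnorm _.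
  (* The inequality a b <= a^2 + b^2 / 4, weighted to compensate the factor 4 = |W|^2 that enters
     the second sum; each sum then contributes at most [t]. *)
  have := sqr_ge0 (a - 2^-1 * b); rewrite sqrrB exprMn.
  rewrite (_ : 2^-1 ^+ 2 = 4^-1 :> R); last by rewrite exprVn -natrX.
  rewrite (_ : a * (2^-1 * b) *+ 2 = a * b); last by field.
  lra.
have small k : (k < m)%N -> rnorm (X ((B ^+ n) (U (e k)))) <= r / (m%:R + 1).
  move=> km; rewrite -(rnorm_absop e_onb) -/A.
  rewrite -(@ler_pXn2r _ 2)// ?nnegrE ?rnorm_ge0 ?divr_ge0 ?(ltW r0) ?(ltW m10)//.
  apply: le_trans (positive_op_norm _ A0 (_ : _ <= rnorm A + 1)) _; first by rewrite lerDl.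
  rewrite mulrC -ler_pdivlMr//; apply: le_trans hn.
  rewrite (bigD1_seq k) ?iota_uniq ?mem_index_iota//= lerDl sumr_ge0// => j _.
  exact: positive_op_ge0.
apply: (@le_trans _ _ (\sum_(0 <= k < m) (rnorm (S (U (e k))) ^+ 2 +
  4^-1 * rnorm (S ((adj W * V) (e k))) ^+ 2 + r / (m%:R + 1)))).
  rewrite big_nat [leRHS]big_nat; apply: ler_sum => k /andP[_ km].
  by apply: le_trans (main k) _; rewrite lerD2l small.
rewrite 2!big_split/= -mulr_sumr.
have h1 := hilbert_schmidt_comp e_onb m S0 St (adjP e_onb U)
  (le_trans (rnorm_adj e_onb U) U1).
have h2 : \sum_(0 <= k < m) rnorm (S ((adj W * V) (e k))) ^+ 2 <= 2 ^+ 2 * t.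
  apply: (hilbert_schmidt_comp e_onb m S0 St
    (adjoint_pairM (adjoint_pairC (adjP e_onb W)) (adjP e_onb V))).
  apply: le_trans (rnorm_bopM _ _) _; rewrite -[leRHS]mul1r.
  by rewrite ler_pM ?rnorm_ge0// (le_trans (rnorm_adj e_onb V)).
have h3 : \sum_(0 <= k < m) (r / (m%:R + 1)) <= r.
  rewrite big_const_nat subn0 iter_addr_0 -[leLHS]mulr_natr mulrAC ler_pdivrMr//.
  by rewrite mulrC [leRHS]mulrC ler_wpM2r ?(ltW r0)// lerDl.
rewrite expr1n mul1r in h1; rewrite expr2 in h2.
rewrite mulr2n; lra.
Qed.

End TraceBound.

(** * Absolutely convergent series *)

Section AbsoluteSeries.
Variable R : realType.

Lemma bounded_sum_cauchy (v : nat -> R) (K : R) : (forall n, 0 <= v n) ->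
  (forall n, \sum_(0 <= k < n) v k <= K) -> forall r : R, 0 < r ->
  exists N, forall m n, (N <= m)%N -> \sum_(m <= k < n) v k <= r.
Proof.
move=> v0 vK r r0.
have vc : cvgn (series v).
  apply: nondecreasing_is_cvgn; last by exists K => _ [n _ <-]; exact: vK.
  by apply/nondecreasing_seqP => k; rewrite /series /= big_nat_recr//= lerDl.
have r20 : 0 < r / 2 by rewrite divr_gt0.
have /cvgrPdist_le/(_ _ r20)[N _ hN] := vc.
exists N => m n Nm; have [mn|nm] := leqP m n; last by rewrite big_geq ?(ltW r0)// ltnW.
rewrite -sub_series_geq//.
have := hN _ Nm; have := hN _ (leq_trans Nm mn); rewrite /= !ler_norml; lra.
Qed.

Lemma cauchy_of_sums (V : normedModType R[i]) (u : nat -> V) (v : nat -> R) (K : R) :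
  (forall n, rnorm (u n) <= v n) -> (forall n, \sum_(0 <= k < n) v k <= K) ->
  forall r : R, 0 < r -> exists N, forall m n, (N <= m)%N -> (N <= n)%N ->
    rnorm (series u m - series u n) <= r.
Proof.
move=> uv vK r r0.
have v0 n : 0 <= v n by exact: le_trans (rnorm_ge0 _) (uv n).
have [N hN] := bounded_sum_cauchy v0 vK r0.
exists N => m n Nm Nn.
wlog mn : m n Nm Nn / (m <= n)%N.
  by move=> h; have [/h|/ltnW/h] := leqP m n; [exact|rewrite rnormBC; exact].
rewrite rnormBC sub_series_geq//; apply: le_trans (rnorm_sum _ _ _) _.
by apply: le_trans (hN m n Nm); exact: ler_sum.
Qed.

Lemma complex_series_cvg (u : nat -> R[i]) (K : R) :
  (forall n, \sum_(0 <= k < n) rnorm (u k) <= K) -> cvgn (series u).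
Proof.
move=> h; apply: ccauchy_cvg => r r0.
exact: (cauchy_of_sums (fun n => lexx (rnorm (u n))) h r0).
Qed.

Lemma bop_series_cvg (H : hilbertType R) (u : nat -> bop H) (v : nat -> R) (K : R) :
  (forall n, rnorm (u n) <= v n) -> (forall n, \sum_(0 <= k < n) v k <= K) ->
  cvgn (series u).
Proof.
by move=> uv vK; apply: bop_cauchy_cvg => r r0; exact: (cauchy_of_sums uv vK r0).
Qed.

End AbsoluteSeries.

(** * Stability of trace bounds and linearity of the trace *)

Section Trace.
Variables (R : realType) (H : hilbertType R).
Local Notation e := (@onb R H).
Hypothesis e_onb : orthonormal_basis e.
Implicit Types (x y z : H) (A B S T U V X Y : bop H).

Lemma trace_bound_diag X K m : trace_bound X K ->
  \sum_(0 <= k < m) rnorm (inner (X (e k)) (e k)) <= K.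
Proof. by move=> h; exact: (h 1 1 (rnorm_bop1 H) (rnorm_bop1 H) m). Qed.

Lemma trace_cvg X K : trace_bound X K ->
  series (fun n => inner (X (e n)) (e n)) @ \oo --> trace X.
Proof. by move=> h; apply: (complex_series_cvg (K := K)) => n; exact: trace_bound_diag. Qed.

Lemma rnorm_trace X K : trace_bound X K -> rnorm (trace X) <= K.
Proof.
move=> h; apply: (cvgr_to_le (cvg_rnorm (trace_cvg h))); apply: nearW => n.
by apply: le_trans (rnorm_sum _ _ _) _; exact: trace_bound_diag.
Qed.

Lemma trace_boundW X K L : K <= L -> trace_bound X K -> trace_bound X L.
Proof. by move=> KL h U V U1 V1 m; apply: le_trans KL; exact: h. Qed.

Lemma trace_boundD X Y K L : trace_bound X K -> trace_bound Y L ->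
  trace_bound (X + Y) (K + L).
Proof.
move=> h h' U V U1 V1 m; apply: le_trans (lerD (h U V U1 V1 m) (h' U V U1 V1 m)).
rewrite -big_split/=; apply: ler_sum => k _.
have -> : inner ((X + Y) (U (e k))) (V (e k)) =
  inner (X (U (e k))) (V (e k)) + inner (Y (U (e k))) (V (e k)) by exact: innerDl.
exact: rnormD.
Qed.

Lemma trace_boundZ (a : R[i]) X K : trace_bound X K ->
  trace_bound (a *: X) (rnorm a * K).
Proof.
move=> h U V U1 V1 m; apply: le_trans (ler_wpM2l (rnorm_ge0 a) (h U V U1 V1 m)).
by rewrite mulr_sumr; apply: ler_sum => k _; rewrite bopZE innerZl rnormM.
Qed.

Lemma trace_bound0 : trace_bound (0 : bop H) 0.
Proof.
by move=> U V _ _ m; rewrite big1// => k _; rewrite inner0l rnorm0.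
Qed.

Lemma trace_bound_sum (Y : nat -> bop H) (y : nat -> R) m n :
  (forall k, trace_bound (Y k) (y k)) ->
  trace_bound (\sum_(m <= k < n) Y k) (\sum_(m <= k < n) y k).
Proof.
move=> h; elim/big_rec2: _ => [|k a b _ hab]; first exact: trace_bound0.
exact: trace_boundD.
Qed.

(** [T] is absorbed into [U] and [adj S] into [V]: this is the reason for quantifying over all
    contractions in [trace_bound]. *)
Lemma trace_bound_mul S X T K : rnorm S <= 1 -> rnorm T <= 1 ->
  trace_bound X K -> trace_bound (S * X * T) K.
Proof.
move=> S1 T1 h U V U1 V1 m.
apply: le_trans (h (T * U) (adj S * V) _ _ m).
- by apply: ler_sum => k _; rewrite !bopME (adjP e_onb S).
- by apply: le_trans (rnorm_bopM _ _) _; rewrite mulr_ile1 ?rnorm_ge0.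
- apply: le_trans (rnorm_bopM _ _) _; rewrite mulr_ile1 ?rnorm_ge0//.
  exact: le_trans (rnorm_adj e_onb S) S1.
Qed.

Lemma trace_bound_adj X X' K : adjoint_pair X X' -> trace_bound X K ->
  trace_bound X' K.
Proof.
move=> XX' h U V U1 V1 m; apply: le_trans (h V U V1 U1 m).
by apply: ler_sum => k _; rewrite XX' rnorm_innerC.
Qed.

(** Every inequality in [trace_bound] involves finitely many matrix coefficients, and these are
    continuous for the operator norm. *)
Lemma trace_bound_lim (X_ : nat -> bop H) X K N :
  X_ @ \oo --> X -> (forall n, (N <= n)%N -> trace_bound (X_ n) K) ->
  trace_bound X K.
Proof.
move=> cX h U V U1 V1 m.
have lim : (fun n => \sum_(0 <= k < m) rnorm (inner (X_ n (U (e k))) (V (e k)))) @ \oo -->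
    \sum_(0 <= k < m) rnorm (inner (X (U (e k))) (V (e k))).
  apply: (@cvg_sum_nat R _ \oo _ (fun k n => rnorm (inner (X_ n (U (e k))) (V (e k))))
    (fun k => rnorm (inner (X (U (e k))) (V (e k))))) => k.
  by apply: cvg_rnorm; apply: cvg_innerl; exact: cvg_bop_apply.
apply: (cvgr_to_le lim).
by exists N => // n /= Nn; exact: h.
Qed.

Lemma traceD X Y K L : trace_bound X K -> trace_bound Y L ->
  trace (X + Y) = trace X + trace Y.
Proof.
move=> h h'; apply: rcvg_lim.
rewrite (_ : series _ = series (fun n => inner (X (e n)) (e n)) +
    series (fun n => inner (Y (e n)) (e n))).
  by apply: cvgD; [exact: trace_cvg h|exact: trace_cvg h'].
apply/funext => n; rewrite -[RHS]/(_ n + _ n) /series /= -big_split/=.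
by apply: eq_bigr => k _; exact: innerDl.
Qed.

Lemma traceZ (a : R[i]) X K : trace_bound X K -> trace (a *: X) = a * trace X.
Proof.
move=> h; apply: rcvg_lim.
rewrite (_ : series _ = (fun n => a *: series (fun n => inner (X (e n)) (e n)) n)).
  by apply: cvgZr; exact: trace_cvg h.
apply/funext => n; rewrite /series /= scaler_sumr.
by apply: eq_bigr => k _; exact: innerZl.
Qed.

Lemma cvg_conjc {T : Type} (F : set_system T) {FF : Filter F} (u : T -> R[i]) l :
  u @ F --> l -> (fun t => conjc (u t)) @ F --> conjc l.
Proof.
move=> /cvg_rnormP h; apply/cvg_rnormP; apply: cvg_trans h.
by apply: near_eq_cvg; apply: nearW => t /=; rewrite -conjcB rnormJ.
Qed.

Lemma trace_adj X X' K : adjoint_pair X X' -> trace_bound X K ->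
  trace X' = conjc (trace X).
Proof.
move=> XX' h; apply: rcvg_lim.
rewrite (_ : series _ = (fun n => conjc (series (fun n => inner (X (e n)) (e n)) n))).
  by apply: cvg_conjc; exact: trace_cvg h.
apply/funext => n; rewrite /series /= (rmorph_sum (@conjc R)).
by apply: eq_bigr => k _ /=; rewrite XX' -innerC.
Qed.

Lemma trace0 : trace (0 : bop H) = 0.
Proof.
apply: rcvg_lim; rewrite (_ : series _ = cst 0); first exact: cvg_cst.
by apply/funext => n; rewrite /series /= big1// => k _; rewrite inner0l.
Qed.

Lemma trace_sum (Y : nat -> bop H) (y : nat -> R) m n :
  (forall k, trace_bound (Y k) (y k)) ->
  trace (\sum_(m <= k < n) Y k) = \sum_(m <= k < n) trace (Y k).
Proof.
move=> h; have [nm|mn] := leqP n m; first by rewrite !big_geq// trace0.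
move: mn => /ltnW/subnK <-; elim: (n - m)%N => [|k ih].
  by rewrite add0n !big_geq// trace0.
rewrite addSn !big_nat_recr ?leq_addl//= -ih.
exact: traceD (trace_bound_sum m _ h) (h _).
Qed.

(** The remainder of the series is a norm limit of blocks whose trace bounds are tails of the sum of
    [y]; [trace_bound_lim] transfers the bound to it, and [rnorm_trace] makes its trace small. *)
Lemma trace_series (Y : nat -> bop H) X (y : nat -> R) (K : R) :
  (forall k, trace_bound (Y k) (y k)) ->
  (forall n, \sum_(0 <= k < n) y k <= K) ->
  series Y @ \oo --> X ->
  trace_bound X K /\ series (fun n => trace (Y n)) @ \oo --> trace X.
Proof.
move=> Yy yK YX.
have y0 k : 0 <= y k by apply: le_trans (rnorm_trace (Yy k)); exact: rnorm_ge0.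
have XK : trace_bound X K.
  apply: (trace_bound_lim (N := 0) YX) => n _.
  exact: trace_boundW (yK n) (trace_bound_sum 0 n Yy).
split=> //; apply/cvg_rnormP/cvgrPdist_le => r r0.
have [N hN] := bounded_sum_cauchy y0 yK r0.
exists N => // m /= Nm; rewrite sub0r normrN ger0_norm ?rnorm_ge0// rnormBC.
have hb : trace_bound (X - series Y m) r.
  apply: (@trace_bound_lim (fun n => series Y n - series Y m) _ _ m).
    by apply: cvgB; [exact: YX|exact: cvg_cst].
  move=> n mn; rewrite sub_series_geq//.
  by apply: trace_boundW (trace_bound_sum m n Yy); exact: hN.
have -> : trace X - series (fun n => trace (Y n)) m = trace (X - series Y m).
  have := traceD hb (trace_bound_sum 0 m Yy).
  by rewrite subrK (trace_sum 0 m Yy) => ->; rewrite addrK.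
exact: rnorm_trace hb.
Qed.

Lemma trace_bound_pow T T0 K n : rnorm T <= 1 -> rnorm T0 <= 1 ->
  trace_bound (T - T0) K -> trace_bound (T ^+ n - T0 ^+ n) (n%:R * K).
Proof.
move=> T1 T01 h; elim: n => [|n ih]; first by rewrite subrr mul0r; exact: trace_bound0.
have -> : T ^+ n.+1 - T0 ^+ n.+1 = T * (T ^+ n - T0 ^+ n) * 1 + 1 * (T - T0) * T0 ^+ n.
  by rewrite mulr1 mul1r mulrBr mulrBl -!exprS addrA subrK.
rewrite -natr1 mulrDl (mul1r K).
have h1 := trace_bound_mul T1 (rnorm_bop1 H) ih.
have h2 := trace_bound_mul (rnorm_bop1 H) (rnorm_bopX n T01) h.
exact: trace_boundD h1 h2.
Qed.

End Trace.

(** * The trace of a difference in the harmonic functional calculus *)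

Section FunctionalCalculusTrace.
Variable R : realType.

(** The N-th partial sum in [sum_ge1] stops at index N - 1, so shifting N by one gives the ordinary
    partial sums of the reindexed series. *)
Lemma sum_ge1_cvg (V : normedModType R[i]) (u : nat -> V) (l : V) :
  series (fun n => u n.+1) @ \oo --> l -> sum_ge1 u = l.
Proof.
move=> h; apply: rcvg_lim; rewrite -cvg_shiftS.
apply: cvg_trans h; apply: near_eq_cvg; apply: nearW => N.
by rewrite /series /= big_add1.
Qed.

(** The unordered sum over the integers bounds the partial sums along each of the injections n and
    -n, whence [C + C]. The index 0 occurs twice, with weight 0. *)
Lemma gtilde_summable (psi : R -> R[i]) : class_Gtilde psi ->
  exists C, forall N, \sum_(0 <= n < N) n%:R *
    (rnorm (fourier psi n%:Z) + rnorm (fourier psi (- n%:Z))) <= C.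
Proof.
move=> [_]; set a := fun n : int => (rnorm (n%:~R * fourier psi n))%:E.
have a0 n : (0 <= a n)%E by rewrite lee_fin rnorm_ge0.
rewrite -[X in (X < _)%E]/(\esum_(n in setT) a n)%E => ay.
have [C aC] : exists C : R, (\esum_(n in setT) a n = C%:E)%E.
  exists (fine (\esum_(n in setT) a n)%E); rewrite fineK// ge0_fin_numE//.
  exact: esum_ge0.
have h (i : nat -> int) N : injective i -> \sum_(0 <= n < N)
    rnorm ((i n)%:~R * fourier psi (i n)) <= C.
  move=> inj_i; rewrite -lee_fin -aC -sumEFin.
  apply: (@le_trans _ _ (\sum_(0 <= n <oo) a (i n))%E).
    by apply: nneseries_lim_ge => *; exact: a0.
  rewrite nneseries_esumT//.
  rewrite -(@esum_image _ _ _ setT i a); last by move=> x y _ _; exact: inj_i.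
  rewrite esum_mkcond; apply: le_esum => n _.
  by case: ifP.
exists (C + C) => N.
have inj_Posz : injective Posz by move=> x y [].
have h1 := h (fun n => n%:Z) N inj_Posz.
have h2 := h (fun n => - n%:Z) N (inj_comp oppr_inj inj_Posz).
apply: le_trans (lerD h1 h2); rewrite -big_split/=; apply: ler_sum => n _.
by rewrite mulrDr mulrNz mulNr rnormN !rnormM rnorm_nat.
Qed.

Variable H : hilbertType R.
Local Notation e := (@onb R H).
Hypothesis e_onb : orthonormal_basis e.

(** The constant term is split off because it cancels in a difference; the terms of index n + 1 and
    -(n + 1) are merged into one series. The weight n + 1 >= 1 lets the summability of |n psi^(n)|
    control the unweighted coefficients. *)
Lemma op_tilde_cvg (psi : R -> R[i]) (T : bop H) : rnorm T <= 1 ->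
  class_Gtilde psi ->
  series (fun n => fourier psi (- n.+1%:Z) *: adj T ^+ n.+1
                 + fourier psi n.+1%:Z *: T ^+ n.+1) @ \oo
    --> op_tilde psi T - fourier psi 0 *: (1 : bop H).
Proof.
move=> T1 /gtilde_summable[C hC].
have sumC (c : nat -> R[i]) : (forall n, rnorm (c n) <=
      rnorm (fourier psi n%:Z) + rnorm (fourier psi (- n%:Z))) ->
    forall N, \sum_(0 <= n < N) rnorm (c n.+1) <= C.
  move=> hc N; apply: le_trans (hC N.+1).
  rewrite big_nat_recl// mul0r add0r; apply: ler_sum => n _.
  apply: le_trans (hc _) _; rewrite ler_peMl ?addr_ge0 ?rnorm_ge0//.
  by rewrite ler1n.
have conv (c : nat -> R[i]) (S : bop H) : rnorm S <= 1 -> (forall n, rnorm (c n) <=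
      rnorm (fourier psi n%:Z) + rnorm (fourier psi (- n%:Z))) ->
    series (fun n => c n.+1 *: S ^+ n.+1) @ \oo --> sum_ge1 (fun n => c n *: S ^+ n).
  move=> S1 hc; have cv : cvgn (series (fun n => c n.+1 *: S ^+ n.+1)).
    apply: (@bop_series_cvg _ _ _ (fun n => rnorm (c n.+1)) C); last exact: sumC.
    move=> n; rewrite rnorm_bopZ ler_piMr ?rnorm_ge0//; exact: rnorm_bopX.
  by rewrite (@sum_ge1_cvg _ (fun n => c n *: S ^+ n) _ cv).
rewrite (_ : series _ = series (fun n => fourier psi (- n.+1%:Z) *: adj T ^+ n.+1) +
    series (fun n => fourier psi n.+1%:Z *: T ^+ n.+1)).
  rewrite (_ : op_tilde psi T - _ = sum_ge1 (fun n => fourier psi (- n%:Z) *: adj T ^+ n)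
                     + sum_ge1 (fun n => fourier psi n%:Z *: T ^+ n)).
    apply: cvgD.
      apply: (conv (fun n => fourier psi (- n%:Z))) => [|n]; last by rewrite lerDr rnorm_ge0.
      exact: le_trans (rnorm_adj e_onb T) T1.
    by apply: (conv (fun n => fourier psi n%:Z)) => // n; rewrite lerDl rnorm_ge0.
  by rewrite /op_tilde -[X in X - _]addrA [LHS]addrC addKr.
by apply/funext => n; rewrite -[RHS]/(_ n + _ n) /series /= -big_split.
Qed.

Theorem op_tilde_trace (psi : R -> R[i]) (T T0 : bop H) :
  rnorm T <= 1 -> rnorm T0 <= 1 -> trace_class (T - T0) -> class_Gtilde psi ->
  trace_class (op_tilde psi T - op_tilde psi T0) /\
  series (fun n => fourier psi (- n.+1%:Z) * conjc (trace (T ^+ n.+1 - T0 ^+ n.+1))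
                 + fourier psi n.+1%:Z * trace (T ^+ n.+1 - T0 ^+ n.+1)) @ \oo
    --> trace (op_tilde psi T - op_tilde psi T0).
Proof.
move=> T1 T01 /(trace_class_bound e_onb)[K hK] hpsi.
have [C hC] := gtilde_summable hpsi.
have K0 : 0 <= K by apply: le_trans (rnorm_trace hK); exact: rnorm_ge0.
pose Y n := fourier psi (- n.+1%:Z) *: (adj T ^+ n.+1 - adj T0 ^+ n.+1) +
  fourier psi n.+1%:Z *: (T ^+ n.+1 - T0 ^+ n.+1).
pose t n := trace (T ^+ n.+1 - T0 ^+ n.+1).
have tb n : trace_bound (T ^+ n.+1 - T0 ^+ n.+1) (n.+1%:R * K).
  exact: trace_bound_pow.
have ap n : adjoint_pair (T ^+ n.+1 - T0 ^+ n.+1) (adj T ^+ n.+1 - adj T0 ^+ n.+1).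
  by apply: adjoint_pairB; apply: adjoint_pairX; exact: (adjP e_onb).
have Yb n : trace_bound (Y n) (n.+1%:R *
    (rnorm (fourier psi n.+1%:Z) + rnorm (fourier psi (- n.+1%:Z))) * K).
  have h1 := trace_boundZ (fourier psi n.+1%:Z) (tb n).
  have h2 := trace_boundZ (fourier psi (- n.+1%:Z)) (trace_bound_adj (ap n) (tb n)).
  apply: trace_boundW (trace_boundD h2 h1).
  by rewrite [X in _ <= X]mulrAC mulrDr addrC !(mulrC (rnorm _)).
have YC N : \sum_(0 <= n < N) (n.+1%:R * (rnorm (fourier psi n.+1%:Z) +
    rnorm (fourier psi (- n.+1%:Z))) * K) <= C * K.
  rewrite -mulr_suml ler_wpM2r//; apply: le_trans (hC N.+1).
  by rewrite big_nat_recl// mul0r add0r.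
have Yc : series Y @ \oo --> op_tilde psi T - op_tilde psi T0.
  rewrite (_ : op_tilde psi T - _ = (op_tilde psi T - fourier psi 0 *: (1 : bop H)) -
    (op_tilde psi T0 - fourier psi 0 *: (1 : bop H))); last by rewrite opprB addrA subrK.
  rewrite (_ : series Y = series (fun n => fourier psi (- n.+1%:Z) *: adj T ^+ n.+1
                 + fourier psi n.+1%:Z *: T ^+ n.+1) -
    series (fun n => fourier psi (- n.+1%:Z) *: adj T0 ^+ n.+1
                 + fourier psi n.+1%:Z *: T0 ^+ n.+1)).
    exact: cvgB (op_tilde_cvg T1 hpsi) (op_tilde_cvg T01 hpsi).
  apply/funext => N; rewrite -[RHS]/(_ N - _ N) /series /= -sumrB.
  by apply: eq_bigr => n _; rewrite /Y !scalerBr opprD addrACA.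
have [XK Xc] := trace_series Yb YC Yc.
split; first exact: (trace_bound_class e_onb XK).
rewrite (_ : series _ = series (fun n => trace (Y n)))//.
congr series; apply/funext => n; rewrite /Y.
have h2 := trace_bound_adj (ap n) (tb n).
rewrite (traceD (trace_boundZ _ h2) (trace_boundZ _ (tb n))).
by rewrite (traceZ _ h2) (traceZ _ (tb n)) (trace_adj (ap n) (tb n)).
Qed.

End FunctionalCalculusTrace.

(** * Integration of complex-valued functions *)

Section ComplexIntegral.
Context d (X : measurableType d) (R : realType).
Variables (mu : {measure set X -> \bar R}) (D : set X).
Hypothesis mD : measurable D.
Implicit Types (f g : X -> R[i]) (c : R[i]).

Lemma CintegrableD f g : Cintegrable mu D f -> Cintegrable mu D g ->
  Cintegrable mu D (fun x => f x + g x).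
Proof.
move=> [f1 f2] [g1 g2]; split.
- have := integrableD mD f1 g1; apply: eq_integrable => // x _ /=.
  by rewrite ReD EFinD.
- have := integrableD mD f2 g2; apply: eq_integrable => // x _ /=.
  by rewrite ImD EFinD.
Qed.

Lemma CintegralD f g : Cintegrable mu D f -> Cintegrable mu D g ->
  Cintegral mu D (fun x => f x + g x) = Cintegral mu D f + Cintegral mu D g.
Proof.
move=> [f1 f2] [g1 g2]; apply: complex_ext; rewrite ?ReD ?ImD /Cintegral/=.
- by rewrite -RintegralD//; apply: eq_Rintegral => x _; rewrite ReD.
- by rewrite -RintegralD//; apply: eq_Rintegral => x _; rewrite ImD.
Qed.

(** The real and the imaginary part of c f are both of this form, so one statement covers both
    halves of complex homogeneity. *)
Lemma Cintegrable_comb (a b : R) f : Cintegrable mu D f ->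
  mu.-integrable D (fun x => (a * Re (f x) + b * Im (f x))%:E) /\
  \int[mu]_(x in D) (a * Re (f x) + b * Im (f x)) =
  a * \int[mu]_(x in D) Re (f x) + b * \int[mu]_(x in D) Im (f x).
Proof.
move=> [f1 f2].
have h1 : mu.-integrable D (EFin \o (fun x => a * Re (f x))).
  by have := integrableZl mD a f1; apply: eq_integrable => // x _ /=; rewrite EFinM.
have h2 : mu.-integrable D (EFin \o (fun x => b * Im (f x))).
  by have := integrableZl mD b f2; apply: eq_integrable => // x _ /=; rewrite EFinM.
split.
  by have := integrableD mD h1 h2; apply: eq_integrable => // x _ /=; rewrite EFinD.
by rewrite RintegralD// !RintegralZl.
Qed.

Lemma CintegrableZ c f : Cintegrable mu D f -> Cintegrable mu D (fun x => c * f x).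
Proof.
move=> hf; split.
- have := (Cintegrable_comb (Re c) (- Im c) hf).1; apply: eq_integrable => // x _ /=.
  by rewrite ReM mulNr.
- have := (Cintegrable_comb (Im c) (Re c) hf).1; apply: eq_integrable => // x _ /=.
  by rewrite ImM addrC.
Qed.

Lemma CintegralZ c f : Cintegrable mu D f ->
  Cintegral mu D (fun x => c * f x) = c * Cintegral mu D f.
Proof.
move=> hf; apply: complex_ext; rewrite ?ReM ?ImM /Cintegral/=.
- rewrite -mulNr -(Cintegrable_comb (Re c) (- Im c) hf).2; apply: eq_Rintegral => x _.
  by rewrite ReM mulNr.
- rewrite addrC -(Cintegrable_comb (Im c) (Re c) hf).2; apply: eq_Rintegral => x _.
  by rewrite ImM addrC.
Qed.

Lemma eq_Cintegral f g : (forall x, D x -> f x = g x) ->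
  Cintegral mu D f = Cintegral mu D g.
Proof.
by move=> fg; congr (_ +i* _); apply: eq_Rintegral => x; rewrite inE => /fg ->.
Qed.

Lemma eq_Cintegrable f g : (forall x, D x -> f x = g x) ->
  Cintegrable mu D f -> Cintegrable mu D g.
Proof.
by move=> fg [h1 h2]; split; [move: h1|move: h2]; apply: eq_integrable => // x;
  rewrite inE => /fg ->.
Qed.

Lemma Cintegrable0 : Cintegrable mu D (fun=> 0).
Proof. by split; exact: integrable0. Qed.

Lemma Cintegral0 : Cintegral mu D (fun=> 0) = 0.
Proof. by apply: complex_ext; rewrite /Cintegral/= Rintegral_cst// mul0r. Qed.

Lemma Cintegrable_sum (F : nat -> X -> R[i]) n :
  (forall k, Cintegrable mu D (F k)) ->
  Cintegrable mu D (fun x => \sum_(0 <= k < n) F k x).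
Proof.
move=> h; elim: n => [|n ih].
  by apply: eq_Cintegrable Cintegrable0 => x _; rewrite big_geq.
by apply: eq_Cintegrable (CintegrableD ih (h n)) => x _; rewrite big_nat_recr.
Qed.

Lemma Cintegral_sum (F : nat -> X -> R[i]) n :
  (forall k, Cintegrable mu D (F k)) ->
  Cintegral mu D (fun x => \sum_(0 <= k < n) F k x) =
  \sum_(0 <= k < n) Cintegral mu D (F k).
Proof.
move=> h; elim: n => [|n ih].
  by rewrite big_geq// -[RHS]Cintegral0; apply: eq_Cintegral => x _; rewrite big_geq.
rewrite big_nat_recr//= -ih -CintegralD//; last exact: Cintegrable_sum.
by apply: eq_Cintegral => x _; rewrite big_nat_recr.
Qed.

Lemma Rdominated_convergence (f_ : nat -> X -> R) (f g : X -> R) :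
  (forall n, mu.-integrable D (EFin \o f_ n)) ->
  (forall x, D x -> (fun n => f_ n x) @ \oo --> f x) ->
  mu.-integrable D (EFin \o g) ->
  (forall n x, D x -> `|f_ n x| <= g x) ->
  mu.-integrable D (EFin \o f) /\
  (fun n => \int[mu]_(x in D) f_ n x) @ \oo --> \int[mu]_(x in D) f x.
Proof.
move=> hf hc hg fg.
have hc' x : D x -> (fun n => (f_ n x)%:E) @ \oo --> (f x)%:E.
  by move=> Dx; apply: cvg_EFin; [exact: nearW|exact: hc].
have mf n := measurable_int mu (hf n).
have mf' : measurable_fun D (EFin \o f).
  exact: (emeasurable_fun_cvg _ _ mf hc').
have [] := @dominated_convergence _ _ _ mu D mD (fun n => EFin \o f_ n) (EFin \o f)
  (EFin \o g) mf mf' _ hg _.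
- by apply: aeW => x; exact: hc'.
- by apply: aeW => x n Dx; rewrite /= lee_fin fg.
move=> fi _ fl; split=> //; apply: fine_cvg.
by rewrite /Rintegral fineK; [exact: fl|exact: integrable_fin_num].
Qed.

Lemma Cdominated_convergence (f_ : nat -> X -> R[i]) (f : X -> R[i]) (g : X -> R) :
  (forall n, Cintegrable mu D (f_ n)) ->
  (forall x, D x -> (fun n => f_ n x) @ \oo --> f x) ->
  mu.-integrable D (EFin \o g) ->
  (forall n x, D x -> rnorm (f_ n x) <= g x) ->
  Cintegrable mu D f /\
  (fun n => Cintegral mu D (f_ n)) @ \oo --> Cintegral mu D f.
Proof.
move=> hf hc hg fg.
have [] := @Rdominated_convergence (fun n x => Re (f_ n x)) (fun x => Re (f x)) g.
- by move=> n; have [] := hf n.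
- by move=> x Dx; apply: cvg_Re; exact: hc.
- by [].
- by move=> n x Dx; apply: le_trans (Re_le_rnorm _) _; exact: fg.
move=> h1 h2.
have [] := @Rdominated_convergence (fun n x => Im (f_ n x)) (fun x => Im (f x)) g.
- by move=> n; have [] := hf n.
- by move=> x Dx; apply: cvg_Im; exact: hc.
- by [].
- by move=> n x Dx; apply: le_trans (Im_le_rnorm _) _; exact: fg.
by move=> h3 h4; split=> //; exact: cvg_ReIm.
Qed.

End ComplexIntegral.

(** * Fourier coefficients and the spectral shift function *)

Section Circle.
Variable R : realType.
Implicit Types (t : R) (z : R[i]).
Local Notation mu := (@lebesgue_measure R).
Local Notation I := (`[0, 2 * pi]%classic).

Lemma measurable_circle : measurable (I : set (measurableTypeR R)).
Proof. exact: measurable_itv. Qed.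

Lemma expi0 : expi (0 : R) = 1.
Proof. by rewrite /expi cos0 sin0. Qed.

Lemma expiD s t : expi (s + t) = expi s * expi t.
Proof. by apply: complex_ext; rewrite ?ReM ?ImM /= ?cosD ?sinD// addrC. Qed.

Lemma expiN t : expi (- t) = conjc (expi t).
Proof. by rewrite /expi cosN sinN. Qed.

Lemma expiX n t : expi (n%:R * t) = expi t ^+ n.
Proof.
elim: n => [|n ih]; first by rewrite mul0r expi0.
by rewrite -natr1 mulrDl mul1r expiD ih exprSr.
Qed.

Lemma rnorm_expi t : rnorm (expi t) = 1.
Proof.
by apply/eqP; rewrite -(@eqrXn2 _ 2) ?rnorm_ge0// rnorm_sqr /= cos2Dsin2 expr1n.
Qed.

Lemma expi_periodic n t : expi (t + n%:R * (2 * pi)) = expi t.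
Proof.
rewrite expiD expiX (_ : expi (2 * pi) = 1) ?expr1n ?mulr1//.
by rewrite /expi mulr_natl cos2pi sin2pi.
Qed.

Section IntegrableData.
Variable xi : R -> R.
Hypothesis hxi : mu.-integrable I (EFin \o xi).

Lemma integrable_mul_cont (h : R -> R) (M : R) : continuous h ->
  (forall t, `|h t| <= M) -> mu.-integrable I (EFin \o (fun t => xi t * h t)).
Proof.
move=> ch hM.
have mI := measurable_circle.
have := @integrableMl _ _ _ mu I mI (EFin \o xi) h hxi.
have mh : measurable_fun I h.
  by apply: measurable_funTS; exact: continuous_measurable_fun.
move=> /(_ mh); apply.
exists M; split; first exact: num_real.
by move=> y My x _; apply: le_trans (hM x) (ltW My).
Qed.

Lemma Cintegrable_expi (c : R) :
  Cintegrable mu I (fun t => (xi t)%:C * expi (c * t)).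
Proof.
have cc : continuous (fun t : R => c * t) by move=> t; exact: mulrl_continuous.
split.
- have h : continuous (fun t : R => cos (c * t)).
    by move=> t; apply: continuous_comp; [exact: cc|exact: continuous_cos].
  have := @integrable_mul_cont _ 1 h.
  move=> /(_ _); have hb t : `|cos (c * t)| <= 1 by rewrite ler_norml cos_geN1 cos_le1.
  move=> /(_ hb); apply: eq_integrable => [|t _ /=]; first exact: measurable_circle.
  by rewrite mul0r subr0.
- have h : continuous (fun t : R => sin (c * t)).
    by move=> t; apply: continuous_comp; [exact: cc|exact: continuous_sin].
  have := @integrable_mul_cont _ 1 h.
  have hb t : `|sin (c * t)| <= 1 by rewrite ler_norml sin_geN1 sin_le1.
  move=> /(_ hb); apply: eq_integrable => [|t _ /=]; first exact: measurable_circle.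
  by rewrite mul0r addr0.
Qed.

Let xiC t := (xi t)%:C.
Local Notation E n := (fun t => xiC t * expi (- (n%:~R * t))).

Lemma Cintegrable_fourier (n : int) : Cintegrable mu I (E n).
Proof.
have := Cintegrable_expi (- n%:~R); apply: (eq_Cintegrable measurable_circle) => t _.
by rewrite mulNr.
Qed.

Lemma fourier_conj (n : int) : fourier xiC (- n) = conjc (fourier xiC n).
Proof.
rewrite /fourier conjcM conjc_real; congr (_ * _).
rewrite /circle_int /Cintegral.
apply: complex_ext => /=.
- by apply: eq_Rintegral => t _; rewrite mulrNz mulNr opprK cosN sinN !mul0r.
- have h : mu.-integrable I (EFin \o (fun t => Im (E n t))) by have [] := Cintegrable_fourier n.
  rewrite -[RHS]mulN1r -RintegralZl//.
  by apply: eq_Rintegral => t _; rewrite mulrNz mulNr opprK /= sinN !mul0r !addr0 mulN1r mulrN opprK.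
Qed.

Lemma fourier_bounded : exists C, forall n, rnorm (fourier xiC n) <= C.
Proof.
pose K := \int[mu]_(t in I) `|xi t|.
exists ((2 * pi)^-1 * (K + K)) => n; rewrite /fourier rnormM rnormR.
have p0 : 0 <= (2 * pi)^-1 :> R by rewrite invr_ge0 mulr_ge0// pi_ge0.
rewrite ger0_norm// ler_wpM2l//.
have [h1 h2] := Cintegrable_fourier n.
have mI := measurable_circle.
have aux (f : R -> R) : mu.-integrable I (EFin \o f) -> (forall t, `|f t| <= `|xi t|) ->
    `|\int[mu]_(t in I) f t| <= K.
  move=> fi fxi; apply: le_trans (le_normr_Rintegral mI fi) _.
  by apply: le_Rintegral => //; [exact: integrable_norm|exact: integrable_norm].
apply: le_trans (rnorm_le_ReIm _) _; apply: lerD; apply: aux => // t.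
- apply: le_trans (Re_le_rnorm (E n t)) _.
  by rewrite rnormM rnormR rnorm_expi mulr1.
- apply: le_trans (Im_le_rnorm (E n t)) _.
  by rewrite rnormM rnormR rnorm_expi mulr1.
Qed.

End IntegrableData.

Lemma series_delta (V : normedModType R[i]) (u : nat -> V) n :
  series (fun k => (k == n)%:R *: u k) @ \oo --> u n.
Proof.
apply/cvg_rnormP/cvgrPdist_le => r r0; exists n.+1 => // N /= nN.
rewrite /series /= (bigD1_seq n) ?iota_uniq ?mem_index_iota//= eqxx scale1r.
rewrite big1 ?addr0 ?subrr ?rnorm0 ?subr0 ?normr0 ?(ltW r0)//.
by move=> k /negPf ->; rewrite scale0r.
Qed.

(** Admits the monomials z^n as test functions in [spectral_shift]. *)
Lemma class_G_delta n : class_G (fun k => (k == n)%:R : R[i]).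
Proof.
rewrite /class_G; apply: (@le_lt_trans _ _ (n%:R)%:E); last exact: ltry.
apply: lime_le.
  by apply: is_cvg_nneseries => k _ _; rewrite lee_fin rnorm_ge0.
apply: nearW => N; rewrite sumEFin lee_fin.
have h k : rnorm (k%:R * (k == n)%:R : R[i]) = if k == n then n%:R else 0.
  by case: eqP => [->|_]; rewrite ?mulr1 ?rnorm_nat// mulr0 rnorm0.
under eq_bigr do rewrite h.
rewrite -big_mkcond/=; have [nN|Nn] := ltnP n N.
  rewrite big_mkord (big_pred1 (Ordinal nN))// => k.
rewrite big_nat_cond big_pred0// => k; apply/negP => /andP[/andP[_ kN] /eqP kn].
by move: kN; rewrite kn ltnNge Nn.
Qed.

Lemma Cderive1_expi (c t : R) :
  Cderive1 (fun s => expi (c * s)) t = 'i * c%:C * expi (c * t).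
Proof.
have d : is_derive t 1 (fun s : R => c * s) c.
  by apply: is_derive_eq; rewrite /GRing.scale/= mulr1.
have dcos : is_derive t 1 (fun s => cos (c * s)) (- (c * sin (c * t))).
  have := @is_derive1_comp _ cos (fun s => c * s) t _ _ (is_derive_cos _) d.
  by rewrite mulNr mulrC.
have dsin : is_derive t 1 (fun s => sin (c * s)) (c * cos (c * t)).
  have := @is_derive1_comp _ sin (fun s => c * s) t _ _ (is_derive_sin _) d.
  by rewrite mulrC.
rewrite /Cderive1 /expi /= !derive1E (derive_val (is_derive := dcos)).
rewrite (derive_val (is_derive := dsin)).
by apply: complex_ext; rewrite ?ReM ?ImM /= ?ReM ?ImM /=; ring.
Qed.

Lemma spectral_shift_trace (H : hilbertType R) (T T0 : bop H) (xi : R -> R) n :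
  spectral_shift T T0 xi ->
  trace (T ^+ n - T0 ^+ n) =
  'i * n%:R * (2 * pi)%:C * fourier (fun t => (xi t)%:C) (- n%:Z).
Proof.
move=> [hxi /(_ _ (class_G_delta n))].
have op (S : bop H) : op_power_series (fun k => (k == n)%:R) S = S ^+ n.
  by apply: rcvg_lim; exact: (@series_delta (bop H) (fun k => S ^+ k) n).
have ps z : power_series (fun k => (k == n)%:R) z = z ^+ n.
  by apply: rcvg_lim; exact: (@series_delta R[i] (fun k => z ^+ k) n).
rewrite !op => ->; rewrite /fourier.
have pi0 : (2 * pi)%:C != 0 :> R[i].
  by rewrite -[0]/((0 : R)%:C) (inj_eq (@complexI R)) mulf_neq0// gt_eqF// pi_gt0.
rewrite [RHS]mulrA -[_ * (2 * pi)%:C * _]mulrA -rmorphM/= mulfV ?mulr1; last first.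
  by rewrite mulf_neq0// gt_eqF// pi_gt0.
have mI := measurable_circle.
rewrite -CintegralZ//; last exact: Cintegrable_fourier.
apply: eq_Cintegral => t _.
under [X in Cderive1 X]eq_fun do rewrite ps -expiX.
rewrite Cderive1_expi mulrNz mulNr opprK rmorph_nat.
by rewrite -!mulrA; congr (_ * _); congr (_ * _); rewrite mulrC.
Qed.

End Circle.

(** * Power series and Wirtinger derivatives *)

Section PowerSeries.
Variable R : realType.
Implicit Types (z w : R[i]) (c p q : nat -> R[i]) (r : R).

Lemma geometric_le r N : 0 <= r -> r < 1 ->
  \sum_(0 <= n < N) r ^+ n <= (1 - r)^-1.
Proof.
move=> r0 r1; have r10 : 0 < 1 - r by rewrite subr_gt0.
suff h : \sum_(0 <= n < N) r ^+ n * (1 - r) = 1 - r ^+ N.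
  by rewrite -[leRHS]mul1r ler_pdivlMr// mulr_suml h gerBl exprn_ge0.
elim: N => [|N ih]; first by rewrite big_geq// expr0 subrr.
by rewrite big_nat_recr//= ih mulrBr mulr1 -exprSr addrA subrK.
Qed.

(** Summation by parts: multiplication by 1 - r replaces the coefficients of [a] by their
    increments, which [b] dominates. Starting from the geometric series, two applications bound the
    sums of (n+1) r^n and (n+1)^2 r^n. *)
Lemma sum_weighted_le (a b : nat -> R) r (M : R) N : 0 <= r -> r < 1 ->
  (forall n, 0 <= a n) -> a 0%N <= b 0%N -> (forall n, a n.+1 - a n <= b n.+1) ->
  (forall N, \sum_(0 <= n < N) b n * r ^+ n <= M) ->
  \sum_(0 <= n < N) a n * r ^+ n <= M / (1 - r).
Proof.
move=> r0 r1 a0 ab0 ab bM; have r10 : 0 < 1 - r by rewrite subr_gt0.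
rewrite ler_pdivlMr//; apply: le_trans (bM N.+1).
(* The boundary term [a N * r ^+ N] of the summation by parts is kept, so that the induction closes,
   and is dropped afterwards by positivity. *)
suff h : (\sum_(0 <= n < N) a n * r ^+ n) * (1 - r) + a N * r ^+ N <=
    \sum_(0 <= n < N.+1) b n * r ^+ n.
  by apply: le_trans h; rewrite lerDl mulr_ge0// exprn_ge0.
elim: N => [|N ih].
  by rewrite big_geq// mul0r add0r big_nat1 expr0 !mulr1.
rewrite [leRHS]big_nat_recr//= big_nat_recr//= mulrDl.
have := ler_wpM2r (exprn_ge0 N.+1 r0) (ab N).
rewrite mulrBl exprS; move: ih.
set s := \sum_(0 <= i < N) _; set t := \sum_(0 <= i < N.+1) _; set x := r ^+ N.
lra.
Qed.

Lemma sum_linear_le r N : 0 <= r -> r < 1 ->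
  \sum_(0 <= n < N) n.+1%:R * r ^+ n <= (1 - r)^-1 / (1 - r).
Proof.
move=> r0 r1; apply: (@sum_weighted_le _ (fun=> 1)) => //.
- by move=> n; rewrite -(natr1 n.+1) addrAC subrr add0r.
- by move=> M; under eq_bigr do rewrite mul1r; exact: geometric_le.
Qed.

Lemma sum_quadratic_le r N : 0 <= r -> r < 1 ->
  \sum_(0 <= n < N) n.+1%:R ^+ 2 * r ^+ n <= (2 * ((1 - r)^-1 / (1 - r))) / (1 - r).
Proof.
move=> r0 r1; apply: (@sum_weighted_le _ (fun n => 2 * n.+1%:R)) => //.
- by rewrite expr1n mulr1 ler1n.
- move=> n; rewrite -(natr1 n.+1); set x := n.+1%:R.
  rewrite sqrrD1 !mulr2n; lra.
- move=> M; under eq_bigr do rewrite -mulrA; rewrite -mulr_sumr ler_wpM2l//.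
  exact: sum_linear_le.
Qed.

(** Without constant term: only the coefficients of positive index need a bound, and the exponents
    of the derived series stay natural. *)
Definition pos_series c z : R[i] := limn (series (fun n => c n.+1 * z ^+ n.+1)).
Definition pos_series_deriv c z : R[i] :=
  limn (series (fun n => n.+1%:R * c n.+1 * z ^+ n)).

Section Bounded.
Variables (c : nat -> R[i]) (C : R).
Hypothesis cC : forall n, rnorm (c n.+1) <= C.

Let C0 : 0 <= C.
Proof. exact: le_trans (rnorm_ge0 (c 1%N)) (cC 0%N). Qed.

Lemma pos_series_bound z N : rnorm z < 1 ->
  \sum_(0 <= n < N) rnorm (c n.+1 * z ^+ n.+1) <= C * (1 - rnorm z)^-1.
Proof.
move=> z1; apply: le_trans (ler_wpM2l C0 (geometric_le N (rnorm_ge0 z) z1)).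
rewrite mulr_sumr; apply: ler_sum => n _; rewrite rnormM rnormX.
rewrite ler_pM ?rnorm_ge0 ?exprn_ge0 ?rnorm_ge0//.
by rewrite exprS ler_piMl ?exprn_ge0 ?rnorm_ge0// ltW.
Qed.

Lemma pos_series_cvg z : rnorm z < 1 ->
  series (fun n => c n.+1 * z ^+ n.+1) @ \oo --> pos_series c z.
Proof. by move=> z1; exact: complex_series_cvg (fun N => pos_series_bound N z1). Qed.

Lemma pos_series_deriv_bound z r N : rnorm z <= r -> r < 1 ->
  \sum_(0 <= n < N) rnorm (n.+1%:R * c n.+1 * z ^+ n) <= C * ((1 - r)^-1 / (1 - r)).
Proof.
move=> zr r1; have r0 := le_trans (rnorm_ge0 z) zr.
apply: le_trans (ler_wpM2l C0 (sum_linear_le N r0 r1)).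
rewrite mulr_sumr; apply: ler_sum => n _; rewrite !rnormM rnormX rnorm_nat.
rewrite mulrAC mulrC ler_pM ?mulr_ge0 ?exprn_ge0 ?rnorm_ge0//.
by rewrite ler_wpM2l// lerXn2r ?nnegrE ?rnorm_ge0.
Qed.

Lemma pos_series_deriv_cvg z : rnorm z < 1 ->
  series (fun n => n.+1%:R * c n.+1 * z ^+ n) @ \oo --> pos_series_deriv c z.
Proof.
by move=> z1; exact: complex_series_cvg (fun N => pos_series_deriv_bound N (lexx _) z1).
Qed.

(** Induction on n: if d is the remainder for the exponent n + 1, the next one is (z + w) d + (n+1)
    z^n w^2. The factor [r] on the left stands for r^(n-1) on the right, which would be awkward at n
    = 0. *)
Lemma power_taylor z w r n : rnorm z <= r -> rnorm (z + w) <= r ->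
  rnorm ((z + w) ^+ n.+1 - z ^+ n.+1 - n.+1%:R * z ^+ n * w) * r <=
  n.+1%:R ^+ 2 * r ^+ n * rnorm w ^+ 2.
Proof.
move=> zr zwr; have r0 := le_trans (rnorm_ge0 z) zr.
elim: n => [|n ih].
  rewrite !expr1 expr0 !mul1r (addrC z) addrK subrr rnorm0 mul0r.
  by rewrite expr0 mulr1 expr1n mul1r sqr_ge0.
set d := _ - _ in ih.
have -> : (z + w) ^+ n.+2 - z ^+ n.+2 - n.+2%:R * z ^+ n.+1 * w =
    (z + w) * d + n.+1%:R * z ^+ n * w ^+ 2.
  rewrite /d -(natr1 n.+1) !exprS; set u := (z + w) ^+ n; set v := z ^+ n.
  by set x := n.+1%:R; ring.
have h1 : rnorm ((z + w) * d) * r <= r * (n.+1%:R ^+ 2 * r ^+ n * rnorm w ^+ 2).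
  by rewrite rnormM -mulrA ler_pM ?mulr_ge0 ?rnorm_ge0.
have h2 : rnorm (n.+1%:R * z ^+ n * w ^+ 2) <= n.+1%:R * r ^+ n * rnorm w ^+ 2.
  rewrite !rnormM !rnormX rnorm_nat ler_wpM2r ?sqr_ge0// ler_wpM2l//.
  by rewrite lerXn2r ?nnegrE ?rnorm_ge0.
have h3 := ler_wpM2r r0 (rnormD ((z + w) * d) (n.+1%:R * z ^+ n * w ^+ 2)).
have h4 := ler_wpM2r r0 h2.
apply: le_trans h3 _; rewrite mulrDl; apply: le_trans (lerD h1 h4) _.
rewrite (exprSr r n) -(natr1 n.+1); set x : R := n.+1%:R; set y := r ^+ n; set t := rnorm w ^+ 2.
have -> : r * (x ^+ 2 * y * t) + x * y * t * r = (x ^+ 2 + x) * (y * r * t) by ring.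
rewrite -(mulrA _ (y * r) t); apply: ler_wpM2r.
  by apply: mulr_ge0; [apply: mulr_ge0 => //; exact: exprn_ge0|exact: sqr_ge0].
have x0 : 0 <= x by [].
by rewrite sqrrD1 mulr2n; lra.
Qed.

(** Termwise differentiation in quantitative form. The remainder is quadratic in |w| uniformly in
    the direction of [w], so the same estimate serves for both real partial derivatives. *)
Lemma pos_series_taylor z : rnorm z < 1 -> exists K d : R, 0 < d /\
  forall w, rnorm w <= d ->
  rnorm (pos_series c (z + w) - pos_series c z - w * pos_series_deriv c z) <=
  K * rnorm w ^+ 2.
Proof.
(* [r] is the midpoint between |z| and 1, and [d] its distance from |z|; hence z and z + w both lie
   in the disc of radius [r]. *)
move=> z1; pose r := (1 + rnorm z) / 2; pose d := (1 - rnorm z) / 2.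
have z0 := rnorm_ge0 z.
have r0 : 0 < r by rewrite /r; lra.
have r1 : r < 1 by rewrite /r; lra.
have d0 : 0 < d by rewrite /d; lra.
have zr : rnorm z <= r by rewrite /r; lra.
pose Q := (2 * ((1 - r)^-1 / (1 - r))) / (1 - r).
exists (C * Q / r), d; split=> // w wd.
have zwr : rnorm (z + w) <= r.
  by apply: le_trans (rnormD _ _) _; rewrite /r; move: wd; rewrite /d; lra.
have c1 := pos_series_cvg (le_lt_trans zwr r1).
have c2 := pos_series_cvg z1.
have c3 := pos_series_deriv_cvg z1.
have c4 : (fun N => series (fun n => c n.+1 * (z + w) ^+ n.+1) N -
    series (fun n => c n.+1 * z ^+ n.+1) N -
    w *: series (fun n => n.+1%:R * c n.+1 * z ^+ n) N) @ \oo -->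
    pos_series c (z + w) - pos_series c z - w * pos_series_deriv c z.
  by apply: cvgB; [exact: cvgB c1 c2|exact: cvgZr c3].
apply: (cvgr_to_le (cvg_rnorm c4)); apply: nearW => N.
rewrite /series /= scaler_sumr -!sumrB; apply: le_trans (rnorm_sum _ _ _) _.
rewrite mulrAC ler_pdivlMr// mulr_suml.
have := ler_wpM2l C0 (ler_wpM2r (sqr_ge0 (rnorm w)) (sum_quadratic_le N (ltW r0) r1)).
rewrite -/Q [X in _ <= X]mulrA; apply: le_trans; rewrite mulr_suml mulr_sumr.
apply: ler_sum => n _.
have -> : c n.+1 * (z + w) ^+ n.+1 - c n.+1 * z ^+ n.+1 - w *: (n.+1%:R * c n.+1 * z ^+ n)
   = c n.+1 * ((z + w) ^+ n.+1 - z ^+ n.+1 - n.+1%:R * z ^+ n * w).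
  rewrite !mulrBr; congr (_ - _); rewrite -[LHS]/(w * _); ring.
rewrite rnormM -[leLHS]mulrA; apply: ler_pM; first exact: rnorm_ge0.
- exact: mulr_ge0 (rnorm_ge0 _) (ltW r0).
- exact: cC.
- exact: power_taylor.
Qed.

End Bounded.

(** [aux] isolates what [Re] and [Im] have in common, real linearity and domination by the modulus,
    and runs the difference quotient once for both. *)
Lemma Cderive1_quadratic (f : R -> R[i]) (s : R) (D : R[i]) (K d : R) : 0 < d ->
  (forall h, `|h| <= d -> rnorm (f (h + s) - f s - h%:C * D) <= K * h ^+ 2) ->
  Cderive1 f s = D.
Proof.
move=> d0 hf.
have aux (g : R[i] -> R) : (forall a b, g (a - b) = g a - g b) ->
    (forall a (x : R), g (x%:C * a) = x * g a) -> (forall a, `|g a| <= rnorm a) ->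
    derive1 (fun t => g (f t)) s = g D.
  move=> gB gZ gn; rewrite /derive1; apply/cvg_lim => //.
  apply/cvgrPdist_le => e e0.
  have K0 : 0 <= K.
    have := hf d; rewrite ger0_norm ?(ltW d0)// lexx => /(_ isT) h.
    by have := le_trans (rnorm_ge0 _) h; rewrite pmulr_lge0// exprn_gt0.
  have e1 : 0 < Num.min d (e / (K + 1)) by rewrite lt_min d0 divr_gt0// ltr_wpDl.
  near=> h.
  have h0 : h != 0 by near: h; exact: nbhs_dnbhs_neq.
  have : `|h| <= Num.min d (e / (K + 1)).
    by near: h; apply: dnbhs0_le.
  rewrite le_min => /andP[hd he].
  have nh : 0 < `|h| by rewrite normr_gt0.
  rewrite -(@ler_pM2l _ `|h|)// -normrM mulrBr /GRing.scale /= mulrA mulfV// mul1r.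
  rewrite distrC -!gB -gZ -gB; apply: le_trans (gn _) _; apply: le_trans (hf _ hd) _.
  rewrite -(real_normK (num_real h)) expr2 mulrA mulrC ler_wpM2l//.
  apply: le_trans (ler_wpM2l K0 he) _.
  by rewrite mulrA ler_pdivrMr ?ltr_wpDl// mulrC ler_wpM2l ?(ltW e0)// lerDl.
apply: complex_ext; rewrite /Cderive1 /=; apply: aux => *.
- exact: ReB.
- exact: ReZ.
- exact: Re_le_rnorm.
- exact: ImB.
- exact: ImZ.
- exact: Im_le_rnorm.
Unshelve. all: by end_near. Qed.

(** Along a unit direction v the derivative is conj(v q') + v p'. The directions 1 and i give the
    two partial derivatives, and each Wirtinger combination cancels one of the two summands. *)
Lemma wirtinger_harmonic (f : R[i] -> R[i]) (a : R[i]) p q (C : R) :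
  (forall n, rnorm (p n.+1) <= C) -> (forall n, rnorm (q n.+1) <= C) ->
  (forall z, rnorm z < 1 -> f z = a + conjc (pos_series q z) + pos_series p z) ->
  forall z, rnorm z < 1 ->
  partial_z f z = pos_series_deriv p z /\
  partial_zbar f z = conjc (pos_series_deriv q z).
Proof.
move=> pC qC fE z z1.
have [K1 [d1 [d10 h1]]] := pos_series_taylor pC z1.
have [K2 [d2 [d20 h2]]] := pos_series_taylor qC z1.
set p' := pos_series_deriv p z in h1 *; set q' := pos_series_deriv q z in h2 *.
pose d := Num.min (Num.min d1 d2) ((1 - rnorm z) / 2).
have d0 : 0 < d by rewrite !lt_min d10 d20 /=; lra.
have dir (v : R[i]) : rnorm v = 1 -> forall h : R, `|h| <= d ->
    rnorm (f (z + h%:C * v) - f z - h%:C * (conjc (v * q') + v * p')) <=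
    (K2 + K1) * h ^+ 2.
  move=> v1 h; rewrite !le_min => /andP[/andP[hd1 hd2] hz].
  have hv : rnorm (h%:C * v) = `|h| by rewrite rnormM v1 mulr1 rnormR.
  have zh1 : rnorm (z + h%:C * v) < 1.
    by apply: le_lt_trans (rnormD _ _) _; rewrite hv; lra.
  have := h1 (h%:C * v); have := h2 (h%:C * v); rewrite hv => /(_ hd2) g2 /(_ hd1) g1.
  rewrite (fE _ zh1) (fE _ z1).
  set A := pos_series p _ in g1 *; set B := pos_series q (z + _) in g2 *.
  set A' := pos_series p z in g1 *; set B' := pos_series q z in g2 *.
  have -> : a + conjc B + A - (a + conjc B' + A') - h%:C * (conjc (v * q') + v * p') =
     conjc (B - B' - h%:C * v * q') + (A - A' - h%:C * v * p').
    have E (a0 b A0 b' A0' h0 k l : R[i]) : a0 + b + A0 - (a0 + b' + A0') - h0 * (k + l) =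
      b - b' - h0 * k + (A0 - A0' - h0 * l) by ring.
    by rewrite !conjcB !conjcM conjc_real -!mulrA; exact: E.
  apply: le_trans (rnormD _ _) _; rewrite rnormJ mulrDl.
  by rewrite real_normK ?num_real// in g1 g2; exact: lerD.
have px : partial_x f z = conjc q' + p'.
  rewrite /partial_x; apply: (@Cderive1_quadratic _ _ _ (K2 + K1) d d0) => h hd.
  have := dir 1 (rnorm1 _) h hd; rewrite !mul1r mulr1.
  have -> : z + h%:C = (h + Re z) +i* Im z by apply: complex_ext; rewrite ?ReD ?ImD /= ?addr0// addrC.
  by have -> : Re z +i* Im z = z by case: (z).
have py : partial_y f z = conjc ('i * q') + 'i * p'.
  rewrite /partial_y; apply: (@Cderive1_quadratic _ _ _ (K2 + K1) d d0) => h hd.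
  have := dir 'i (rnormi _) h hd.
  have -> : z + h%:C * 'i = Re z +i* (h + Im z).
    apply: complex_ext; rewrite ?ReD ?ImD ?ReM ?ImM /= ?mulr0 ?mulr1 ?mul0r ?subr0 ?addr0//.
    by rewrite addrC.
  by have -> : Re z +i* Im z = z by case: (z).
have i2 : 'i * 'i = -1 :> R[i] by rewrite -expr2 sqr_i.
have ci : conjc 'i = - 'i :> R[i] by apply: complex_ext => /=; rewrite ?oppr0.
rewrite /partial_z /partial_zbar px py conjcM ci.
have two : (2 : R[i]) != 0 by rewrite pnatr_eq0.
split; apply: (mulfI two); rewrite mulrA divff// mul1r mulrDr !mulrA ?mulrN ?mulNr i2 !mulNr !mul1r; ring.
Qed.

End PowerSeries.

(** * The Poisson integral as a harmonic series *)

Section PoissonIntegral.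
Variable R : realType.
Implicit Types (t : R) (z w : R[i]).
Local Notation mu := (@lebesgue_measure R).
Local Notation I := (`[0, 2 * pi]%classic).

(** The series in conj(z) is written as the conjugate of a power series with conjugated
    coefficients, so that the results on [pos_series] apply to both halves. *)
Lemma tilde_pos_series (psi : R -> R[i]) (C : R) z :
  (forall n : nat, rnorm (fourier psi n.+1%:Z) <= C) ->
  (forall n : nat, rnorm (fourier psi (- n.+1%:Z)) <= C) -> rnorm z < 1 ->
  tilde psi z = fourier psi 0 +
    conjc (pos_series (fun n => conjc (fourier psi (- n%:Z))) z) +
    pos_series (fun n => fourier psi n%:Z) z.
Proof.
move=> hp hq z1; rewrite /tilde.
have h1 := pos_series_cvg (c := fun n : nat => fourier psi n%:Z) hp z1.
have hq' n : rnorm (conjc (fourier psi (- n.+1%:Z))) <= C by rewrite rnormJ.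
have h2 := cvg_conjc (pos_series_cvg (c := fun n : nat => conjc (fourier psi (- n%:Z))) hq' z1).
have -> : sum_ge1 (fun n => fourier psi n%:Z * z ^+ n) =
    pos_series (fun n => fourier psi n%:Z) z by apply: sum_ge1_cvg; exact: h1.
have -> : sum_ge1 (fun n => fourier psi (- n%:Z) * z^* ^+ n) =
    conjc (pos_series (fun n => conjc (fourier psi (- n%:Z))) z); last by [].
apply: sum_ge1_cvg; rewrite (_ : series _ = (fun N =>
    conjc (series (fun n => conjc (fourier psi (- n.+1%:Z)) * z ^+ n.+1) N))); first exact: h2.
apply/funext => N; rewrite /series (rmorph_sum (@conjc R)); apply: eq_bigr => n _.
rewrite -[RHS]/(conjc (conjc (fourier psi (- n.+1%:Z)) * z ^+ n.+1)).
by rewrite conjcM conjcX conjcK.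
Qed.

Lemma geometric_cvg w : rnorm w < 1 ->
  series (fun n => w ^+ n.+1) @ \oo --> w / (1 - w).
Proof.
move=> w1; have w10 : 1 - w != 0.
  rewrite subr_eq0; apply/eqP => E; by rewrite -E rnorm1 ltxx in w1.
have E N : series (fun n => w ^+ n.+1) N = w / (1 - w) - (w / (1 - w)) * w ^+ N.
  rewrite /series /=; elim: N => [|N ih]; first by rewrite big_geq// expr0 mulr1 subrr.
  by rewrite big_nat_recr//= ih exprS; move: (w ^+ N) => x; field.
apply/cvg_rnormP.
have -> : (fun N => rnorm (series (fun n => w ^+ n.+1) N - w / (1 - w))) =
    (fun N => rnorm (w / (1 - w)) * rnorm w ^+ N).
  by apply/funext => N; rewrite E addrC addKr rnormN rnormM rnormX.
rewrite -[X in _ --> X](mulr0 (rnorm (w / (1 - w)))); apply: cvgMr.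
by apply: cvg_expr; rewrite ger0_norm ?rnorm_ge0.
Qed.

(** Both sides are the real part of (1 + w) / (1 - w). *)
Lemma poisson_kernel w : rnorm w < 1 ->
  ((1 - rnorm w ^+ 2) / rnorm (1 - w) ^+ 2)%:C =
  1 + (conjc (w / (1 - w)) + w / (1 - w)).
Proof.
move=> w1; have w10 : 1 - w != 0.
  rewrite subr_eq0; apply/eqP => E; by rewrite -E rnorm1 ltxx in w1.
have wc0 : 1 - conjc w != 0.
  by apply: contra_neq w10 => /(congr1 (@conjc R)); rewrite conjcB conjcK conjc1 conjc0.
rewrite rmorphM fmorphV rmorphB /= -!mulcJ conjcB conjcM conjc_inv conjcB conjc1.
by field; rewrite w10 wc0.
Qed.

Variable xi : R -> R.
Hypothesis hxi : mu.-integrable I (EFin \o xi).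
Let xiC t := (xi t)%:C.
Local Notation E n := (fun t => xiC t * expi (- (n%:~R * t))).

(** The kernel is expanded into geometric series in w and conj(w) and integrated against [xi] term
    by term, by dominated convergence. The integrals of the terms are Fourier coefficients of
    [xi]. *)
Lemma poisson_tilde z : rnorm z < 1 -> poisson xiC z = tilde xiC z.
Proof.
move=> z1; have [C hC] := fourier_bounded hxi.
have -> := tilde_pos_series (fun n => hC n.+1%:Z) (fun n => hC (- n.+1%:Z)) z1.
have mI := @measurable_circle R.
pose F n (t : R) := (conjc z ^+ n.+1 * (E (- n.+1%:Z)) t + z ^+ n.+1 * (E n.+1%:Z) t).
have Fi n : Cintegrable mu I (F n).
  by apply: CintegrableD => //; apply: CintegrableZ => //; exact: Cintegrable_fourier.
pose f N t := (E 0) t + \sum_(0 <= n < N) F n t.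
have fi N : Cintegrable mu I (f N).
  apply: CintegrableD => //; first exact: Cintegrable_fourier.
  exact: Cintegrable_sum.
(* Since e^(it) - z = e^(it) (1 - w), the kernel depends only on [w t], whose modulus |z| does not
   vary with [t]. *)
pose w t := z * expi (- t).
have wz t : rnorm (w t) = rnorm z by rewrite /w rnormM rnorm_expi mulr1.
have w1 t : rnorm (w t) < 1 by rewrite wz.
have FE n t : F n t = xiC t * (conjc (w t ^+ n.+1) + w t ^+ n.+1).
  have e1 : expi (- ((- n.+1%:Z)%:~R * t)) = conjc (expi (- t)) ^+ n.+1.
    by rewrite mulrNz mulNr opprK expiN conjcK; exact: (expiX n.+1 t).
  have e2 : expi (- (n.+1%:Z%:~R * t)) = expi (- t) ^+ n.+1.
    by rewrite -mulrN; exact: (expiX n.+1 (- t)).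
  rewrite /F e1 e2 /w exprMn conjcM !conjcX.
  by rewrite mulrDr; congr (_ + _); rewrite mulrCA.
have fE N t : f N t = xiC t * (1 + (conjc (series (fun n => w t ^+ n.+1) N) +
    series (fun n => w t ^+ n.+1) N)).
  rewrite /f mul0r oppr0 expi0 mulr1 mulrDr mulr1; congr (_ + _).
  rewrite /series /= (rmorph_sum (@conjc R)) -big_split/= mulr_sumr.
  by apply: eq_bigr => n _; rewrite FE.
have kE t : ((1 - rnorm z ^+ 2) / rnorm (expi t - z) ^+ 2)%:C =
    1 + (conjc (w t / (1 - w t)) + w t / (1 - w t)).
  rewrite -poisson_kernel// wz; congr (((1 - _) / _ ^+ 2)%:C).
  have -> : expi t - z = expi t * (1 - w t).
    by rewrite /w mulrBr mulr1 mulrCA -expiD subrr expi0 mulr1.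
  by rewrite rnormM rnorm_expi mul1r.
(* The constant bounds every partial sum of the kernel: the term 1 and two geometric sums, each at
   most 1 / (1 - |z|). *)
pose g (t : R) := (1 + ((1 - rnorm z)^-1 + (1 - rnorm z)^-1)) * `|xi t|.
have [] := @Cdominated_convergence _ _ _ mu I mI f
  (fun t => ((1 - rnorm z ^+ 2) / rnorm (expi t - z) ^+ 2)%:C * xiC t) g fi.
- move=> t _; rewrite kE mulrC.
  have -> : (fun n => f n t) = (fun N => xiC t *: (1 + (conjc (series (fun n => w t ^+ n.+1) N) +
    series (fun n => w t ^+ n.+1) N))) by apply/funext => N; rewrite fE.
  apply: cvgZr; apply: cvgD; first exact: cvg_cst.
  by apply: cvgD; [apply: cvg_conjc|]; exact: geometric_cvg.
- have := integrableZl mI (1 + ((1 - rnorm z)^-1 + (1 - rnorm z)^-1)) (integrable_norm hxi).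
  by apply: eq_integrable.
- move=> N t _; rewrite fE rnormM rnormR /g mulrC ler_wpM2r//.
  apply: le_trans (rnormD _ _) _; rewrite rnorm1 lerD2l.
  apply: le_trans (rnormD _ _) _; rewrite rnormJ.
  suff h : rnorm (series (fun n => w t ^+ n.+1) N) <= (1 - rnorm z)^-1 by exact: lerD.
  apply: le_trans (rnorm_sum _ _ _) _.
  apply: le_trans (geometric_le N (rnorm_ge0 z) z1).
  apply: ler_sum => n _; rewrite rnormX wz exprS ler_piMl ?exprn_ge0 ?rnorm_ge0//.
  exact: ltW.
move=> _ lim1.
have lim2 : (fun N => ((2 * pi)^-1)%:C *: Cintegral mu I (f N)) @ \oo --> poisson xiC z.
  by apply: cvgZr; exact: lim1.
apply: rcvg_unique lim2 _.
have sE N : ((2 * pi)^-1)%:C *: Cintegral mu I (f N) = fourier xiC 0 +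
    conjc (series (fun n => conjc (fourier xiC (- n.+1%:Z)) * z ^+ n.+1) N) +
    series (fun n => fourier xiC n.+1%:Z * z ^+ n.+1) N.
  rewrite CintegralD//; first last.
  - exact: Cintegrable_sum.
  - exact: Cintegrable_fourier.
  rewrite scalerDr -addrA; congr (_ + _).
  rewrite Cintegral_sum// scaler_sumr /series (rmorph_sum (@conjc R)) -big_split.
  apply: eq_bigr => n _.
  rewrite -[RHS]/(conjc (conjc (fourier xiC (- n.+1%:Z)) * z ^+ n.+1) +
    fourier xiC n.+1%:Z * z ^+ n.+1) CintegralD//; first last.
  - by apply: CintegrableZ => //; exact: Cintegrable_fourier.
  - by apply: CintegrableZ => //; exact: Cintegrable_fourier.
  rewrite !CintegralZ//; try exact: Cintegrable_fourier.
  rewrite scalerDr conjcM conjcK conjcX; congr (_ + _).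
  - by rewrite -[LHS]/(_ * (_ * _)) /fourier mulrCA mulrC.
  - by rewrite -[LHS]/(_ * (_ * _)) /fourier mulrCA mulrC.
rewrite (_ : (fun N => _) = (fun N => fourier xiC 0 +
    conjc (series (fun n => conjc (fourier xiC (- n.+1%:Z)) * z ^+ n.+1) N) +
    series (fun n => fourier xiC n.+1%:Z * z ^+ n.+1) N)); last by apply/funext.
have hq' n : rnorm (conjc (fourier xiC (- n.+1%:Z))) <= C by rewrite rnormJ.
apply: cvgD; last exact: (pos_series_cvg (c := fun n : nat => fourier xiC n%:Z) (fun n => hC _) z1).
apply: cvgD; first exact: cvg_cst.
apply: cvg_conjc.
exact: (pos_series_cvg (c := fun n : nat => conjc (fourier xiC (- n%:Z))) hq' z1).
Qed.

End PoissonIntegral.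

(** * Green's formula and moments of the disc *)

Section GreenFormula.
Variable R : realType.
Local Notation mu := (@lebesgue_measure R).

(** Polynomials in two real variables, presented inductively so that measurability, continuity and
    boundedness on bounded sets follow by structural induction. *)
Inductive polyfun : (R -> R -> R) -> Prop :=
| Polyfun_cst c : polyfun (fun _ _ => c)
| Polyfun_x : polyfun (fun x _ => x)
| Polyfun_y : polyfun (fun _ y => y)
| Polyfun_add f g : polyfun f -> polyfun g -> polyfun (fun x y => f x y + g x y)
| Polyfun_mul f g : polyfun f -> polyfun g -> polyfun (fun x y => f x y * g x y).

Lemma polyfun_ext f g : (forall x y, f x y = g x y) -> polyfun f -> polyfun g.
Proof.
move=> fg hf; suff -> : g = f by [].
by apply/funext => x; apply/funext => y; rewrite fg.
Qed.

Lemma polyfun_sub f g : polyfun f -> polyfun g -> polyfun (fun x y => f x y - g x y).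
Proof.
move=> hf hg; apply: (@polyfun_ext (fun x y => f x y + (-1) * g x y)).
  by move=> x y; rewrite mulN1r.
by apply: Polyfun_add => //; apply: Polyfun_mul => //; exact: Polyfun_cst.
Qed.

Lemma polyfun_swap f : polyfun f -> polyfun (fun x y => f y x).
Proof.
by elim=> [c|||f' g' _ h1 _ h2|f' g' _ h1 _ h2]; [exact: Polyfun_cst|exact: Polyfun_y
  |exact: Polyfun_x|exact: Polyfun_add|exact: Polyfun_mul].
Qed.

Lemma polyfun_continuous f (u v : R -> R) : polyfun f -> continuous u -> continuous v ->
  continuous (fun t => f (u t) (v t)).
Proof.
move=> hf cu cv; elim: hf => [c|||f' g' _ h1 _ h2|f' g' _ h1 _ h2] t.
- exact: cvg_cst.
- exact: cu.
- exact: cv.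
- by apply: cvgD; [exact: h1|exact: h2].
- by apply: cvgM; [exact: h1|exact: h2].
Qed.

Lemma polyfun_measurable f : polyfun f ->
  measurable_fun setT (fun p : measurableTypeR R * measurableTypeR R => f p.1 p.2).
Proof.
elim=> [c|||f' g' _ h1 _ h2|f' g' _ h1 _ h2].
- exact: measurable_cst.
- exact: measurable_fst.
- exact: measurable_snd.
- exact: measurable_funD.
- exact: measurable_funM.
Qed.

Lemma polyfun_bounded f (r : R) : polyfun f -> exists M, forall x y,
  `|x| <= r -> `|y| <= r -> `|f x y| <= M.
Proof.
elim=> [c|||f' g' _ [M1 h1] _ [M2 h2]|f' g' _ [M1 h1] _ [M2 h2]].
- by exists `|c|.
- by exists r.
- by exists r.
- exists (M1 + M2) => x y xr yr; apply: le_trans (ler_normD _ _) _.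
  by rewrite lerD ?h1 ?h2.
- by exists (M1 * M2) => x y xr yr; rewrite normrM ler_pM ?h1 ?h2.
Qed.

Definition disc (r : R) : set (R * R) := [set p | rnorm (p.1 +i* p.2) <= r].

Lemma discE r x y : 0 <= r -> (disc r (x, y) : Prop) = (x ^+ 2 + y ^+ 2 <= r ^+ 2 : Prop).
Proof.
move=> r0; rewrite /disc /=; congr (is_true _).
by rewrite -(@ler_pXn2r _ 2)// ?nnegrE ?rnorm_ge0// rnorm_sqr.
Qed.

Lemma measurable_disc r : 0 <= r ->
  measurable (disc r : set (measurableTypeR R * measurableTypeR R)).
Proof.
move=> r0.
have h : polyfun (fun x y => x * x + y * y).
  by apply: Polyfun_add; apply: Polyfun_mul; do ?[exact: Polyfun_x|exact: Polyfun_y].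
have := polyfun_measurable h measurableT (measurable_itv `]-oo, r ^+ 2]).
rewrite setTI; congr (measurable _); apply/seteqP; split=> -[x y] /=.
- by rewrite in_itv/= (discE _ _ r0) !expr2.
- by rewrite in_itv/= (discE _ _ r0) !expr2.
Qed.

Lemma disc_coord r x y : 0 <= r -> disc r (x, y) -> `|x| <= r /\ `|y| <= r.
Proof.
move=> r0; rewrite /disc /= => h; split.
- exact: le_trans (Re_le_rnorm (x +i* y)) h.
- exact: le_trans (Im_le_rnorm (x +i* y)) h.
Qed.

Local Notation mu2 := (mu \x mu)%E.

Lemma disc_finite r : 0 <= r -> (mu2 (disc r) < +oo)%E.
Proof.
move=> r0; apply: (@le_lt_trans _ _ (mu2 (`[- r, r]%classic `*` `[- r, r]%classic))).
  apply: le_measure; rewrite ?inE.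
  - exact: measurable_disc.
  - by apply: measurableX; exact: measurable_itv.
  - move=> [x y] /(disc_coord r0)[]; rewrite !ler_norml => h1 h2.
    by split; rewrite /= in_itv.
rewrite product_measure1E; [|exact: measurable_itv|exact: measurable_itv].
have h : (mu `[(- r)%R, r]%classic < +oo)%E.
  by rewrite lebesgue_measure_itv/=; case: ifP => _; rewrite -?EFinD ltry.
by apply: lte_mul_pinfty => //; rewrite ge0_fin_numE.
Qed.

Lemma polyfun_integrable f r : 0 <= r -> polyfun f ->
  mu2.-integrable (disc r) (EFin \o (fun p => f p.1 p.2)).
Proof.
move=> r0 hf; apply: measurable_bounded_integrable.
- exact: measurable_disc.
- exact: disc_finite.
- by apply: measurable_funTS; exact: polyfun_measurable.
- have [M hM] := polyfun_bounded r hf.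
  exists M; split; first exact: num_real.
  move=> y My [a b] /(disc_coord r0)[ha hb]; apply: le_trans (ltW My).
  exact: hM.
Qed.

(** Fubini in both orders, the disc being symmetric in its coordinates. It lets [Cgreen_x] follow
    from [Cgreen_y]. *)
Lemma integral_disc_swap f r : 0 <= r -> polyfun f ->
  \int[mu2]_(p in disc r) f p.1 p.2 = \int[mu2]_(p in disc r) f p.2 p.1.
Proof.
move=> r0 hf.
have mD := measurable_disc r0.
have i1 := polyfun_integrable r0 hf.
have i2 := polyfun_integrable r0 (polyfun_swap hf).
rewrite /Rintegral; congr fine.
rewrite integral_mkcond [RHS]integral_mkcond.
rewrite -integral12_prod_meas1; last by rewrite -integrable_mkcond.
rewrite -integral21_prod_meas1; last by rewrite -integrable_mkcond.
apply: eq_integral => x _; apply: eq_integral => y _.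
rewrite /patch; have -> : ((x, y) \in disc r) = ((y, x) \in disc r).
  by apply/idP/idP; rewrite !inE !discE// addrC.
by [].
Qed.

Lemma disc_section r x : 0 < r -> - r <= x <= r ->
  [set y | disc r (x, y)] = `[- Num.sqrt (r ^+ 2 - x ^+ 2), Num.sqrt (r ^+ 2 - x ^+ 2)]%classic.
Proof.
move=> r0 xr; have x2 : 0 <= r ^+ 2 - x ^+ 2.
  rewrite subr_ge0 -(real_normK (num_real x)) lerXn2r ?nnegrE ?(ltW r0)//.
  by rewrite ler_norml.
apply/seteqP; split=> y /=; rewrite in_itv/= (discE _ _ (ltW r0)) -ler_norml.
- by move=> h; rewrite -sqrtr_sqr ler_sqrt// lerBrDl.
- move=> h; have := lerXn2r 2 (_ : `|y| \in Num.nneg) (_ : _ \in Num.nneg) h.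
  rewrite !nnegrE normr_ge0 sqrtr_ge0 => /(_ isT isT).
  by rewrite real_normK ?num_real// sqr_sqrtr// lerBrDl.
Qed.

Lemma disc_section0 r x : 0 < r -> ~~ (- r <= x <= r) -> [set y | disc r (x, y)] = set0.
Proof.
move=> r0 xr; apply/seteqP; split=> // y /(disc_coord (ltW r0))[h _].
by move: xr; rewrite -ler_norml h.
Qed.

Lemma integral_derive (f F : R -> R) (a b : R) : a <= b -> continuous f ->
  (forall y : R, is_derive y 1 F (f y)) ->
  (\int[mu]_(y in `[a, b]) (f y)%:E = (F b - F a)%:E)%E.
Proof.
(* The degenerate interval does occur: the vertical section of the disc at x = r or x = -r is a
   single point. *)
move=> ab cf dF; have [->|nab] := eqVneq a b.
  by rewrite set_itv1 subrr integral_set1.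
have cF : continuous F.
  by move=> y; apply: differentiable_continuous; apply/derivable1_diffP;
    exact: (@ex_derive _ _ _ _ _ _ _ (dF y)).
rewrite EFinB; apply: continuous_FTC2.
- by rewrite lt_neqAle nab.
- exact: continuous_subspaceT.
- split.
  + by move=> y _; exact: (@ex_derive _ _ _ _ _ _ _ (dF y)).
  + exact: cvg_at_right_filter (cF a).
  + exact: cvg_at_left_filter (cF b).
- by move=> y _; rewrite derive1E; exact: (@derive_val _ _ _ _ _ _ _ (dF y)).
Qed.

(* Green's formula on the disc for [f = dF/dy]: the boundary integral of [F]
   against [dx] is evaluated through the angular primitive [P]. *)
Lemma green_disc (f F : R -> R -> R) (P : R -> R) (r : R) : 0 < r ->
  polyfun f -> polyfun F -> (forall x y : R, is_derive y 1 (F x) (f x y)) ->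
  (forall t : R, is_derive t 1 P (F (r * sin t) (r * cos t) * (r * cos t))) ->
  \int[mu2]_(p in disc r) f p.1 p.2 = P (- (pi / 2) + 2 * pi) - P (- (pi / 2)).
Proof.
move=> r0 hf hF dF dP.
have mD := measurable_disc (ltW r0).
have fi := polyfun_integrable (ltW r0) hf.
pose s x := Num.sqrt (r ^+ 2 - x ^+ 2).
pose G x := F x (s x) - F x (- s x).
have cs : continuous s.
  move=> x; apply: continuous_comp; last exact: sqrt_continuous.
  by apply: cvgB; [exact: cvg_cst|apply: exprn_continuous].
have cid : continuous (id : R -> R) by move=> x.
have cG : continuous G.
  move=> x; apply: cvgB; first exact: polyfun_continuous.
  by apply: polyfun_continuous => // y; apply: cvgN; exact: cs.
have step1 : (\int[mu2]_(p in disc r) (f p.1 p.2)%:E = \int[mu]_(x in `[(- r)%R, r]) (G x)%:E)%E.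
  rewrite integral_mkcond -integral12_prod_meas1; last by rewrite -integrable_mkcond.
  rewrite [RHS]integral_mkcond; apply: eq_integral => x _; rewrite /fubini_F.
  transitivity (\int[mu]_(y in [set y | disc r (x, y)]) (f x y)%:E)%E.
    rewrite [RHS]integral_mkcond; apply: eq_integral => y _.
    rewrite /patch; have -> : ((x, y) \in disc r) = (y \in [set y | disc r (x, y)]).
      by apply/idP/idP; rewrite !inE.
    by [].
  rewrite /patch (_ : (x \in `[- r, r]%classic) = (- r <= x <= r)); last first.
    by apply/idP/idP; rewrite inE /= in_itv.
  case: ifPn => xr.
    rewrite disc_section// (@integral_derive _ (F x))//.
    + by rewrite lerNl; apply: (@le_trans _ _ 0); rewrite ?oppr_le0 sqrtr_ge0.
    + by apply: (polyfun_continuous hf) => // y; exact: cvg_cst.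
  by rewrite disc_section0// integral_set0.
pose a : R := - (pi / 2); pose b : R := pi / 2.
have pi0 : 0 < pi / 2 :> R by rewrite divr_gt0// pi_gt0.
have ab : a <= b by rewrite /a /b; lra.
pose S (t : R) := r * sin t.
have dS (t : R) : is_derive t 1 S (r * cos t).
  by have := @is_deriveZ _ _ _ sin r t 1 _ (is_derive_sin t).
have S'E : derive1 S = (fun t => r * cos t).
  by apply/funext => t; rewrite derive1E; exact: (@derive_val _ _ _ _ _ _ _ (dS t)).
have cS' : continuous (derive1 S).
  by rewrite S'E => t; apply: cvgMr; exact: continuous_cos.
have cS : continuous S by move=> t; apply: cvgMr; exact: continuous_sin.
have Sa : S a = - r by rewrite /S /a sinN sin_pihalf mulrN1.
have Sb : S b = r by rewrite /S /b sin_pihalf mulr1.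
(* The substitution x = r sin t is increasing on [-pi/2, pi/2], where cos t >= 0, so that the
   half-height of the section becomes r cos t. *)
have step2 : (\int[mu]_(x in `[(- r)%R, r]) (G x)%:E =
    \int[mu]_(t in `[a, b]) (G (S t) * (r * cos t))%R%:E)%E.
  rewrite -{1}Sa -{1}Sb (@integration_by_substitution_increasing _ S G a b)//.
  - by apply: eq_integral => t _; rewrite S'E.
  - by move=> x y xab yab xy; rewrite /S ltr_pM2l// ltr_sin.

  - by apply/cvg_ex; exists (derive1 S a); exact: cvg_at_right_filter (cS' a).
  - by apply/cvg_ex; exists (derive1 S b); exact: cvg_at_left_filter (cS' b).
  - split.
    + by move=> y _; exact: (@ex_derive _ _ _ _ _ _ _ (dS y)).
    + exact: cvg_at_right_filter (cS a).
    + exact: cvg_at_left_filter (cS b).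
  - exact: continuous_subspaceT.
pose h t := F (r * sin t) (r * cos t) * (r * cos t) -
  F (r * sin t) (- (r * cos t)) * (r * cos t).
have step3 : (\int[mu]_(t in `[a, b]) (G (S t) * (r * cos t))%R%:E =
    \int[mu]_(t in `[a, b]) (h t)%:E)%E.
  apply: eq_integral => t; rewrite inE /= in_itv/= => tab; congr (_%:E).
  have -> : G (S t) = F (r * sin t) (r * cos t) - F (r * sin t) (- (r * cos t)).
    rewrite /G; have -> : s (S t) = r * cos t; last by [].
    rewrite /s /S; have -> : r ^+ 2 - (r * sin t) ^+ 2 = (r * cos t) ^+ 2.
      by have := cos2Dsin2 t; rewrite !exprMn => /(canRL (addrK _)) ->; ring.
    rewrite sqrtr_sqr ger0_norm// mulr_ge0 ?(ltW r0)//.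
    exact: cos_ge0_pihalf.
  by rewrite mulrBl.
(* The lower arc is the reflection of the upper one under t -> pi - t, which keeps sin t and changes
   the sign of cos t; its integrand is the derivative of -P(pi - t). At t = pi/2 the two primitives
   cancel, and at t = -pi/2 they leave the increment of [P] over a full turn. *)
have step4 : (\int[mu]_(t in `[a, b]) (h t)%:E =
    ((P b - P (pi - b)) - (P a - P (pi - a)))%:E)%E.
  apply: (@integral_derive h (fun t => P t - P (pi - t))) => //.
  - have c1 : continuous (fun t : R => r * cos t).
      by move=> t; apply: cvgMr; exact: continuous_cos.
    have c2 : continuous (fun t : R => - (r * cos t)) by move=> t; apply: cvgN; exact: c1.
    move=> t; apply: cvgB; apply: cvgM; do ?exact: c1; exact: polyfun_continuous.
  - move=> t.
    have d1 : is_derive (t : R) 1 (fun t : R => pi - t) (-1).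
      have := @is_deriveB _ _ _ (cst pi) id t 1 0 1 (is_derive_cst _ _ _) (is_derive_id _ _).
      by rewrite sub0r.
    have d2 := @is_derive1_comp _ P (fun t => pi - t) t _ _ (dP (pi - t)) d1.
    have sE : sin (pi - t) = sin t by rewrite addrC sinDpi sinN opprK.
    have cE : cos (pi - t) = - cos t by rewrite addrC cosDpi cosN.
    rewrite sE cE in d2.
    have d3 := is_deriveB (dP t) d2.
    have -> : h t = F (r * sin t) (r * cos t) * (r * cos t) -
      F (r * sin t) (r * - cos t) * (r * - cos t) * -1.
      by rewrite /h !mulrN; ring.
    exact: d3.
rewrite /Rintegral step1 step2 step3 step4 /=.
rewrite /a /b (_ : pi - pi / 2 = pi / 2); last by field.
rewrite (_ : pi - - (pi / 2) = - (pi / 2) + 2 * pi); last by field.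
ring.
Qed.

End GreenFormula.

(** * Moments of monomials in z and its conjugate over a disc *)

Section DiscMoments.
Variable R : realType.
Local Notation mu := (@lebesgue_measure R).
Local Notation mu2 := (mu \x mu)%E.

Definition is_Cderive (f : R -> R[i]) (t : R) (D : R[i]) :=
  is_derive t 1 (fun s => Re (f s)) (Re D) /\ is_derive t 1 (fun s => Im (f s)) (Im D).

Lemma is_Cderive_cst (c : R[i]) t : is_Cderive (fun=> c) t 0.
Proof. by split; exact: is_derive_cst. Qed.

Lemma is_CderiveD f g t D E : is_Cderive f t D -> is_Cderive g t E ->
  is_Cderive (fun s => f s + g s) t (D + E).
Proof.
move=> [f1 f2] [g1 g2]; split.
- by rewrite ReD (_ : (fun s => _) = (fun s => Re (f s)) + (fun s => Re (g s)));
    [exact: is_deriveD|apply/funext => s; rewrite ReD].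
- by rewrite ImD (_ : (fun s => _) = (fun s => Im (f s)) + (fun s => Im (g s)));
    [exact: is_deriveD|apply/funext => s; rewrite ImD].
Qed.

Lemma is_CderiveM f g t D E : is_Cderive f t D -> is_Cderive g t E ->
  is_Cderive (fun s => f s * g s) t (D * g t + f t * E).
Proof.
move=> [f1 f2] [g1 g2]; split.
- have h := is_deriveB (is_deriveM f1 g1) (is_deriveM f2 g2).
  rewrite (_ : (fun s => _) = (fun s => Re (f s)) * (fun s => Re (g s)) -
     (fun s => Im (f s)) * (fun s => Im (g s))); last first.
    by apply/funext => s; rewrite ReM.
  apply: is_derive_eq h _; rewrite /GRing.scale/= ReD !ReM; ring.
- have h := is_deriveD (is_deriveM f1 g2) (is_deriveM f2 g1).
  rewrite (_ : (fun s => _) = (fun s => Re (f s)) * (fun s => Im (g s)) +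
     (fun s => Im (f s)) * (fun s => Re (g s))); last first.
    by apply/funext => s; rewrite ImM.
  apply: is_derive_eq h _; rewrite /GRing.scale/= ImD !ImM; ring.
Qed.

Lemma is_Cderive_eq f t D E : is_Cderive f t D -> D = E -> is_Cderive f t E.
Proof. by move=> h <-. Qed.

Lemma is_CderiveZ (c : R[i]) f t D : is_Cderive f t D ->
  is_Cderive (fun s => c * f s) t (c * D).
Proof.
move=> h; apply: is_Cderive_eq (is_CderiveM (is_Cderive_cst c t) h) _.
by rewrite mul0r add0r.
Qed.

Lemma is_CderiveX f t D n : is_Cderive f t D ->
  is_Cderive (fun s => f s ^+ n) t (n%:R * f t ^+ n.-1 * D).
Proof.
move=> h; elim: n => [|n ih].
  by rewrite !mul0r; under eq_fun do rewrite expr0; exact: is_Cderive_cst.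
under eq_fun do rewrite exprS.
apply: is_Cderive_eq (is_CderiveM h ih) _; case: n {ih} => [|n] /=.
  by rewrite !expr0 !mul0r mulr0 addr0 mulr1 mul1r mul1r.
by rewrite exprS -(natr1 n.+1); move: (f t ^+ n) => x; ring.
Qed.

Lemma is_Cderive_expi (c t : R) :
  is_Cderive (fun s => expi (c * s)) t ('i%C * c%:C * expi (c * t)).
Proof.
have d : is_derive t 1 (fun s : R => c * s) c.
  by apply: is_derive_eq; rewrite /GRing.scale/= mulr1.
split.
- have := @is_derive1_comp _ cos (fun s => c * s) t _ _ (is_derive_cos _) d.
  congr (is_derive _ _ _ _); rewrite !ReM !ImM /=; ring.
- have := @is_derive1_comp _ sin (fun s => c * s) t _ _ (is_derive_sin _) d.
  congr (is_derive _ _ _ _); rewrite !ImM !ReM /=; ring.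
Qed.

Lemma is_Cderive_x (x y : R) : is_Cderive (fun s => s +i* y) x 1.
Proof. by split => /=; [exact: is_derive_id|exact: is_derive_cst]. Qed.

Lemma is_Cderive_y (x y : R) : is_Cderive (fun s => x +i* s) y 'i%C.
Proof. by split => /=; [exact: is_derive_cst|exact: is_derive_id]. Qed.

Lemma is_Cderive_conj f t D : is_Cderive f t D ->
  is_Cderive (fun s => conjc (f s)) t (conjc D).
Proof.
move=> [f1 f2]; split; first by rewrite ReJ; under eq_fun do rewrite ReJ.
rewrite ImJ; under eq_fun do rewrite ImJ.
exact: is_deriveN.
Qed.

Definition cpolyfun (f : R -> R -> R[i]) :=
  polyfun (fun x y => Re (f x y)) /\ polyfun (fun x y => Im (f x y)).

Lemma cpolyfunM f g : cpolyfun f -> cpolyfun g -> cpolyfun (fun x y => f x y * g x y).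
Proof.
move=> [f1 f2] [g1 g2]; split.
- apply: (@polyfun_ext _ (fun x y => Re (f x y) * Re (g x y) - Im (f x y) * Im (g x y))).
    by move=> x y; rewrite ReM.
  by apply: polyfun_sub; exact: Polyfun_mul.
- apply: (@polyfun_ext _ (fun x y => Re (f x y) * Im (g x y) + Im (f x y) * Re (g x y))).
    by move=> x y; rewrite ImM.
  by apply: Polyfun_add; exact: Polyfun_mul.
Qed.

Lemma cpolyfunD f g : cpolyfun f -> cpolyfun g -> cpolyfun (fun x y => f x y + g x y).
Proof.
move=> [f1 f2] [g1 g2]; split.
- apply: (@polyfun_ext _ (fun x y => Re (f x y) + Re (g x y))).
    by move=> x y; rewrite ReD.
  exact: Polyfun_add.
- apply: (@polyfun_ext _ (fun x y => Im (f x y) + Im (g x y))).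
    by move=> x y; rewrite ImD.
  exact: Polyfun_add.
Qed.

Lemma cpolyfun_cst c : cpolyfun (fun _ _ => c).
Proof. by split; exact: Polyfun_cst. Qed.

Definition monomial a b (z : R[i]) : R[i] := z ^+ a * conjc z ^+ b.

Lemma cpolyfun_monomial a b : cpolyfun (fun x y => monomial a b (x +i* y)).
Proof.
apply: cpolyfunM.
- elim: a => [|n ih]; first by under eq_fun do under eq_fun do rewrite expr0;
    exact: cpolyfun_cst.
  under eq_fun do under eq_fun do rewrite exprS.
  by apply: cpolyfunM => //; split => /=; [exact: Polyfun_x|exact: Polyfun_y].
- elim: b => [|n ih]; first by under eq_fun do under eq_fun do rewrite expr0;
    exact: cpolyfun_cst.
  under eq_fun do under eq_fun do rewrite exprS.
  apply: cpolyfunM => //; split => /=; first exact: Polyfun_x.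
  apply: (@polyfun_ext _ (fun x y => 0 - y)); first by move=> x y; rewrite sub0r.
  by apply: polyfun_sub; [exact: Polyfun_cst|exact: Polyfun_y].
Qed.

Lemma cpolyfun_integrable f r : 0 <= r -> cpolyfun f ->
  Cintegrable mu2 (disc r) (fun p => f p.1 p.2).
Proof.
move=> r0 [f1 f2]; split; first exact: (polyfun_integrable r0 f1).
exact: (polyfun_integrable r0 f2).
Qed.

Lemma Cgreen_y (f F : R -> R -> R[i]) (P : R -> R[i]) r : 0 < r ->
  cpolyfun f -> cpolyfun F -> (forall x y, is_Cderive (F x) y (f x y)) ->
  (forall t, is_Cderive P t (F (r * sin t) (r * cos t) * (r * cos t)%:C)) ->
  Cintegral mu2 (disc r) (fun p => f p.1 p.2) =
  P (- (pi / 2) + 2 * pi) - P (- (pi / 2)).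
Proof.
move=> r0 [f1 f2] [F1 F2] dF dP; apply: complex_ext.
- rewrite ReB; apply: (@green_disc _ (fun x y => Re (f x y)) (fun x y => Re (F x y))
    (fun t => Re (P t))) => //.
  + by move=> x y; exact: (dF x y).1.
  + by move=> t; have := (dP t).1; rewrite (mulrC (F _ _)) ReZ mulrC.
- rewrite ImB; apply: (@green_disc _ (fun x y => Im (f x y)) (fun x y => Im (F x y))
    (fun t => Im (P t))) => //.
  + by move=> x y; exact: (dF x y).2.
  + by move=> t; have := (dP t).2; rewrite (mulrC (F _ _)) ImZ mulrC.
Qed.

Lemma Cgreen_x (f F : R -> R -> R[i]) (P : R -> R[i]) r : 0 < r ->
  cpolyfun f -> cpolyfun F -> (forall x y, is_Cderive (F ^~ y) x (f x y)) ->
  (forall t, is_Cderive P t (F (r * cos t) (r * sin t) * (r * cos t)%:C)) ->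
  Cintegral mu2 (disc r) (fun p => f p.1 p.2) =
  P (- (pi / 2) + 2 * pi) - P (- (pi / 2)).
Proof.
move=> r0 [f1 f2] [F1 F2] dF dP.
rewrite -(@Cgreen_y (fun x y => f y x) (fun x y => F y x) P r r0)//; first last.
- by split; exact: polyfun_swap.
- by split; exact: polyfun_swap.
congr (_ +i* _).
- exact: (integral_disc_swap (ltW r0) f1).
- exact: (integral_disc_swap (ltW r0) f2).
Qed.

(** A primitive of e^(i(m-n)t). It is periodic except when m = n, so its increment over a turn
    expresses the orthogonality of the characters. *)
Definition trig_primitive m n (t : R) : R[i] :=
  if m == n then t%:C else ('i%C * (m%:R - n%:R))^-1 * expi ((m%:R - n%:R) * t).

Lemma expi_monomial m n (t : R) :
  expi ((m%:R - n%:R) * t) = monomial m n (expi t).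
Proof. by rewrite mulrBl expiD expiN !expiX conjcX. Qed.

Lemma trig_primitive_derive m n (t : R) :
  is_Cderive (trig_primitive m n) t (monomial m n (expi t)).
Proof.
rewrite /trig_primitive -expi_monomial; case: eqVneq => [->|mn].
  rewrite subrr mul0r expi0; split => /=; [exact: is_derive_id|exact: is_derive_cst].
have mn0 : 'i%C * (m%:R - n%:R) != 0 :> R[i].
  rewrite mulf_neq0 ?subr_eq0 ?eqr_nat//.
  by rewrite eq_complex /= oner_eq0 andbF.
apply: is_Cderive_eq (is_CderiveZ _ (is_Cderive_expi (m%:R - n%:R) t)) _.
by rewrite rmorphB/= !rmorph_nat mulrA mulVf// mul1r.
Qed.

Lemma trig_primitive_period m n (t : R) :
  trig_primitive m n (t + 2 * pi) - trig_primitive m n t =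
  (m == n)%:R * (2 * pi)%:C.
Proof.
rewrite /trig_primitive; case: eqP => [_|_]; first by rewrite rmorphD/= addrC addKr mul1r.
rewrite mul0r -mulrBr !expi_monomial.
by rewrite -[2 * pi]mul1r (expi_periodic 1) subrr mulr0.
Qed.

(** For F = z^a conj(z)^(b+1) the partial derivatives in x and y are U + V and i(U - V), where V is
    b + 1 times the wanted monomial. Green's formula integrates both over the disc, and 2V = (U + V)
    + i (i (U - V)) isolates the moment. *)
Lemma disc_moment a b r : 0 < r ->
  Cintegral mu2 (disc r) (fun p => monomial a b (p.1 +i* p.2)) =
  (a == b)%:R * (pi * r ^+ (a + a).+2 / a.+1%:R)%:C.
Proof.
move=> r0.
pose F x y := monomial a b.+1 (x +i* y).
pose U x y : R[i] := a%:R * monomial a.-1 b.+1 (x +i* y).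
pose V x y : R[i] := b.+1%:R * monomial a b (x +i* y).
have pU : cpolyfun U by apply: cpolyfunM; [exact: cpolyfun_cst|exact: cpolyfun_monomial].
have pV : cpolyfun V by apply: cpolyfunM; [exact: cpolyfun_cst|exact: cpolyfun_monomial].
have pF : cpolyfun F by exact: cpolyfun_monomial.
have iU := cpolyfun_integrable (ltW r0) pU.
have iV := cpolyfun_integrable (ltW r0) pV.
have mD := measurable_disc (ltW r0).
(* On the circle F contributes r^(a+b+1) and r cos t contributes r/2 times a sum of two opposite
   characters. Hence this constant, and two Kronecker symbols in each boundary integral. *)
pose c : R[i] := r%:C ^+ (a + b).+2 / 2.
have dX x y : is_Cderive (F ^~ y) x (U x y + V x y).
  have h := is_Cderive_x x y.
  apply: is_Cderive_eq (is_CderiveM (is_CderiveX a h)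
    (is_CderiveX b.+1 (is_Cderive_conj h))) _.
  by rewrite /U /V /monomial conjc1 !mulr1 /=; ring.
have dY x y : is_Cderive (F x) y ('i%C * (U x y - V x y)).
  have h := is_Cderive_y x y.
  apply: is_Cderive_eq (is_CderiveM (is_CderiveX a h)
    (is_CderiveX b.+1 (is_Cderive_conj h))) _.
  have -> : conjc 'i%C = - 'i%C :> R[i] by apply: complex_ext => /=; rewrite ?oppr0.
  by rewrite /U /V /monomial /=; ring.
have uv t : expi t * conjc (expi t) = 1 :> R[i].
  by rewrite mulcJ rnorm_expi expr1n.
have cosE t : (r * cos t)%:C = r%:C * (expi t + conjc (expi t)) / 2 :> R[i].
  apply: complex_ext; rewrite /expi /= ?mul0r ?mulr0 ?subr0 ?addr0 ?subrr; last first.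
    by rewrite ?mulr0 ?mul0r ?addr0 ?oppr0 ?mulr0 ?addr0.
  by rewrite ?mulr0 ?mul0r ?addr0 ?oppr0 ?mulr0 ?subr0; field.
have hX := @Cgreen_x (fun x y => U x y + V x y) F
  (fun t => c * (trig_primitive a b t + trig_primitive a b.+2 t)) r r0 (cpolyfunD pU pV) pF dX.
have hY := @Cgreen_y (fun x y => 'i%C * (U x y - V x y)) F
  (fun t => c * 'i%C ^+ a * (- 'i%C) ^+ b.+1 * (trig_primitive b.+2 a t + trig_primitive b a t)) r r0.
have {}hX : Cintegral mu2 (disc r) (fun p => U p.1 p.2 + V p.1 p.2) =
    c * (2 * pi)%:C * ((a == b)%:R + (a == b.+2)%:R).
  rewrite hX => [|t].
    rewrite -mulrBr opprD addrACA !trig_primitive_period.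
    by move: (2 * pi)%:C => x; ring.
  apply: is_Cderive_eq (is_CderiveZ c (is_CderiveD (trig_primitive_derive _ _ _)
    (trig_primitive_derive _ _ _))) _.
  rewrite cosE /F /c /monomial.
  have -> : (r * cos t) +i* (r * sin t) = r%:C * expi t.
    by apply: complex_ext; rewrite ?ReZ ?ImZ.
  rewrite conjcM conjc_real; move: (uv t); set u := expi t; set v := conjc u => uv1.
  have -> : u ^+ a * v ^+ b = u ^+ a * v ^+ b * (u * v) by rewrite uv1 mulr1.
  rewrite !exprMn !exprS exprD.
  move: (u ^+ a) (v ^+ b) (r%:C ^+ a) (r%:C ^+ b) => A B ra rb; ring.
have {}hY : Cintegral mu2 (disc r) (fun p => 'i%C * (U p.1 p.2 - V p.1 p.2)) =
    c * 'i%C ^+ a * (- 'i%C) ^+ b.+1 * (2 * pi)%:C * ((a == b)%:R + (a == b.+2)%:R).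
  rewrite hY => [||//|//|t].
  - rewrite -mulrBr opprD addrACA !trig_primitive_period (eq_sym b.+2) (eq_sym b).
    by move: (2 * pi)%:C => x; ring.
  - apply: cpolyfunM; first exact: cpolyfun_cst.
    apply: cpolyfunD => //; have [V1 V2] := pV; split.
    + apply: (@polyfun_ext _ (fun x y => 0 - Re (V x y))).
        by move=> x y; rewrite sub0r ReN.
      by apply: polyfun_sub => //; exact: Polyfun_cst.
    + apply: (@polyfun_ext _ (fun x y => 0 - Im (V x y))).
        by move=> x y; rewrite sub0r ImN.
      by apply: polyfun_sub => //; exact: Polyfun_cst.
  - apply: is_Cderive_eq (is_CderiveZ _ (is_CderiveD (trig_primitive_derive _ _ _)
      (trig_primitive_derive _ _ _))) _.
    rewrite cosE /F /c /monomial.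
    have -> : (r * sin t) +i* (r * cos t) = r%:C * ('i%C * conjc (expi t)).
      by apply: complex_ext; rewrite ?ReZ ?ImZ ?ReM ?ImM /=; ring.
    rewrite conjcM conjc_real conjcM conjcK.
    have -> : conjc 'i%C = - 'i%C :> R[i] by apply: complex_ext => /=; rewrite ?oppr0.
    move: (uv t); set u := expi t; set v := conjc u => uv1.
    have -> : u ^+ b * v ^+ a = u ^+ b * v ^+ a * (u * v) by rewrite uv1 mulr1.
    rewrite !exprMn !(exprS u) !(exprS r%:C) exprD.
    move: (v ^+ a) (u ^+ b) (r%:C ^+ a) (r%:C ^+ b) ('i%C ^+ a) ((- 'i%C) ^+ b.+1)
      => A B ra rb i1 i2; ring.
pose MU := Cintegral mu2 (disc r) (fun p => U p.1 p.2).
pose MV := Cintegral mu2 (disc r) (fun p => V p.1 p.2).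
have iN : Cintegrable mu2 (disc r) (fun p => -1 * V p.1 p.2) by exact: CintegrableZ.
have eX : MU + MV = c * (2 * pi)%:C * ((a == b)%:R + (a == b.+2)%:R).
  by rewrite -hX CintegralD.
have eY : 'i%C * (MU - MV) = c * 'i%C ^+ a * (- 'i%C) ^+ b.+1 * (2 * pi)%:C *
    ((a == b)%:R + (a == b.+2)%:R).
  rewrite -hY -mulN1r -CintegralZ// -CintegralD// -CintegralZ//; last exact: CintegrableD.
  by apply: eq_Cintegral => p _; rewrite mulN1r.
have eV : MV = b.+1%:R * Cintegral mu2 (disc r) (fun p => monomial a b (p.1 +i* p.2)).
  by rewrite -CintegralZ//; exact: (cpolyfun_integrable (ltW r0) (cpolyfun_monomial a b)).
have ii : 'i%C * 'i%C = -1 :> R[i] by rewrite -expr2 sqr_i.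
have iNi n : 'i%C ^+ n * (- 'i%C) ^+ n = 1 :> R[i].
  by rewrite -exprMn mulrN ii opprK expr1n.
have e2 : 2 * MV = (MU + MV) + 'i%C * ('i%C * (MU - MV)).
  by rewrite mulrA ii; ring.
have b0 : b.+1%:R != 0 :> R[i] by rewrite pnatr_eq0.
have two0 : 2 != 0 :> R[i] by rewrite pnatr_eq0.
move: e2; rewrite eX eY eV; set M := Cintegral _ _ _ => e2.
apply: (mulfI b0); apply: (mulfI two0); rewrite e2 {e2}.
have [ab|ab] := eqVneq a b.
  have -> : (a == b.+2) = false by rewrite ab; apply/negbTE; rewrite neq_ltn ltnS leqnSn.
  have rcM (x y : R) : (x * y)%:C = x%:C * y%:C by exact: rmorphM.
  have -> : (pi * r ^+ (a + a).+2 / a.+1%:R)%:C =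
      pi%:C * r%:C ^+ (a + a).+2 / a.+1%:R :> R[i].
    rewrite (rcM (pi * _)) (rcM pi); congr (_ * _ * _); first exact: rmorphXn.
    by rewrite [LHS]fmorphV; congr (_^-1); exact: rmorph_nat.
  have -> : (2 * pi)%:C = 2 * pi%:C :> R[i].
    by rewrite rcM; congr (_ * _); exact: rmorph_nat.
  rewrite /c ab mul1r addr0 !mulr1.
  have hk : 'i%C * ('i%C ^+ b * (- 'i%C) ^+ b.+1) = 1 :> R[i].
    rewrite (exprS (- 'i%C) b).
    transitivity (- ('i%C * 'i%C) * ('i%C ^+ b * (- 'i%C) ^+ b) : R[i]); first by ring.
    by rewrite iNi ii opprK mul1r.
  transitivity ((1 + 'i%C * ('i%C ^+ b * (- 'i%C) ^+ b.+1)) *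
    (r%:C ^+ (b + b).+2 / 2 * (2 * pi%:C)) : R[i]).
    by move: ('i%C ^+ b) ((- 'i%C) ^+ b.+1) (r%:C ^+ _) => x y t; ring.
  rewrite hk; move: (r%:C ^+ _) (b.+1%:R) b0 => x y y0.
  by field; rewrite ?two0 ?y0.
(* The Kronecker symbol at a = b + 2 comes from the other character in r cos t; its contributions to
   the two boundary integrals have opposite signs and cancel. *)
rewrite mul0r !mulr0 add0r; have [ab2|_] := eqVneq a b.+2; last by rewrite !mulr0 addr0.
rewrite ab2.
have -> : 'i%C ^+ b.+2 = 'i%C * 'i%C ^+ b.+1 :> R[i] by rewrite exprS.
have -> : (c * ('i%C * 'i%C ^+ b.+1) * (- 'i%C) ^+ b.+1 * (2 * pi)%:C * 1) =
  c * 'i%C * ('i%C ^+ b.+1 * (- 'i%C) ^+ b.+1) * (2 * pi)%:C by ring.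
rewrite iNi mulr1 mulr1.
have -> : 'i%C * (c * 'i%C * (2 * pi)%:C) = ('i%C * 'i%C) * (c * (2 * pi)%:C) by ring.
by rewrite ii mulN1r subrr.
Qed.

End DiscMoments.

(** * Area integrals of products of series, and the limit at radius 1 *)

Section AreaIntegral.
Variable R : realType.
Local Notation mu := (@lebesgue_measure R).
Local Notation mu2 := (mu \x mu)%E.

Lemma cvg_complexM {T : Type} (F : set_system T) {FF : ProperFilter F}
    (u v : T -> R[i]) (l m : R[i]) :
  u @ F --> l -> v @ F --> m -> (fun t => u t * v t) @ F --> l * m.
Proof.
move=> ul vm; apply: cvg_ReIm.
- rewrite ReM; under eq_fun do rewrite ReM.
  by apply: cvgB; apply: cvgM; [exact: cvg_Re ul|exact: cvg_Re vm|exact: cvg_Im ul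
    |exact: cvg_Im vm].
- rewrite ImM; under eq_fun do rewrite ImM.
  by apply: cvgD; apply: cvgM; [exact: cvg_Re ul|exact: cvg_Im vm|exact: cvg_Im ul
    |exact: cvg_Re vm].
Qed.

(** Both factors are truncated at the same [N], so the diagonal moments give exactly the N-th
    partial sum; two weights n + 1 and the denominator n + 1 of the moment leave one weight. The
    truncated products are bounded by the constant [K * K] on the disc, whose area is finite, and
    dominated convergence applies. *)
Lemma deriv_product_integral (c d : nat -> R[i]) (C r : R) : 0 < r -> r < 1 ->
  (forall n, rnorm (c n.+1) <= C) -> (forall n, rnorm (d n.+1) <= C) ->
  let f p := pos_series_deriv c (p.1 +i* p.2) * conjc (pos_series_deriv d (p.1 +i* p.2)) in
  Cintegrable mu2 (disc r) f /\
  series (fun n => n.+1%:R * c n.+1 * conjc (d n.+1) * (pi * (r ^+ 2) ^+ n.+1)%:C) @ \oo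
    --> Cintegral mu2 (disc r) f.
Proof.
move=> r0 r1 cC dC f.
have mD := measurable_disc (ltW r0).
pose c' n := n.+1%:R * c n.+1; pose d' n := n.+1%:R * d n.+1.
pose z (p : R * R) := p.1 +i* p.2.
pose S (u : nat -> R[i]) N p := \sum_(0 <= n < N) u n * z p ^+ n.
pose fN N p := S c' N p * conjc (S d' N p).
have fNE N p : fN N p = \sum_(0 <= n < N) \sum_(0 <= m < N)
    (c' n * conjc (d' m)) * monomial n m (z p).
  rewrite /fN /S (rmorph_sum (@conjc R)) mulr_suml; apply: eq_bigr => n _.
  rewrite mulr_sumr; apply: eq_bigr => m _.
  rewrite /monomial -[X in _ * X = _]/(conjc (d' m * z p ^+ m)) conjcM conjcX.
  by rewrite mulrACA.
have im0 n m : Cintegrable mu2 (disc r) (fun p => monomial n m (z p)).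
  have := cpolyfun_integrable (ltW r0) (cpolyfun_monomial R n m).
  by rewrite /z.
have im n m : Cintegrable mu2 (disc r) (fun p => (c' n * conjc (d' m)) * monomial n m (z p)).
  exact: CintegrableZ.
have iN N : Cintegrable mu2 (disc r) (fN N).
  apply: (eq_Cintegrable mD (f := fun p => \sum_(0 <= n < N) \sum_(0 <= m < N)
    (c' n * conjc (d' m)) * monomial n m (z p))); first by move=> p _; rewrite fNE.
  by apply: Cintegrable_sum => // n; apply: Cintegrable_sum => // m.
have intN N : Cintegral mu2 (disc r) (fN N) = series (fun n =>
    n.+1%:R * c n.+1 * conjc (d n.+1) * (pi * (r ^+ 2) ^+ n.+1)%:C) N.
  have -> : fN N = fun p => \sum_(0 <= n < N) \sum_(0 <= m < N)
    (c' n * conjc (d' m)) * monomial n m (z p) by apply/funext => p; exact: fNE.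
  rewrite Cintegral_sum// => [|n]; last by apply: Cintegrable_sum => // m.
  rewrite /series /= big_nat [RHS]big_nat; apply: eq_bigr => n /andP[_ nN].
  rewrite Cintegral_sum//.
  rewrite (bigD1_seq n) ?iota_uniq ?mem_index_iota//= big1 ?addr0.
    rewrite CintegralZ//.
    rewrite disc_moment// eqxx mul1r /c' /d' conjcM conjc_nat.
    have -> : (pi * r ^+ (n + n).+2 / n.+1%:R)%:C =
      (pi * (r ^+ 2) ^+ n.+1)%:C / n.+1%:R :> R[i].
      rewrite -exprM mulnS mul2n -addnn add2n [LHS]rmorphM; congr (_ * _).
      by rewrite [LHS]fmorphV; congr (_^-1); exact: rmorph_nat.
    have n0 : n.+1%:R != 0 :> R[i] by rewrite pnatr_eq0.
    by move: (n.+1%:R) n0 (conjc (d _)) (_%:C) => x x0 y t; field.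
  move=> m mn; rewrite CintegralZ//.
  by rewrite disc_moment// eq_sym (negPf mn) mul0r mulr0.
pose K := C * ((1 - r)^-1 / (1 - r)).
have Sb (u : nat -> R[i]) N p : (forall n, rnorm (u n.+1) <= C) -> disc r p ->
    rnorm (S (fun n => n.+1%:R * u n.+1) N p) <= K.
  move=> uC pr; apply: le_trans (rnorm_sum _ _ _) _.
  exact: (pos_series_deriv_bound uC N pr r1).
have Sc (u : nat -> R[i]) p : (forall n, rnorm (u n.+1) <= C) -> disc r p ->
    (fun N => S (fun n => n.+1%:R * u n.+1) N p) @ \oo --> pos_series_deriv u (z p).
  by move=> uC pr; exact: (pos_series_deriv_cvg uC (le_lt_trans pr r1)).
have K0 : 0 <= K.
  apply: le_trans (Sb c 0%N (0, 0) cC _); first exact: rnorm_ge0.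
  by rewrite /disc /= (rnormR 0) normr0 ltW.
have [] := @Cdominated_convergence _ _ _ mu2 (disc r) mD fN f (fun=> K * K) iN.
- move=> p pr; apply: cvg_complexM; first exact: Sc.
  by apply: cvg_conjc; exact: Sc.
- apply: measurable_bounded_integrable => //.
  + exact: disc_finite (ltW r0).
  + exists `|K * K|; split; first exact: num_real.
    by move=> y Ky p _; exact: ltW.
- move=> N p pr; rewrite rnormM rnormJ; apply: ler_pM; do ?exact: rnorm_ge0; exact: Sb.
move=> i1 i2; split=> //; apply: cvg_trans i2.
by apply: near_eq_cvg; apply: nearW => N; rewrite intN.
Qed.

(** The series of |k_n| is cut at [N]. The tail is small uniformly in r because the factors 1 -
    r^(2n+2) lie in [0, 1], and the head [q r] is a finite sum that tends to 0 as r tends to 1. *)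
Lemma abel_limit (k : nat -> R[i]) (F : R -> R[i]) (S : R[i]) (B : R) :
  (forall n, \sum_(0 <= i < n) rnorm (k i) <= B) ->
  series k @ \oo --> S ->
  (forall r : R, 0 < r -> r < 1 ->
     series (fun n => k n * ((r ^+ 2) ^+ n.+1)%:C) @ \oo --> F r) ->
  F r @[r --> 1^'-] --> S.
Proof.
move=> kB kS kF; apply/cvg_rnormP/cvgrPdist_le => e e0.
have e20 : 0 < e / 2 by rewrite divr_gt0.
have [N hN] := bounded_sum_cauchy (fun n => rnorm_ge0 (k n)) kB e20.
pose q r := \sum_(0 <= n < N) rnorm (k n) * (1 - (r ^+ 2) ^+ n.+1).
have q1 : q r @[r --> (1 : R)^'-] --> (0 : R).
  rewrite [X in _ --> X](_ : 0 = \sum_(0 <= n < N) 0 :> R); last by rewrite big1.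
  apply: cvg_sum_nat => n; rewrite -[X in _ --> X](mulr0 (rnorm (k n))).
  apply: cvgMr.
  have h : continuous (fun r : R => 1 - (r ^+ 2) ^+ n.+1).
    move=> r; apply: cvgB; first exact: cvg_cst.
    by under eq_fun do rewrite -exprM; rewrite -exprM; exact: exprn_continuous.
  have := cvg_at_left_filter (h 1); by rewrite expr1n expr1n subrr.
move: q1 => /cvgrPdist_le/(_ _ e20) q1.
near=> r; rewrite sub0r normrN ger0_norm ?rnorm_ge0//.
have r1 : r < 1 by near: r; exact: nbhs_left_lt.
have r0 : 0 < r by near: r; exact: nbhs_left_gt.
have qr : q r <= e / 2.
  have : `|0 - q r| <= e / 2 by near: r; exact: q1.
  by rewrite sub0r normrN; apply: le_trans; exact: ler_norm.
have p01 n : 0 <= 1 - (r ^+ 2) ^+ n.+1 <= 1.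
  by rewrite subr_ge0 !exprn_ile1 ?sqr_ge0 ?(ltW r0) ?(ltW r1)//= gerBl !exprn_ge0// ltW.
have h := cvgB (kF r r0 r1) kS.
have {}h := cvg_rnorm (h _).
apply: (cvgr_to_le (h _ _)); apply: nearW => n.
rewrite -[X in rnorm X]/(_ n - _ n) /series /= -sumrB.
apply: le_trans (rnorm_sum _ _ _) _.
(* Enlarging the range to [maxn N n] only adds nonnegative terms, and allows the sum to be cut at
   [N] even when n < N. *)
apply: (@le_trans _ _ (\sum_(0 <= i < maxn N n) rnorm (k i) * (1 - (r ^+ 2) ^+ i.+1))).
  rewrite (big_cat_nat (leq0n n) (leq_maxr N n))/=.
  apply: ler_wpDr; first by apply: sumr_ge0 => i _; rewrite mulr_ge0 ?rnorm_ge0//; have /andP[] := p01 i.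
  apply: ler_sum => i _; rewrite -{2}[k i]mulr1 -mulrBr rnormM ler_wpM2l ?rnorm_ge0//.
  rewrite rnormBC -[1 - _]/((1 : R)%:C - _) -rmorphB/= rnormR ger0_norm//.
  by have /andP[] := p01 i.
rewrite (big_cat_nat (leq0n N) (leq_maxl N n))/= [leRHS]splitr; apply: lerD => //.
apply: le_trans (hN N (maxn N n) (leqnn N)); apply: ler_sum => i _.
by rewrite ler_piMr ?rnorm_ge0//; have /andP[] := p01 i.
Unshelve. all: by end_near. Qed.

End AreaIntegral.

(** * The two series *)

Section MainTheorem.
Variable R : realType.
Local Notation mu := (@lebesgue_measure R).

(* The general term of the common series expansion of both sides. *)
Definition trace_term (psi : R -> R[i]) (t : nat -> R[i]) n : R[i] :=
  fourier psi (- n.+1%:Z) * conjc (t n) + fourier psi n.+1%:Z * t n.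

Lemma op_tilde_trace_gen (H : hilbertType R) (psi : R -> R[i]) (T T0 : bop H) :
  rnorm T <= 1 -> rnorm T0 <= 1 -> trace_class (T - T0) -> class_Gtilde psi ->
  trace_class (op_tilde psi T - op_tilde psi T0) /\
  series (trace_term psi (fun n => trace (T ^+ n.+1 - T0 ^+ n.+1))) @ \oo
    --> trace (op_tilde psi T - op_tilde psi T0).
Proof.
move=> T1 T01 TT0 hpsi.
have [he|he] := pselect (orthonormal_basis (@onb R H)); first exact: op_tilde_trace.
(* Without a basis, [onb] is [0] and every trace vanishes. *)
have onb0 : @onb R H = fun=> 0.
  by apply: xgetPN => e ee; apply: he; exact: (xgetPex _ (ex_intro _ e ee)).
have tr0 (X : bop H) : trace X = 0.
  rewrite /trace onb0; apply: rcvg_lim; rewrite (_ : series _ = cst 0); first exact: cvg_cst.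
  by apply/funext => n; rewrite /series /= big1// => k _; rewrite inner0r.
split.
  rewrite /trace_class onb0; under eq_eseriesr do rewrite inner0r.
  by rewrite eseries0// ltry.
rewrite tr0 (_ : series _ = cst 0); first exact: cvg_cst.
apply/funext => n; rewrite /series /= big1// => k _.
by rewrite /trace_term !tr0 conjc0 !mulr0 addr0.
Qed.

Variables (xi : R -> R) (psi : R -> R[i]).
Hypothesis hxi : mu.-integrable `[0, 2 * pi]%classic (EFin \o xi).
Hypothesis hpsi : class_Gtilde psi.
Let xiC t := (xi t)%:C.
Let t n : R[i] := 'i%C * n.+1%:R * (2 * pi)%:C * fourier xiC (- n.+1%:Z).

(** The coefficients of [xi] are merely bounded; the weight n + 1 in [t n] is absorbed by the
    summability of |n psi^(n)|. *)
Lemma trace_term_summable : exists B, forall N,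
  \sum_(0 <= n < N) rnorm (trace_term psi t n) <= B.
Proof.
have [C hC] := gtilde_summable hpsi; have [K hK] := fourier_bounded hxi.
have K0 : 0 <= K by apply: le_trans (hK 0); exact: rnorm_ge0.
have p0 : 0 <= 2 * pi :> R by rewrite mulr_ge0// pi_ge0.
exists (2 * pi * K * C) => N.
apply: le_trans (ler_wpM2l (mulr_ge0 p0 K0) (hC N.+1)).
rewrite big_nat_recl// mul0r add0r mulr_sumr; apply: ler_sum => n _.
have tn : rnorm (t n) <= n.+1%:R * (2 * pi * K).
  rewrite /t; move: (hK (- n.+1%:Z)); move: (fourier _ _) => y yK.
  by rewrite !rnormM rnormi mul1r rnorm_nat rnormR ger0_norm// -mulrA !ler_wpM2l.
rewrite /trace_term; apply: le_trans (rnormD _ _) _.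
rewrite (rnormM (fourier psi _) (conjc _)) (rnormM (fourier psi _) (t n)) rnormJ -mulrDl.
rewrite [rnorm (fourier psi (- _)) + _]addrC [leRHS]mulrCA [leRHS]mulrA mulrC.
by rewrite ler_wpM2r ?addr_ge0 ?rnorm_ge0.
Qed.

(** With p and q the holomorphic and antiholomorphic coefficients, the Jacobian is p1' conj(q2') -
    p2' conj(q1'). Each product integrates to a diagonal series, and the factor -2i times pi
    reproduces the 2 pi i of the trace side. *)
Lemma disc_integral_series (r : R) : 0 < r -> r < 1 ->
  series (fun n => trace_term psi t n * ((r ^+ 2) ^+ n.+1)%:C) @ \oo -->
  disc_integral (wirtinger_jacobian (poisson xiC) (tilde psi)) r.
Proof.
move=> r0 r1.
have [C1 hC1] := gtilde_summable hpsi; have [C2 hC2] := fourier_bounded hxi.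
pose C := Num.max C1 C2.
have psiC n : rnorm (fourier psi n.+1%:Z) + rnorm (fourier psi (- n.+1%:Z)) <= C.
  rewrite le_max; apply/orP; left; apply: le_trans (hC1 n.+2).
  rewrite big_nat_recr//=; apply: ler_wpDl.
    by apply: sumr_ge0 => k _; rewrite mulr_ge0// addr_ge0 ?rnorm_ge0.
  by rewrite ler_peMl ?addr_ge0 ?rnorm_ge0// ler1n.
have xC n : rnorm (fourier xiC n) <= C by rewrite le_max hC2 orbT.
pose p1 n := fourier xiC n%:Z; pose q1 n := conjc (fourier xiC (- n%:Z)).
pose p2 n := fourier psi n%:Z; pose q2 n := conjc (fourier psi (- n%:Z)).
have p1C n : rnorm (p1 n.+1) <= C by exact: xC.
have q1C n : rnorm (q1 n.+1) <= C by rewrite rnormJ.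
have p2C n : rnorm (p2 n.+1) <= C.
  by apply: le_trans (psiC n); rewrite lerDl rnorm_ge0.
have q2C' n : rnorm (fourier psi (- n.+1%:Z)) <= C.
  by apply: le_trans (psiC n); rewrite lerDr rnorm_ge0.
have q2C n : rnorm (q2 n.+1) <= C by rewrite rnormJ.
have J1 z : rnorm z < 1 -> poisson xiC z =
    fourier xiC 0 + conjc (pos_series q1 z) + pos_series p1 z.
  by move=> z1; rewrite (poisson_tilde hxi z1); exact: (tilde_pos_series p1C (fun n => xC _) z1).
have J2 z : rnorm z < 1 -> tilde psi z =
    fourier psi 0 + conjc (pos_series q2 z) + pos_series p2 z.
  by move=> z1; exact: (tilde_pos_series p2C q2C' z1).
have [i1 l1] := deriv_product_integral r0 r1 p1C q2C.
have [i2 l2] := deriv_product_integral r0 r1 p2C q1C.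
have mD := measurable_disc (ltW r0).
pose g1 (p : R * R) := pos_series_deriv p1 (p.1 +i* p.2) *
  conjc (pos_series_deriv q2 (p.1 +i* p.2)).
pose g2 (p : R * R) := pos_series_deriv p2 (p.1 +i* p.2) *
  conjc (pos_series_deriv q1 (p.1 +i* p.2)).
have i2N : Cintegrable (mu \x mu)%E (disc r) (fun p => -1 * g2 p) := CintegrableZ mD (-1) i2.
have e1 := CintegralD mD i1 i2N; have e2 := CintegralZ mD (-1) i2.
rewrite mulN1r in e2; rewrite e2 in e1.
have JE : disc_integral (wirtinger_jacobian (poisson xiC) (tilde psi)) r =
    - 2 * 'i%C * (Cintegral (mu \x mu)%E (disc r) g1 - Cintegral (mu \x mu)%E (disc r) g2).
  rewrite /disc_integral; congr (_ * _); apply: etrans e1.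
  apply: eq_Cintegral => p pr; have z1 := le_lt_trans pr r1.
  have [a1 a2] := wirtinger_harmonic p1C q1C J1 z1.
  have [b1 b2] := wirtinger_harmonic p2C q2C J2 z1.
  by rewrite /wirtinger_jacobian a1 a2 b1 b2 /g2 mulN1r.
rewrite JE.
have l3 : (fun N => - 2 * 'i%C *: (series (fun n => n.+1%:R * p1 n.+1 * conjc (q2 n.+1) *
      (pi * (r ^+ 2) ^+ n.+1)%:C) N - series (fun n => n.+1%:R * p2 n.+1 *
      conjc (q1 n.+1) * (pi * (r ^+ 2) ^+ n.+1)%:C) N)) @ \oo -->
    - 2 * 'i%C *: (Cintegral (mu \x mu)%E (disc r) g1 - Cintegral (mu \x mu)%E (disc r) g2).
  by apply: cvgZr; apply: cvgB; [exact: l1|exact: l2].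
apply: cvg_trans l3; apply: near_eq_cvg; apply: nearW => N.
rewrite /series -sumrB scaler_sumr; apply: eq_bigr => n _.
rewrite /trace_term /t /p1 /p2 /q1 /q2.
rewrite !conjcK.
(* Here the reality of [xi] enters: conjugation exchanges its coefficients of index n + 1 and -(n +
   1). *)
have -> : conjc ('i%C * n.+1%:R * (2 * pi)%:C * fourier xiC (- n.+1%:Z)) =
    conjc 'i%C * n.+1%:R * (2 * pi)%:C * fourier xiC n.+1%:Z.
  rewrite -{2}[n.+1%:Z]opprK (fourier_conj hxi (- _)).
  by move: (fourier _ _) => y; rewrite !conjcM conjc_real conjc_nat.
have -> : conjc 'i%C = - 'i%C :> R[i] by apply: complex_ext => /=; rewrite ?oppr0.
have -> : (pi * (r ^+ 2) ^+ n.+1)%:C = pi%:C * ((r ^+ 2) ^+ n.+1)%:C :> R[i].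
  exact: rmorphM.
have -> : (2 * pi)%:C = 2 * pi%:C :> R[i].
  by rewrite [LHS]rmorphM; congr (_ * _); exact: rmorph_nat.
rewrite -[LHS]/(- 2 * 'i%C * _).
move: (fourier psi n.+1) (fourier psi (- n.+1%:Z)) (fourier xiC n.+1)
  (fourier xiC (- n.+1%:Z)) (((r ^+ 2) ^+ n.+1)%:C) (pi%:C) (n.+1%:R) => a b c d e f g.
ring.
Qed.

End MainTheorem.

Theorem theorem3p3 (R : realType) (H : hilbertType R)
  (Hsep : separable H) (Hdim : infinite_dimensional H)
  (T T0 : bop H) (hT : `|T| <= 1) (hT0 : `|T0| < 1)
  (hTT0 : trace_class (T - T0))
  (xi : R -> R) (hxi : spectral_shift T T0 xi)
  (psi : R -> R[i]) (hpsi : class_Gtilde psi) :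
  trace_class (op_tilde psi T - op_tilde psi T0) /\
  disc_integral
    (wirtinger_jacobian (poisson (fun t => (xi t)%:C)) (tilde psi)) r @[r --> 1^'-]
  --> trace (op_tilde psi T - op_tilde psi T0).
Proof.
have T1 : rnorm T <= 1 by rewrite -lecR -normE.
have T01 : rnorm T0 <= 1 by rewrite -lecR -normE ltW.
have [h1 h2] := op_tilde_trace_gen T1 T01 hTT0 hpsi.
split=> //.
(* The spectral shift property gives the trace series the same general term as the area series at
   radius r, without its factor r^(2n+2). The limit r -> 1 then identifies the two sides. *)
have tE : (fun n => trace (T ^+ n.+1 - T0 ^+ n.+1)) =
    (fun n => 'i%C * n.+1%:R * (2 * pi)%:C * fourier (fun t => (xi t)%:C) (- n.+1%:Z)).
  by apply/funext => n; rewrite (spectral_shift_trace n.+1 hxi).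
rewrite tE in h2.
have [B hB] := trace_term_summable hxi.1 hpsi.
exact: (abel_limit hB h2 (disc_integral_series hxi.1 hpsi)).
Qed.
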